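(* Let $\mathbf Z$ be an AV-bundle over $M$. The special affine bundles $\overline{\mathsf T}\mathbf Z$ and $\overline{\mathsf L}\mathbf Z$ carry canonical Lie affgebroid structures for which the brackets are the commutators $[D,D']=D\circ D'-D'\circ D$ in $\mathrm{ADer}(\mathbf Z;\mathbf Z)$ and $\mathrm{ADO}^1(\mathbf Z;\mathbf Z)$, respectively (sections of these bundles being regarded as affine maps $\mathrm{Sec}(\mathbf Z)\to\mathrm{Sec}(\mathbf Z)$). The Lie algebroid hulls of $\overline{\mathsf T}\mathbf Z$ and $\overline{\mathsf L}\mathbf Z$ are $\breve{\mathsf L}\mathbf Z$ and $\mathsf R\mathbf Z$, respectively.
   Context: An AV-bundle $\zeta:\mathbf Z\to M$ is a rank-one affine bundle modelled on $M\times\mathbb R$ (equivalently a principal $(\mathbb R,+)$-bundle). $X_{\mathbf Z}$ is the vertical vector field on $\mathbf Z$ with flow $z\mapsto z-t$; in local affine coordinates $(x^a,s)$ it is $-\partial_s$. For a section $\sigma$, $\mathbf F_\sigma\in C^\infty(\mathbf Z)$ is $\mathbf F_\sigma(z)=\sigma(\zeta(z))-z$; for $f\in C^\infty(M)$, $\mathbf F_f=f\circ\zeta$. With $\mathrm{Pol}^n(\mathbf Z)=\{f:X_{\mathbf Z}^{n+1}(f)=0\}$, the linear first-order differential operators $D$ on $C^\infty(\mathbf Z)$ preserving all $\mathrm{Pol}^n(\mathbf Z)$, locally $D=f_a(x)\partial_{x^a}-(\alpha(x)s+\beta(x))\partial_s+\gamma(x)$, are the sections of a vector bundle $\mathsf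 R\mathbf Z\to M$, which is a Lie algebroid with the commutator bracket and anchor $D\mapsto f_a\partial_{x^a}$. Let $\phi^0,\phi^1\in\mathrm{Sec}((\mathsf R\mathbf Z)^* )$ be given by $[D,X_{\mathbf Z}]=\phi^0(D)X_{\mathbf Z}$, $\phi^1(D)=D(1)$; locally $\phi^0(D)=\alpha$, $\phi^1(D)=\gamma$. Subbundles of $\mathsf R\mathbf Z$: the Lie subalgebroids $\widetilde{\mathsf T}\mathbf Z=\{\phi^0=\phi^1=0\}$, $\breve{\mathsf L}\mathbf Z=\{\phi^1=0\}$, $\widetilde{\mathsf L}\mathbf Z=\{\phi^1=\phi^0\}$; the affine subbundles $\overline{\mathsf T}\mathbf Z=\{\phi^1=0,\ \phi^0=-1\}$ (sections locally $f_a\partial_{x^a}+(s-\beta)\partial_s$), modelled on $\widetilde{\mathsf T}\mathbf Z$, and $\overline{\mathsf L}\mathbf Z=\{\phi^1-\phi^0=1\}$ (sections locally $f_a\partial_{x^a}-((\alpha-1)s+\beta)\partial_s+\alpha$), modelled on $\widetilde{\mathsf L}\mathbf Z$. Both are special affine bundles (affine bundles with a distinguished nowhere-vanishing section of the model bundle), the distinguished section being $X_{\mathbf Z}$. A section $D$ of $\overline{\mathsf T}\mathbf Z$ or $\overline{\mathsf L}\mathbf Z$ acts on $\sigma\in\mathrm{Sec}(\mathbf Z)$ by $\mathbf F_{D(\sigma)}=D(\mathbf F_\sigma)$, $D(\sigma)\in\mathrm{Sec}(\mathbf Z)$; in this way $\mathrm{Sec}(\overline{\mathsf T}\mathbf Z)=\mathrm{ADer}(\mathbf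 Z;\mathbf Z)$ (locally $D(\sigma)=f_a\partial_{x^a}\sigma+\beta$) and $\mathrm{Sec}(\overline{\mathsf L}\mathbf Z)=\mathrm{ADO}^1(\mathbf Z;\mathbf Z)$ (locally $D(\sigma)=f_a\partial_{x^a}\sigma+\alpha\sigma+\beta$). Sections of $\widetilde{\mathsf T}\mathbf Z$, $\widetilde{\mathsf L}\mathbf Z$ act by the same formula with values in $C^\infty(M)$, and the commutator $D\circ D'-D'\circ D:\mathrm{Sec}(\mathbf Z)\to C^\infty(M)$ (pointwise difference of sections of $\mathbf Z$) is regarded as a section of the model bundle via this action. A Lie affgebroid structure on an affine bundle $A\to M$ modelled on $\mathsf V(A)$ consists of a bi-affine (over $\mathbb R$) map $[\cdot,\cdot]:\mathrm{Sec}(A)\times\mathrm{Sec}(A)\to\mathrm{Sec}(\mathsf V(A))$ that is skew-symmetric and satisfies the Jacobi identity $[\sigma_1,[\sigma_2,\sigma_3]]^2_{\mathsf v}+[\sigma_2,[\sigma_3,\sigma_1]]^2_{\mathsf v}+[\sigma_3,[\sigma_1,\sigma_2]]^2_{\mathsf v}=0$, where $[\sigma,X]^2_{\mathsf v}=[\sigma,\sigma'+X]-[\sigma,\sigma']$ is the linear part in the second argument, together with an affine bundle morphism $\gamma:A\to TM$ over $\mathrm{id}_M$ such that $[\sigma,fX]^2_{\mathsf v}=f[\sigma,X]^2_{\mathsf v}+\gamma(\sigma)(f)X$ for $\sigma\in\mathrm{Sec}(A)$, $X\in\mathrm{Sec}(\mathsf V(A))$, $f\in C^\infty(M)$. The vector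 hull $\widehat A$ of $A$ is the vector bundle (unique up to canonical isomorphism) containing $A$ as an affine hyperbundle not meeting the zero section. The Lie algebroid hull of a Lie affgebroid $A$ is the unique Lie algebroid structure on $\widehat A$ whose bracket extends the Lie affgebroid bracket of $\mathrm{Sec}(A)$. *)

(* Defs.v *)
From HB Require Import structures.
From mathcomp Require Import all_boot all_order all_algebra.
From mathcomp Require Import all_classical all_reals all_analysis.
Set Implicit Arguments.
Unset Strict Implicit.
Unset Printing Implicit Defensive.
Import Order.TTheory GRing.Theory Num.Theory.
Import numFieldNormedType.Exports.
Local Open Scope classical_set_scope.
Local Open Scope ring_scope.

(** * Smooth functions and smooth manifolds *)

(* Used for open U in 'rV_n and 'rV_n * R only, where existence and
   continuity of all iterated directional derivatives is the usual C^k.       *)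
Fixpoint Ck (R : realType) (V : normedModType R) (k : nat)
    (U : set V) (f : V -> R) {struct k} : Prop :=
  (forall x, U x -> {for x, continuous f}) /\
  match k with
  | 0%N => True
  | k'.+1 => forall v, (forall x, U x -> derivable f x v) /\
                       Ck k' U (fun x => 'D_v f x)
  end.

Definition smooth (R : realType) (V : normedModType R)
  (U : set V) (f : V -> R) := forall k, Ck k U f.

(* cmap is only meaningful on cdom, and cinv on cimg.                         *)
Record chart (R : realType) (n : nat) (M : Type) := Chart {
  cdom : set M;
  cimg : set 'rV[R]_n;
  cmap : M -> 'rV[R]_n;
  cinv : 'rV[R]_n -> M }.

Record manifold (R : realType) (n : nat) := Manifold {
  carrier :> topologicalType;
  carrier_hausdorff : hausdorff_space carrier;
  carrier_second_countable : @second_countable carrier;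
  atlas : set (chart R n carrier);
  atlas_cover : forall m, exists2 c, atlas c & cdom c m;
  atlas_open : forall c, atlas c -> open (cdom c) /\ open (cimg c);
  atlas_map : forall c m, atlas c -> cdom c m ->
    cimg c (cmap c m) /\ cinv c (cmap c m) = m;
  atlas_inv : forall c x, atlas c -> cimg c x ->
    cdom c (cinv c x) /\ cmap c (cinv c x) = x;
  atlas_map_cont : forall c m, atlas c -> cdom c m ->
    {for m, continuous (cmap c)};
  atlas_inv_cont : forall c x, atlas c -> cimg c x ->
    {for x, continuous (cinv c)};
  atlas_smooth : forall c c', atlas c -> atlas c' -> forall i : 'I_n,
    smooth (cimg c `&` cinv c @^-1` cdom c')
           (fun x => cmap c' (cinv c x) 0 i) }.

Section Bundles.
Context {R : realType} {n : nat} {M : manifold R n}.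

Definition smooth_on (U : set M) (f : M -> R) :=
  forall c, atlas c -> smooth (cimg c `&` cinv c @^-1` U) (f \o cinv c).

Definition Cinf (f : M -> R) := smooth_on setT f.

Definition tangent_vector (m : M) (v : (M -> R) -> R) :=
  (forall t f g, Cinf f -> Cinf g -> v (t *: f + g) = t * v f + v g) /\
  (forall f g, Cinf f -> Cinf g -> v (f * g) = v f * g m + f m * v g).

(** * Vector bundles, affine bundles, Lie algebroids and Lie affgebroids *)

(* A bundle over M given by its fibres, realised inside one (possibly
   infinite-dimensional) vector space W, and its set of global smooth
   sections.  Over a second countable Hausdorff M local sections extend
   globally after shrinking, so global sections determine the smooth
   structure.                                                                 *)
Record bundle (W : lmodType R) := Bundle {
  fib : M -> set W;
  sec : set (M -> W) }.

Section Generic.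
Context {W : lmodType R}.
Implicit Types (E A V H : bundle W) (br : (M -> W) -> (M -> W) -> (M -> W))
  (rho : M -> W -> (M -> R) -> R).

Definition local_frame E (r : nat) (U : set M) (e : 'I_r -> M -> W) :=
  [/\ open U,
      forall i, sec E (e i) &
      forall y, U y -> (forall i, fib E y (e i y)) /\
        (forall v, fib E y v ->
           exists! a : 'rV[R]_r, v = \sum_i a 0 i *: e i y)].

Definition vector_bundle (r : nat) E :=
  [/\ forall m, fib E m 0,
      forall m (t : R) v w, fib E m v -> fib E m w -> fib E m (t *: v + w),
      forall m, exists U e, local_frame E U (r:=r) e /\ U m &
      forall s, sec E s <->
        forall U e, local_frame E U (r:=r) e ->
          exists a : 'I_r -> M -> R, (forall i, smooth_on U (a i)) /\
            forall y, U y -> s y = \sum_i a i y *: e i y].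

Definition restr E (P : M -> set W) : bundle W :=
  Bundle P [set s | sec E s /\ forall m, P m (s m)].

(* A is an affine subbundle, modelled on V, of the vector bundle E.           *)
Definition affine_subbundle E A V :=
  [/\ exists r, vector_bundle r V,
      V = restr E (fib V),
      A = restr E (fib A) &
      forall m, exists U s, [/\ open U, U m, sec E s &
        forall y, U y -> fib A y = [set w | fib V y (w - s y)]]].

Definition special_affine_subbundle E A V (x : M -> W) :=
  [/\ affine_subbundle E A V, sec V x & forall m, x m <> 0].

Definition lie_algebroid E br rho :=
  [/\ exists r, vector_bundle r E,
      [/\ forall X Y, sec E X -> sec E Y -> sec E (br X Y),
          forall (t : R) X Y Z, sec E X -> sec E Y -> sec E Z ->
            br (t *: X + Y) Z = t *: br X Z + br Y Z,
          forall X Y, sec E X -> sec E Y -> br X Y = - br Y X &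
          forall X Y Z, sec E X -> sec E Y -> sec E Z ->
            br X (br Y Z) + br Y (br Z X) + br Z (br X Y) = 0],
      [/\ forall m v, fib E m v -> tangent_vector m (rho m v),
          forall m (t : R) v w f, fib E m v -> fib E m w -> Cinf f ->
            rho m (t *: v + w) f = t * rho m v f + rho m w f &
          forall s f, sec E s -> Cinf f -> Cinf (fun m => rho m (s m) f)] &
      forall X Y f, sec E X -> sec E Y -> Cinf f ->
        br X (fun m => f m *: Y m) =
        (fun m => f m *: br X Y m + rho m (X m) f *: Y m)].

(* The linear part in the second argument; it does not depend on s' when br
   is affine, and below s' is universally quantified over the sections of A.  *)
Definition linear_part br (s' s X : M -> W) := br s (s' + X) - br s s'.

Definition lie_affgebroid E A V br rho :=
  [/\ affine_subbundle E A V,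
      forall s s', sec A s -> sec A s' -> sec V (br s s'),
      [/\ forall (t : R) s1 s2 s, sec A s1 -> sec A s2 -> sec A s ->
            br (t *: s1 + (1 - t) *: s2) s =
              t *: br s1 s + (1 - t) *: br s2 s /\
            br s (t *: s1 + (1 - t) *: s2) =
              t *: br s s1 + (1 - t) *: br s s2,
          forall s s', sec A s -> sec A s' -> br s s' = - br s' s &
          forall s' s1 s2 s3, sec A s' -> sec A s1 -> sec A s2 -> sec A s3 ->
            linear_part br s' s1 (br s2 s3) + linear_part br s' s2 (br s3 s1)
            + linear_part br s' s3 (br s1 s2) = 0],
      (* the anchor is an affine bundle morphism to TM *)
      [/\ forall m v, fib A m v -> tangent_vector m (rho m v),
          forall m (t : R) v w f, fib A m v -> fib A m w -> Cinf f ->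
            rho m (t *: v + (1 - t) *: w) f =
              t * rho m v f + (1 - t) * rho m w f &
          forall U s f, open U -> sec E s -> (forall y, U y -> fib A y (s y)) ->
            Cinf f -> smooth_on U (fun m => rho m (s m) f)] &
      forall s' s X f, sec A s' -> sec A s -> sec V X -> Cinf f ->
        linear_part br s' s (fun m => f m *: X m) =
        (fun m => f m *: linear_part br s' s X m + rho m (s m) f *: X m)].

(* A sits in the vector bundle H as an affine hyperbundle not meeting the
   zero section.                                                              *)
Definition vector_hull A V H :=
  [/\ exists r, vector_bundle r H,
      affine_subbundle H A V,
      forall m, ~ fib A m 0 &
      forall m a v, fib A m a -> fib H m v ->
        exists t : R, fib V m (v - t *: a)].

Definition bracket_extends A br H (brH : (M -> W) -> (M -> W) -> (M -> W)) :=
  forall s s', sec A s -> sec A s' -> brH s s' = br s s'.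

Definition lie_algebroid_hull A V br H brH rhoH :=
  [/\ vector_hull A V H,
      lie_algebroid H brH rhoH,
      bracket_extends A br H brH &
      forall br' rho', lie_algebroid H br' rho' -> bracket_extends A br H br' ->
        (forall X Y, sec H X -> sec H Y -> br' X Y = brH X Y) /\
        (forall m v f, fib H m v -> Cinf f -> rho' m v f = rhoH m v f)].

End Generic.
End Bundles.

(** * AV-bundles *)

(* zadd z t is z + t, and zsub z' z is z' - z when z, z' lie in one fibre.
   The local sections in ltriv are the zero sections of the local affine
   fibre coordinates s(z) = z - tau(zeta z); together with the charts of M
   they determine the manifold structure of the total space.                  *)
Record avbundle (R : realType) (n : nat) (M : manifold R n) := AVBundle {
  total :> Type;
  zeta : total -> M;
  zadd : total -> R -> total;
  zsub : total -> total -> R;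
  zeta_add : forall z t, zeta (zadd z t) = zeta z;
  zadd0 : forall z, zadd z 0 = z;
  zaddD : forall z t u, zadd z (t + u) = zadd (zadd z t) u;
  zsubK : forall z z', zeta z = zeta z' -> zadd z (zsub z' z) = z';
  zaddK : forall z t, zsub (zadd z t) z = t;
  ltriv : set (set M * (M -> total));
  ltriv_cover : forall m, exists2 tau, ltriv tau & tau.1 m;
  ltriv_open : forall tau, ltriv tau -> open tau.1;
  ltriv_sec : forall tau m, ltriv tau -> tau.1 m -> zeta (tau.2 m) = m;
  ltriv_smooth : forall tau tau', ltriv tau -> ltriv tau' ->
    smooth_on (tau.1 `&` tau'.1) (fun m => zsub (tau'.2 m) (tau.2 m)) }.

Section AV.
Context {R : realType} {n : nat} {M : manifold R n}.
Variable Z : avbundle M.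

(* The local coordinates (x, s) on Z: (x, s) |-> tau (x) + s.                 *)
Definition zpoint (c : chart R n M) (tau : set M * (M -> Z))
  (p : 'rV[R]_n * R) : Z := zadd (tau.2 (cinv c p.1)) p.2.

Definition zdom (c : chart R n M) (tau : set M * (M -> Z)) :
  set ('rV[R]_n * R) := [set p | cimg c p.1 /\ tau.1 (cinv c p.1)].

Definition CinfZ (F : Z -> R) :=
  forall c tau, atlas c -> ltriv tau -> smooth (zdom c tau) (F \o zpoint c tau).

Definition SecZ (sigma : M -> Z) :=
  (forall m, zeta (sigma m) = m) /\
  forall tau, ltriv tau -> smooth_on tau.1 (fun m => zsub (sigma m) (tau.2 m)).

Definition Fsec (sigma : M -> Z) : Z -> R := fun z => zsub (sigma (zeta z)) z.

Definition Ffun (f : M -> R) : Z -> R := fun z => f (zeta z).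

(* Operators on smooth functions are extended by 0 to all functions, so that
   equality of operators is equality on smooth functions.                     *)
Definition op := (Z -> R) -> (Z -> R).

Definition XZ : op := fun F =>
  if `[< CinfZ F >] then
    (fun z => derive1 (fun t : R => F (zadd z (- t))) 0)
  else 0.

Definition Pol (k : nat) : set (Z -> R) :=
  [set F | CinfZ F /\ iter k.+1 XZ F = 0].

Definition first_order_operator (D : op) :=
  (forall F, ~ CinfZ F -> D F = 0) /\
  forall c tau, atlas c -> ltriv tau ->
    exists (g : 'I_n -> 'rV[R]_n * R -> R) (h k : 'rV[R]_n * R -> R),
      [/\ forall a, smooth (zdom c tau) (g a),
          smooth (zdom c tau) h,
          smooth (zdom c tau) k &
          forall F p, CinfZ F -> zdom c tau p ->
            let Fl := F \o zpoint c tau in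
            D F (zpoint c tau p) =
              \sum_(a < n) g a p * 'D_((delta_mx 0 a, 0)) Fl p
              + h p * 'D_((0, 1)) Fl p + k p * Fl p].

Definition OpZ : set op :=
  [set D | first_order_operator D /\ forall k F, Pol k F -> Pol k (D F)].

(* The value at m of the section of RZ defined by an operator D keeps from
   D F exactly its restriction to the fibre over m.                           *)
Definition field_of (D : op) : M -> op :=
  fun m F z => if `[< zeta z = m >] then D F z else 0.

Definition op_of (s : M -> op) : op := fun F z => s (zeta z) F z.

Definition RZ : @bundle R n M op :=
  Bundle (fun m => [set v | exists2 D, OpZ D & v = field_of D m])
         [set s | exists2 D, OpZ D & s = field_of D].

(* v (XZ F) - XZ (v F) only involves v F along the fibre over m.              *)
Definition phi0 (m : M) (v : op) : R :=
  get [set c | forall F z, CinfZ F -> zeta z = m ->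
                 v (XZ F) z - derive1 (fun t : R => v F (zadd z (- t))) 0
                 = c * XZ F z].

Definition phi1 (m : M) (v : op) : R :=
  get [set c | forall z, zeta z = m -> v (cst 1) z = c].

(* f |-> v (f o zeta) - v(1) f on the fibre over m; for
   v = f_a d/dx^a - (alpha s + beta) d/ds + gamma this is f_a d/dx^a.         *)
Definition anchor (m : M) (v : op) (f : M -> R) : R :=
  get [set c | forall z, zeta z = m -> v (Ffun f) z - v (cst 1) z * f m = c].

Definition Ttilde := restr RZ
  (fun m => [set v | [/\ fib RZ m v, phi0 m v = 0 & phi1 m v = 0]]).
Definition Lbreve := restr RZ
  (fun m => [set v | fib RZ m v /\ phi1 m v = 0]).
Definition Ltilde := restr RZ
  (fun m => [set v | fib RZ m v /\ phi1 m v = phi0 m v]).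
Definition Tbar := restr RZ
  (fun m => [set v | [/\ fib RZ m v, phi1 m v = 0 & phi0 m v = -1]]).
Definition Lbar := restr RZ
  (fun m => [set v | fib RZ m v /\ phi1 m v - phi0 m v = 1]).

Definition op_commutator (s s' : M -> op) : M -> op :=
  field_of (fun F => op_of s (op_of s' F) - op_of s' (op_of s F)).

(* D(sigma), read off from F_{D(sigma)} = D(F_sigma) at the point sigma(m).   *)
Definition act (s : M -> op) (sigma : M -> Z) : M -> Z :=
  fun m => zadd (sigma m) (op_of s (Fsec sigma) (sigma m)).

(* The sections of A are, via act, affine maps Sec(Z) -> Sec(Z).              *)
Definition affine_maps_on_SecZ (A : @bundle R n M op) :=
  [/\ forall s sigma, sec A s -> SecZ sigma ->
        SecZ (act s sigma) /\ Fsec (act s sigma) = op_of s (Fsec sigma),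
      forall s sigma sigma' (t : R), sec A s -> SecZ sigma -> SecZ sigma' ->
        act s (fun m => zadd (sigma m) (t * zsub (sigma' m) (sigma m))) =
        (fun m => zadd (act s sigma m)
                       (t * zsub (act s sigma' m) (act s sigma m))) &
      forall s s', sec A s -> sec A s' ->
        (forall sigma, SecZ sigma -> act s sigma = act s' sigma) -> s = s'].

(* D o D' - D' o D : Sec(Z) -> C^oo(M).                                       *)
Definition commutator (s s' : M -> op) (sigma : M -> Z) : M -> R :=
  fun m => zsub (act s (act s' sigma) m) (act s' (act s sigma) m).

(* br s s' is the section of V acting on Sec(Z) as the commutator.            *)
Definition bracket_is_commutator (A V : @bundle R n M op)
    (br : (M -> op) -> (M -> op) -> (M -> op)) :=
  forall s s' X, sec A s -> sec A s' -> sec V X ->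
    (br s s' = X <-> forall sigma, SecZ sigma ->
       op_of X (Fsec sigma) = Ffun (commutator s s' sigma)).

End AV.

Arguments XZ {R n M} Z F _.
Arguments anchor {R n M} Z m v f.
Arguments op_commutator {R n M} Z s s' _ _ _.

(* Main.v *)
(* A partition of unity provides a global section sigma of Z. In the trivialisation
   it defines, F_sigma is - s, and there are global operators X = - d/ds,
   E = F_sigma X = s d/ds, the identity, and the bump multiples of d/dx^a. At a
   given point, a first-order operator is determined by its values on functions of
   the base and on F_sigma. Comparing with combinations of the operators above, one
   gets local frames of RZ; moreover [D, X] = phi0 (D) X, since both sides agree on
   these test functions. As phi0 (E) = - 1, phi1 (E) = 0, phi0 (id) = 0 and
   phi1 (id) = 1, a linear condition on (phi0, phi1) selects a subframe, so that all
   the subbundles at hand are vector bundles. The identity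
   phi_i [D, D'] = D (phi_i (D')) - D' (phi_i (D)) shows that constant linear
   conditions on (phi0, phi1) are preserved by commutators, and that commutators of
   sections of an affine subbundle lie in its model. Both affine subbundles are the
   translates by E of their models, and the sections of the hulls are the f E + v
   with v in the model. *)

From HB Require Import structures.
Require Import Defs.
From mathcomp Require Import all_boot all_order all_algebra.
From mathcomp Require Import all_classical all_reals all_analysis.
From mathcomp Require Import ring lra.
Set Implicit Arguments.
Unset Strict Implicit.
Unset Printing Implicit Defensive.
Import Order.TTheory GRing.Theory Num.Theory.
Import numFieldNormedType.Exports.
Local Open Scope classical_set_scope.
Local Open Scope ring_scope.

(** * Differential calculus in normed modules *)

(** Smoothness is expressed by iterated directional derivatives, so the chain rule and the symmetry
    of second derivatives are derived from the mean value theorem; the symmetry is what makes the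
    commutator of two first-order operators first order again. Operators are global and act on
    global functions, whereas frames and coefficients are local: bump functions turn local data into
    global operators, and uniqueness of the coefficients in a chart allows operators to be glued.
    The two halves of the theorem are one computation with parameters. Every vector bundle involved
    is the preimage under (- [phi0], [phi1]) of a subspace of the plane, and the affine bundles are
    preimages of translates by (1, 0), the position of E. For [Tbar] the subspaces of the model and
    of the hull are 0 and the axis b = 0; for [Lbar] they are the line a + b = 0 and the whole
    plane. Uniqueness of the hull rests on X being a nowhere vanishing section of the model: the
    Leibniz rule for f X recovers the anchor from the bracket. *)

Section Directional.
Context {R : realType} {V : normedModType R}.
Implicit Types (f g : V -> R) (x v w : V) (U : set V).

Lemma is_derive_line f x v (t : R) : derivable f (x + t *: v) v ->
  is_derive t 1 (fun s : R => f (x + s *: v)) ('D_v f (x + t *: v)).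
Proof.
move=> df; rewrite /derivable in df.
have e : (fun h : R => h^-1 *: (((fun s : R => f (x + s *: v)) \o shift t) (h *: 1)
    - f (x + t *: v))) =
  (fun h : R => h^-1 *: ((f \o shift (x + t *: v)) (h *: v) - f (x + t *: v))).
  apply/funext => h /=; congr (_ *: (f _ - _)).
  by rewrite [h *: 1]mulr1 scalerDl addrCA.
by split; [rewrite /derivable e | rewrite /derive e].
Qed.

(** Derivability is assumed in the direction [v] alone, so no linear differential is at hand:
    homogeneity comes from composing the restriction to the line with [s |-> s * k], which also
    covers [k = 0]. *)
Lemma deriveZv f x v (k : R) : derivable f x v ->
  is_derive x (k *: v) f (k * 'D_v f x).
Proof.
move=> df.
have e (l : V -> R) (w : V) (t : R) : l (t *: w + x) = l (x + t *: w) by rewrite addrC.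
have d0 : is_derive (0 : R) (1 : R) (fun s : R => f (x + s *: v)) ('D_v f x).
  by have := @is_derive_line f x v 0; rewrite scale0r addr0; apply.
have dk : is_derive (0 : R) (1 : R) (fun s : R => s * k) k.
  rewrite (_ : (fun s : R => s * k) = k \*: (@id R)); last first.
    by apply/funext => s /=; rewrite mulrC.
  by apply: is_derive_eq; rewrite [LHS]mulr1.
have [c1 c2] : is_derive (0 : R) (1 : R)
    ((fun s : R => f (x + s *: v)) \o (fun s : R => s * k)) (k * 'D_v f x).
  have d0' : derivable (fun s : R => f (x + s *: v)) (0 * k : R) 1.
    by rewrite mul0r; case: d0.
  split.
    apply/derivable1_diffP/differentiable_comp; exact/derivable1_diffP.
  rewrite -derive1E derive1_comp//.
  by rewrite !derive1E mul0r !derive_val mulrC.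
have q : (fun h : R => h^-1 *: (f (h *: (k *: v) + x) - f x)) = fun h : R =>
    h^-1 *: ((((fun s : R => f (x + s *: v)) \o (fun s : R => s * k)) \o shift 0) (h *: 1)
     - ((fun s : R => f (x + s *: v)) \o (fun s : R => s * k)) 0).
  apply/funext => h /=; rewrite mul0r scale0r !addr0 [h *: 1]mulr1.
  by rewrite scalerA (addrC x).
by split; [rewrite /derivable /= q | rewrite /derive /= q].
Qed.

Lemma derive_mean_value f x v :
  (forall t : R, 0 <= t <= 1 -> derivable f (x + t *: v) v) ->
  exists2 t : R, 0 <= t <= 1 & f (x + v) - f x = 'D_v f (x + t *: v).
Proof.
move=> df.
have dl (t : R) : t \in `]0, 1[ ->
    is_derive t 1 (fun s : R => f (x + s *: v)) ('D_v f (x + t *: v)).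
  by rewrite in_itv/= => /andP[t0 t1]; apply: is_derive_line; apply: df; rewrite !ltW.
have cl : {within `[0, 1], continuous (fun s : R => f (x + s *: v))}.
  apply: derivable_within_continuous => s; rewrite in_itv/= => s01.
  by have [] := @is_derive_line f x v s (df _ s01).
have [t] := MVT ltr01 dl cl.
rewrite in_itv/= => /andP[t0 t1]; rewrite scale1r scale0r addr0 subr0 mulr1 => ->.
by exists t => //; rewrite !ltW.
Qed.

End Directional.

Lemma cvg_sum {R : realType} {T : Type} (F : set_system T) {FF : Filter F}
    {W : normedModType R} {I : Type} (s : seq I) (f : I -> T -> W) (l : I -> W) :
  (forall j, f j x @[x --> F] --> l j) ->
  \sum_(j <- s) f j x @[x --> F] --> \sum_(j <- s) l j.
Proof.
move=> fl; elim: s => [|i s IH].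
  rewrite big_nil (_ : (fun x => _) = cst 0); first exact: cvg_cst.
  by apply/funext => x; rewrite big_nil.
rewrite big_cons (_ : (fun x => _) = f i \+ (fun x => \sum_(j <- s) f j x)).
  exact: cvgD.
by apply/funext => x; rewrite big_cons.
Qed.

Section ChainRule.
Context {R : realType} {W : normedModType R} {I : finType} (e : I -> W).
Implicit Types (f : W -> R) (O : set W).

(** Induction on the list of directions: adding [e i] changes the value by the increment [G h] of
    [f] from [P h] to [P h + d i h *: e i]. By the mean value theorem it is [d i h] times a value of
    ['D_(e i) f] at an intermediate point, and continuity of this partial derivative at [w] gives
    the limit. *)
Lemma is_derive_chain_curve f O (w : W) (s : seq I) (d : I -> R -> R) (d' : I -> R) :
  open O -> Ck 1 O f -> O w -> (forall j, d j 0 = 0) ->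
  (forall j, is_derive (0 : R) (1 : R) (d j) (d' j)) ->
  is_derive (0 : R) (1 : R) (fun h => f (w + \sum_(j <- s) d j h *: e j))
    (\sum_(j <- s) d' j * 'D_(e j) f w).
Proof.
move=> oO [fc fD] Ow d0 dd.
have cd j : {for (0 : R), continuous (d j)}.
  by apply/differentiable_continuous/derivable1_diffP; case: (dd j).
elim: s => [|i s IH].
  rewrite (_ : (fun h => _) = cst (f w)); last first.
    by apply/funext => h; rewrite big_nil addr0.
  by rewrite big_nil; exact: is_derive_cst.
pose P h := w + \sum_(j <- s) d j h *: e j.
pose G h := f (P h + d i h *: e i) - f (P h).
pose L := 'D_(e i) f w.
(* The difference quotient of [f] along [e i], set to its limit [L] where [d i h] vanishes, so that
   [G h = d i h * q h] holds for every [h]. *)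
pose q h := if d i h == 0 then L else G h / d i h.
have P0 : P 0 = w.
  by rewrite /P big1 ?addr0// => j _; rewrite d0 scale0r.
have Gq h : G h = d i h * q h.
  rewrite /q; case: eqP => [d00|/eqP dn0]; last by rewrite mulrC divfK.
  by rewrite /G d00 scale0r addr0 subrr mul0r.
have cP : {for (0 : R), continuous P}.
  apply: cvgD; first exact: cvg_cst.
  apply: cvg_sum => j; apply: cvgZr_tmp; exact: cd.
have qL : q h @[h --> 0^'] --> L.
  apply/cvgrPdist_lt => eps eps0.
  have [cDe _] := (fD (e i)).2.
  have /cvgrPdist_lt/(_ eps eps0) nD := cDe w Ow.
  have nO : nbhs w O by exact: open_nbhs_nbhs.
  have nI : nbhs w ([set y | `|L - 'D_(e i) f y| < eps] `&` O) by exact: filterI.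
  have [r /= r0 br] := (nbhs_ballP _ _).1 nI.
  (* This sum bounds the distance from [w] to every point of the segment on which the mean value
     theorem is applied. *)
  have cn : (`|P h - w| + `|d i h| * `|e i|) @[h --> (0:R)] --> (0 : R).
    rewrite [X in _ --> X](_ : _ = `|P 0 - w| + `|d i 0| * `|e i|); last first.
      by rewrite P0 subrr d0 !normr0 mul0r addr0.
    apply: cvgD.
      by apply: cvg_norm; apply: cvgB => //; exact: cvg_cst.
    by apply: cvgMr_tmp; apply: cvg_norm; exact: cd.
  apply: cvg_within.
  have /cvgrPdist_lt/(_ r r0) := cn.
  apply: filterS => h /=; rewrite sub0r normrN.
  rewrite (@ger0_norm _ (_ + _)) ?addr_ge0 ?mulr_ge0// => lr.
  rewrite /q; case: eqP => [_|/eqP dn0]; first by rewrite subrr normr0.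
  have inb (t : R) : 0 <= t <= 1 -> ball w r (P h + t *: (d i h *: e i)).
    move=> /andP[t0 t1]; rewrite -ball_normE /= -normrN opprB addrAC.
    apply: le_lt_trans (ler_normD _ _) _; apply: le_lt_trans lr.
    rewrite lerD2l !normrZ (ger0_norm t0).
    by rewrite ler_piMl ?mulr_ge0.
  have [|t t01] := @derive_mean_value R W f (P h) (d i h *: e i).
    move=> t t01; have [] := @deriveZv R W f (P h + t *: (d i h *: e i)) (e i) (d i h) =>
      //.
    by apply: (fD (e i)).1; have [] := br _ (inb t t01).
  have /= [ltL Ot] := br _ (inb t t01).
  have [_ ->] := @deriveZv R W f _ (e i) (d i h) ((fD (e i)).1 _ Ot).
  by rewrite -/(G h) => ->; rewrite mulrAC mulfV// mul1r.
have dG : is_derive (0 : R) (1 : R) G (d' i * L).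
  have cG : h^-1 *: (G (h *: 1 + 0) - G 0) @[h --> 0^'] --> d' i * L.
    have -> : (fun h : R => h^-1 *: (G (h *: 1 + 0) - G 0)) =
        (fun h => (h^-1 *: (d i (h *: 1 + 0) - d i 0)) * q h).
      apply/funext => h; rewrite !Gq d0 mul0r !subr0 [h *: 1]mulr1 addr0.
      by rewrite -[_ *: _]/(_ * _) -[_ *: d i h]/(_ * _) mulrA.
    apply: cvgM => //.
    by have [] := dd i; rewrite /derivable /derive => /[swap] <-.
  by split; [apply/cvg_ex; exists (d' i * L)|exact: cvg_lim cG].
rewrite (_ : (fun h => _) = (fun h => f (w + \sum_(j <- s) d j h *: e j)) + G).
  by rewrite big_cons addrC; exact: is_deriveD.
apply/funext => h; rewrite big_cons -[RHS]/(f (P h) + (f (P h + d i h *: e i) - f (P h))).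
by rewrite [RHS]addrC subrK /P addrA addrAC.
Qed.

(** Along [v] only the curve [h |-> h *: v + x] matters; [is_derive_chain_curve] applies to the
    increments of the [c j] along it. *)
Lemma is_derive_chain {V : normedModType R} f O (c : I -> V -> R) (x v : V) :
  open O -> Ck 1 O f -> O (\sum_j c j x *: e j) ->
  (forall j, derivable (c j) x v) ->
  is_derive x v (fun y => f (\sum_j c j y *: e j))
    (\sum_j 'D_v (c j) x * 'D_(e j) f (\sum_j c j x *: e j)).
Proof.
move=> oO fC Ow cD.
pose d j (h : R) := c j (h *: v + x) - c j x.
have d0 j : d j 0 = 0 by rewrite /d scale0r add0r subrr.
have dd j : is_derive (0 : R) (1 : R) (d j) ('D_v (c j) x).
  have cj : is_derive (0 : R) (1 : R) (fun h => c j (x + h *: v)) ('D_v (c j) x).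
    by have := @is_derive_line _ _ (c j) x v 0; rewrite scale0r addr0 => /(_ (cD j)).
  rewrite (_ : d j = (fun h => c j (x + h *: v)) - cst (c j x)).
    apply: is_derive_eq.
    by rewrite subr0.
  by apply/funext => h; rewrite /d (addrC (h *: v)).
have [h1 h2] := is_derive_chain_curve (index_enum I) oO fC Ow d0 dd.
have q : (fun h : R => h^-1 *: (((fun y => f (\sum_j c j y *: e j)) \o shift x) (h *: v)
     - f (\sum_j c j x *: e j))) =
  (fun h : R => h^-1 *: (((fun h => f (\sum_j c j x *: e j + \sum_j d j h *: e j)) \o
    shift 0) (h *: 1)
     - (fun h => f (\sum_j c j x *: e j + \sum_j d j h *: e j)) 0)).
  apply/funext => h /=; rewrite [h *: 1]mulr1 addr0.
  rewrite -!big_split /=; congr (_ *: (f _ - f _)); apply: eq_bigr => j _.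
    by rewrite -scalerDl /d [c j x + _]addrC subrK.
  by rewrite d0 scale0r addr0.
by split; [rewrite /derivable q|rewrite /derive q].
Qed.

End ChainRule.

(** * Stability properties of the classes [Ck] *)

Section CkAlgebra.
Context {R : realType} {V : normedModType R}.
Implicit Types (f g : V -> R) (x v : V) (U : set V) (k : nat).

Lemma Ck_continuous k U f x : Ck k U f -> U x -> {for x, continuous f}.
Proof. by case: k => [|k] [+ _] => /[apply]. Qed.

Lemma CkS k U f : Ck k.+1 U f -> Ck k U f.
Proof.
elim: k f => [|k IH] f [fc fD]; first by split.
by split=> // v; have [fd fk] := fD v; split=> //; exact: IH.
Qed.

Lemma CkS1 k U f : Ck k.+1 U f -> Ck 1 U f.
Proof. by elim: k => // k IH /CkS. Qed.

Lemma Ck_subset k U U' f : U' `<=` U -> Ck k U f -> Ck k U' f.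
Proof.
move=> UU'; elim: k f => [|k IH] f [fc fD]; split=> //.
- by move=> x /UU'; exact: fc.
- by move=> x /UU'; exact: fc.
- move=> v; have [fd fk] := fD v; split; last exact: IH.
  by move=> x /UU'; exact: fd.
Qed.

Lemma eq_on_near U f g x : open U -> (forall y, U y -> f y = g y) -> U x ->
  {near x, f =1 g}.
Proof.
by move=> oU fg Ux; near=> y; apply: fg; near: y; exact: open_nbhs_nbhs.
Unshelve. all: by end_near. Qed.

Lemma eq_Ck k U f g : open U -> (forall x, U x -> f x = g x) ->
  Ck k U f -> Ck k U g.
Proof.
move=> oU; elim: k f g => [|k IH] f g fg [fc fD]; split=> //.
- move=> x Ux; rewrite /prop_for /continuous_at -fg//.
  apply: cvg_trans (fc x Ux); apply: near_eq_cvg.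
  by apply: filterS (eq_on_near oU fg Ux) => y ->.
- move=> x Ux; rewrite /prop_for /continuous_at -fg//.
  apply: cvg_trans (fc x Ux); apply: near_eq_cvg.
  by apply: filterS (eq_on_near oU fg Ux) => y ->.
- move=> v; have [fd fk] := fD v; split.
    by move=> x Ux; apply: near_eq_derivable (fd x Ux); exact: eq_on_near Ux.
  apply: IH fk => x Ux; apply: near_eq_derive; exact: eq_on_near Ux.
Qed.

Lemma Ck_local k U f :
  (forall x, U x -> exists2 U', U' x & Ck k U' f) -> Ck k U f.
Proof.
elim: k f => [|k IH] f Uf.
  by split=> // x /Uf[U' U'x fk]; exact: Ck_continuous fk U'x.
split; first by move=> x /Uf[U' U'x fk]; exact: Ck_continuous fk U'x.
move=> v; split; first by move=> x /Uf[U' U'x [_ fD]]; exact: (fD v).1.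
by apply: IH => x /Uf[U' U'x [_ fD]]; exists U' => //; exact: (fD v).2.
Qed.

Lemma Ck_cst k U (a : R) : Ck k U (cst a).
Proof.
elim: k a => [|k IH] a; split=> //; try by move=> x Ux; exact: cvg_cst.
move=> v; split; first by move=> x _; exact: derivable_cst.
rewrite (_ : (fun x => 'D_v (cst a) x) = cst 0)//.
by apply/funext => x; rewrite derive_cst.
Qed.

Lemma CkD k U f g : open U -> Ck k U f -> Ck k U g -> Ck k U (fun x => f x + g x).
Proof.
move=> oU; elim: k f g => [|k IH] f g [fc fD] [gc gD]; split=> //;
  try by move=> x Ux; apply: cvgD; [exact: fc|exact: gc].
move=> v; have [fd fk] := fD v; have [gd gk] := gD v; split.
  by move=> x Ux; apply: derivableD; [exact: fd|exact: gd].
apply: eq_Ck (IH _ _ fk gk) => // x Ux.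
by rewrite /= deriveD//; [exact: fd|exact: gd].
Qed.

Lemma CkM k U f g : open U -> Ck k U f -> Ck k U g -> Ck k U (fun x => f x * g x).
Proof.
move=> oU; elim: k f g => [|k IH] f g.
  by move=> [fc _] [gc _]; split=> // x Ux; apply: cvgM; [exact: fc|exact: gc].
move=> fk1 gk1; have fk := CkS fk1; have gk := CkS gk1.
case: fk1 gk1 => [fc fD] [gc gD]; split.
  by move=> x Ux; apply: cvgM; [exact: fc|exact: gc].
move=> v; have [fd fk'] := fD v; have [gd gk'] := gD v; split.
  by move=> x Ux; apply: derivableM; [exact: fd|exact: gd].
apply: eq_Ck (CkD oU (IH _ _ fk gk') (IH _ _ gk fk')) => // x Ux.
by rewrite /= deriveM//; [exact: fd|exact: gd].
Qed.

Lemma CkV k U f : open U -> (forall x, U x -> f x != 0) -> Ck k U f ->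
  Ck k U (fun x => (f x)^-1).
Proof.
move=> oU f0; elim: k => [|k IH] fk.
  by split=> // x Ux; apply: cvgV; [exact: f0|exact: (Ck_continuous fk)].
have := IH (CkS fk); case: fk => [fc fD] ik; split.
  by move=> x Ux; apply: cvgV; [exact: f0|exact: fc].
move=> v; have [fd fk'] := fD v; split.
  by move=> x Ux; apply: derivableV; [exact: f0|exact: fd].
apply: eq_Ck (CkM oU (CkM oU (Ck_cst k U (-1)) (CkM oU ik ik)) fk') => // x Ux.
by rewrite /= deriveV ?f0//; [rewrite mulN1r expr2 invfM|exact: fd].
Qed.

Lemma Ck_sum k U (I : Type) (s : seq I) (f : I -> V -> R) : open U ->
  (forall i, Ck k U (f i)) -> Ck k U (fun x => \sum_(i <- s) f i x).
Proof.
move=> oU fk; elim: s => [|i s IH].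
  by apply: eq_Ck (Ck_cst k U 0) => // x _; rewrite big_nil.
by apply: eq_Ck (CkD oU (fk i) IH) => // x _; rewrite big_cons.
Qed.

Lemma Ck_linear k U (f : {linear V -> R}) : continuous f -> Ck k U f.
Proof.
move=> fc; case: k => [|k]; first by split=> // x _; exact: fc.
split; first by move=> x _; exact: fc.
move=> v; split.
  by move=> x _; apply: diff_derivable; exact: linear_differentiable.
rewrite (_ : (fun x => 'D_v f x) = cst (f v)); first exact: Ck_cst.
by apply/funext => x; rewrite deriveE ?diff_lin//; exact: linear_differentiable.
Qed.

End CkAlgebra.

Section CkComposition.
Context {R : realType} {V W : normedModType R} {I : finType} (e : I -> W).

(** [Ck] concerns real-valued functions, so a map into [W] is given by its components along the
    finite family [e]. The chain rule expresses the derivative by the ['D_v (c j)] and by composites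
    of the ['D_(e j) f] with the same map, to which the induction applies. *)
Lemma Ck_comp k (U : set V) (O : set W) (f : W -> R) (c : I -> V -> R) :
  open U -> open O -> Ck k O f -> (forall j, Ck k U (c j)) ->
  (forall x, U x -> O (\sum_j c j x *: e j)) ->
  Ck k U (fun x => f (\sum_j c j x *: e j)).
Proof.
move=> oU oO + + UO.
have gc : (forall j x, U x -> {for x, continuous (c j)}) ->
    forall x, U x -> {for x, continuous (fun x => \sum_j c j x *: e j)}.
  by move=> cc x Ux; apply: cvg_sum => j; apply: cvgZr_tmp; exact: cc.
elim: k f c gc UO => [|k IH] f c gc UO fk ck.
  split=> // x Ux; apply: (@continuous_comp _ _ _ _ f).
    by apply: gc => // j y; exact: Ck_continuous.
  by apply: Ck_continuous fk _; exact: UO.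
have f1 := CkS1 fk.
split.
  move=> x Ux; apply: (@continuous_comp _ _ _ _ f).
    by apply: gc => // j y; exact: Ck_continuous.
  by apply: Ck_continuous fk _; exact: UO.
move=> v; have cd j x : U x -> derivable (c j) x v.
  by case: (ck j) => _ /(_ v)[+ _]; exact.
split.
  move=> x Ux.
  by have [] := is_derive_chain oO f1 (UO _ Ux) (fun j => cd j x Ux).
apply: (@eq_Ck _ _ _ _ (fun x => \sum_j 'D_v (c j) x * 'D_(e j) f (\sum_j c j x *: e j)))
  => //.
  by move=> x Ux; have [_ ->] := is_derive_chain oO f1 (UO _ Ux) (fun j => cd j x Ux).
apply: (@Ck_sum _ _ _ _ _ _ (fun j x => 'D_v (c j) x * 'D_(e j) f (\sum_j c j x *: e j)))
  => // j.
apply: CkM => //; first by case: (ck j) => _ /(_ v)[].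
apply: (IH (fun y => 'D_(e j) f y) c gc UO); last by move=> i; exact/CkS.
by case: fk => _ /(_ (e j))[].
Qed.

End CkComposition.

(** The second difference of [f] over a parallelogram is symmetric in its two sides; the mean value
    theorem applied twice, in either order, writes it as a mixed derivative at a point near [x].
    Continuity of both mixed derivatives at [x] then makes their values at [x] as close as
    desired. *)
Lemma derive_symmetric {R : realType} {V : normedModType R} (U : set V)
    (f : V -> R) (x v w : V) : open U -> Ck 2 U f -> U x ->
  'D_v (fun y => 'D_w f y) x = 'D_w (fun y => 'D_v f y) x.
Proof.
move=> oU fk Ux.
have dvw (a b : V) (r : R) : 0 < r -> ball x r `<=` U ->
    `|a| + `|b| < r ->
    exists2 y, `|x - y| <= `|a| + `|b| &
     f (x + a + b) - f (x + a) - (f (x + b) - f x) = 'D_b (fun y => 'D_a f y) y.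
  move=> r0 br ab.
  have inb (s t : R) : 0 <= s <= 1 -> 0 <= t <= 1 ->
      `|x - (x + s *: a + t *: b)| <= `|a| + `|b|.
    move=> /andP[s0 s1] /andP[t0 t1].
    rewrite -addrA opprD addrA subrr add0r normrN.
    apply: le_trans (ler_normD _ _) _; rewrite !normrZ !ger0_norm//.
    by apply: lerD; rewrite ler_piMl.
  have inU (s t : R) : 0 <= s <= 1 -> 0 <= t <= 1 -> U (x + s *: a + t *: b).
    move=> s01 t01; apply: br; rewrite -ball_normE /=.
    exact: le_lt_trans (inb _ _ s01 t01) ab.
  have h01 : 0 <= (1 : R) <= 1 by rewrite ler01 lexx.
  have h00 : 0 <= (0 : R) <= 1 by rewrite ler01 lexx.
  have dsh (s : R) : 0 <= s <= 1 ->
     is_derive (x + s *: a) a (fun y => f (y + b) - f y)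
       ('D_a f (x + s *: a + b) - 'D_a f (x + s *: a)).
    move=> s01; case: fk => [_ /(_ a)[fd _]].
    have d1 := fd _ (inU _ _ s01 h01); rewrite scale1r in d1.
    have d0 := fd _ (inU _ _ s01 h00); rewrite scale0r addr0 in d0.
    have d1' : is_derive (x + s *: a) a (fun y => f (y + b)) ('D_a f (x + s *: a + b)).
      have q : (fun h : R => h^-1 *: (((fun y => f (y + b)) \o shift (x + s *: a)) (h *:
        a) - f (x + s *: a + b)))
         = (fun h : R => h^-1 *: ((f \o shift (x + s *: a + b)) (h *: a) - f (x + s *: a
           + b))).
        by apply/funext => h /=; rewrite !addrA.
      by split; [rewrite /derivable q|rewrite /derive q].
    have d0' := derivableP d0.
    exact: is_deriveB.
  have [|s s01] := @derive_mean_value R V (fun y => f (y + b) - f y) x a.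
    by move=> s s01; case: (dsh s s01).
  have [_ ->] := dsh s s01; rewrite addrAC => eq1.
  have [|t t01] := @derive_mean_value R V (fun y => 'D_a f y) (x + s *: a) b.
    move=> t t01; case: fk => [_ /(_ a)[_ [_ fD]]].
    by apply: (fD b).1; exact: inU.
  move=> eq2; exists (x + s *: a + t *: b); first exact: inb.
  by rewrite -eq2 -eq1; congr (_ - _); congr (_ - _); congr f; rewrite addrAC.
apply/eqP; rewrite -subr_eq0 -normr_eq0 eq_le normr_ge0 andbT.
apply/ler_addgt0Pr => eps eps0; rewrite add0r.
have cvw : {for x, continuous (fun y => 'D_v (fun y => 'D_w f y) y)}.
  by have [_ D] := fk; have [_ [_ D2]] := D w; exact: ((D2 v).2.1 x Ux).
have cwv : {for x, continuous (fun y => 'D_w (fun y => 'D_v f y) y)}.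
  by have [_ D] := fk; have [_ [_ D2]] := D v; exact: ((D2 w).2.1 x Ux).
have e2 : 0 < eps / 2 by rewrite divr_gt0.
have /cvgrPdist_lt/(_ _ e2) n1 := cvw.
have /cvgrPdist_lt/(_ _ e2) n2 := cwv.
have n3 : nbhs x U by exact: open_nbhs_nbhs.
have [r /= r0 br] := (nbhs_ballP _ _).1 (filterI (filterI n1 n2) n3).
have rU : ball x r `<=` U by move=> y /br[].
(* The parallelogram with sides [c *: v] and [c *: w] stays in the ball of radius [r]; the summand 1
   keeps the denominator positive when [v] and [w] are 0. *)
pose c := r / (2 * (`|v| + `|w| + 1)).
have N0 : 0 < `|v| + `|w| + 1 by rewrite ltr_wpDl ?addr_ge0.
have c0 : 0 < c by rewrite divr_gt0 ?mulr_gt0.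
have cvw_lt : `|c *: v| + `|c *: w| < r.
  have nc (a : V) : `|c *: a| = c * `|a| by rewrite normrZ gtr0_norm.
  have A0 : 0 <= `|v| + `|w| by rewrite addr_ge0.
  rewrite !nc -mulrDr /c mulrAC ltr_pdivrMr ?mulr_gt0// ltr_pM2l//; lra.
have [y yx ey] := dvw (c *: v) (c *: w) r r0 rU cvw_lt.
have [|z zx ez] := dvw (c *: w) (c *: v) r r0 rU.
  by rewrite addrC.
(* Rescaling both sides of the parallelogram multiplies either mixed derivative by [c * c], which
   then cancels. *)
have sc (a b u : V) : U u ->
    'D_(c *: b) (fun y => 'D_(c *: a) f y) u = c * (c * 'D_b (fun y => 'D_a f y) u).
  move=> Uu; case: fk => [_ /(_ a)[fd [_ fD]]].
  have dz : {near u, (fun y => 'D_(c *: a) f y) =1 (c \*: (fun y => 'D_a f y))}.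
    apply: (@eq_on_near _ _ U) => // y' Uy'.
    by have [] := @deriveZv _ _ f y' a c (fd _ Uy').
  rewrite (near_eq_derive _ dz).
  have dk : derivable (c \*: (fun y => 'D_a f y)) u b.
    by apply: derivableZ; exact: ((fD b).1 _ Uu).
  have [_ ->] := @deriveZv _ _ (c \*: (fun y => 'D_a f y)) u b c dk.
  congr (c * _); have h := (fD b).1 u Uu.
  exact: (@deriveZ _ _ _ (fun y => 'D_a f y) c u b h).
have By : ball x r y by rewrite -ball_normE /=; exact: le_lt_trans yx cvw_lt.
have Bz : ball x r z.
  by rewrite -ball_normE /=; apply: le_lt_trans zx _; rewrite addrC.
have [[_ hy] Uy] := br _ By; have [[hz _] Uz] := br _ Bz.
have : 'D_w (fun y => 'D_v f y) y = 'D_v (fun y => 'D_w f y) z.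
  rewrite (sc v w y Uy) in ey; rewrite (sc w v z Uz) in ez.
  apply: (mulfI (lt0r_neq0 c0)); apply: (mulfI (lt0r_neq0 c0)).
  have sw (p q t s : R) : p - q - (t - s) = p - t - (q - s) by ring.
  have xvw : x + c *: v + c *: w = x + c *: w + c *: v by rewrite addrAC.
  rewrite xvw in ey; exact: (etrans (esym ey) (etrans (sw _ _ _ _) ez)).
have fin (p q t s : R) : `|p - s| < eps / 2 -> `|q - t| < eps / 2 -> t = s ->
    `|p - q| <= eps.
  move=> ps qt ts; have -> : p - q = (p - s) - (q - t) by rewrite ts; ring.
  by rewrite (le_trans (ler_normB _ _))// (splitr eps) lerD// ltW.
exact: (fin _ _ _ _ hz hy).
Qed.

(** * A smooth step function *)

Lemma Ck_comp1 {R : realType} {V : normedModType R} k (U : set V) (O : set R)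
    (f : R -> R) (g : V -> R) :
  open U -> open O -> Ck k O f -> Ck k U g -> (forall x, U x -> O (g x)) ->
  Ck k U (fun x => f (g x)).
Proof.
move=> oU oO fk gk UO.
have E x : \sum_(j : unit) g x *: (1 : R) = g x.
  by rewrite sumr_const card_unit mulr1n [LHS]mulr1.
apply: eq_Ck (@Ck_comp R V R unit (fun=> 1) k U O f (fun=> g) oU oO fk _ _) => //.
  by move=> x _ /=; rewrite E.
by move=> x Ux; rewrite E; exact: UO.
Qed.

Section SmoothStep.
Context {R : realType}.
Implicit Types (p : {poly R}) (x y : R).

(* Closed under differentiation, because of the polynomial factor in 1/x. *)
Definition flat p x : R := if 0 < x then p.[x^-1] * expR (- x^-1) else 0.

(** With y = 1/x, the derivative of p(y) exp(- y) with respect to x is - y^2 (p' - p)(y) exp(-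
    y). *)
Definition flat_deriv p : {poly R} := 'X^2 * (p - p^`()).

(** Each monomial is absorbed by exp(y) >= y^k / k!. The factor [y ^+ 2] is what differentiability
    of [flat p] at 0 consumes: for [y = h^-1] it bounds [flat p h] by a multiple of the square of
    [h]. *)
Lemma horner_expR_bound p : exists2 C : R, 0 <= C &
  forall y, 0 < y -> `|p.[y] * expR (- y)| * y ^+ 2 <= C.
Proof.
exists (\sum_(i < size p) `|p`_i| * (i.+2)`!%:R).
  by apply: sumr_ge0 => i _; apply: mulr_ge0.
move=> y y0; rewrite normrM (gtr0_norm (expR_gt0 _)) horner_coef.
have y2 : 0 <= y ^+ 2 by rewrite exprn_ge0// ltW.
have E0 : 0 <= expR (- y) by exact: expR_ge0.
apply: (@le_trans _ _ ((\sum_(i < size p) `|p`_i * y ^+ i|) * expR (- y) * y ^+ 2)).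
  by rewrite !ler_wpM2r// ler_norm_sum.
rewrite -mulrA mulr_suml; apply: ler_sum => i _.
rewrite normrM -mulrA ler_wpM2l// normrX gtr0_norm//.
rewrite mulrCA -exprD addn2 expRN ler_pdivrMl ?expR_gt0//.
have f0 : 0 < (i.+2)`!%:R :> R by rewrite ltr0n fact_gt0.
rewrite -ler_pdivrMr//; have := @expR_ge1Dxn R y i.+1 (ltW y0); lra.
Qed.

Lemma is_derive_comp1 (f g : R -> R) x (df dg : R) :
  is_derive x (1 : R) g dg -> is_derive (g x) (1 : R) f df ->
  is_derive x (1 : R) (fun y => f (g y)) (df * dg).
Proof.
move=> [gd gE] [fd fE]; split.
  exact/derivable1_diffP/differentiable_comp/derivable1_diffP/fd/derivable1_diffP.
by rewrite -derive1E -[fun y => _]/(f \o g) derive1_comp// !derive1E gE fE.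
Qed.

Lemma is_derive_flat p x : is_derive x (1 : R) (flat p) (flat (flat_deriv p) x).
Proof.
have [x0|x0|->] := ltgtP x 0.
- have -> : flat (flat_deriv p) x = 0 by rewrite /flat ltNge (ltW x0).
  apply: (@near_eq_is_derive _ _ _ (cst 0)).
  have := lt_nbhsl x0; apply: filterS => y y0.
  by rewrite /flat ltNge (ltW y0).
- have -> : flat (flat_deriv p) x = (flat_deriv p).[x^-1] * expR (- x^-1).
    by rewrite /flat x0.
  apply: (@near_eq_is_derive _ _ _ (fun y => p.[y^-1] * expR (- y^-1))).
    have xN : - x < 0 by rewrite oppr_lt0.
    have := Nlt_nbhsl xN.
    by apply: filterS => y /=; rewrite oppr_lt0 /flat => ->.
  have dV : is_derive x (1 : R) (fun y : R => y^-1) (- x ^- 2).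
    have dx : derivable (@id R) x 1 by exact: derivable_id.
    have x0' := lt0r_neq0 x0; split.
      exact: (@derivableV R R id x 1 x0' dx).
    have := @deriveV R R id x 1 x0' dx.
    by rewrite derive_id => ->; rewrite [LHS]mulr1.
  have dp := is_derive_comp1 dV (is_derive_poly p _).
  have dN := is_deriveN dV.
  have de := is_derive_comp1 dN (is_derive_expR _).
  apply: is_derive_eq (is_deriveM dp de) _.
  rewrite /flat_deriv hornerM hornerXn hornerD hornerN.
  rewrite -[X in X + _]/(_ * _) -[X in _ + X]/(_ * _) /=.
  by rewrite exprVn; ring.
- have -> : flat (flat_deriv p) 0 = 0 by rewrite /flat ltxx.
  have [C C0 pC] := horner_expR_bound p.
  have c : h^-1 *: (flat p (h *: 1 + 0) - flat p 0) @[h --> 0^'] --> (0 : R).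
    apply/cvgrPdist_le => eps eps0.
    (* The difference quotient at 0 is at most [C * h]; [C + 1] avoids dividing by zero when
       [C = 0]. *)
    have e0 : 0 < eps / (C + 1) by rewrite divr_gt0// ltr_wpDl.
    have := @dnbhs0_lt R R _ e0; apply: filterS => h hC.
    rewrite sub0r normrN {2}/flat ltxx subr0 [h *: 1]mulr1 addr0 /flat.
    case: ifPn => h0; last by rewrite scaler0 normr0 ltW.
    rewrite -[_ *: _]/(_ * _) normrM (gtr0_norm (_ : 0 < h^-1)) ?invr_gt0//.
    have hi : 0 < h^-1 by rewrite invr_gt0.
    have := pC _ hi; rewrite exprVn expr2 => hp.
    have : `|p.[h^-1] * expR (- h^-1)| <= C * (h * h).
      by rewrite -ler_pdivrMr ?mulr_gt0.
    move=> /(ler_wpM2l (ltW hi)) /le_trans; apply.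
    rewrite mulrCA mulKf ?gt_eqF//.
    by move: hC; rewrite gtr0_norm// ltr_pdivlMr ?ltr_wpDl// => hC; nra.
  by split; [apply/cvg_ex; exists 0|exact: cvg_lim c].
Qed.

Lemma Ck_flat k U p : Ck k U (flat p).
Proof.
have cf q x : {for x, continuous (flat q)}.
  by apply/differentiable_continuous/derivable1_diffP; have [] := is_derive_flat q x.
suff : Ck k setT (flat p) by apply: Ck_subset.
elim: k p => [|k IH] p; first by split=> // x _; exact: cf.
split=> [x _|v]; first exact: cf.
have dv (x : R) : is_derive x v (flat p) (v * flat (flat_deriv p) x).
  have [d1 d2] := is_derive_flat p x.
  have := @deriveZv R R (flat p) x 1 v d1; rewrite d2 [v *: 1]mulr1.
  by apply.
split=> [x _|]; first by have [] := dv x.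
apply: eq_Ck (CkM openT (Ck_cst k setT v) (IH (flat_deriv p))) => [|x _].
  exact: openT.
by have [_ ->] := dv x.
Qed.

Lemma flat1_gt0 x : 0 < x -> 0 < flat 1 x.
Proof. by move=> x0; rewrite /flat x0 hornerC mul1r expR_gt0. Qed.

Lemma flat1_ge0 x : 0 <= flat 1 x.
Proof. by have [/flat1_gt0/ltW//|x0] := ltP 0 x; rewrite /flat ltNge x0. Qed.

Lemma flat1_eq0 x : x <= 0 -> flat 1 x = 0.
Proof. by move=> x0; rewrite /flat ltNge x0. Qed.

Definition smooth_step x : R := flat 1 (2 - x) / (flat 1 (2 - x) + flat 1 (x - 1)).

(** The arguments [2 - x] and [x - 1] add up to 1, so at least one of them is positive. *)
Lemma smooth_step_den x : 0 < flat 1 (2 - x) + flat 1 (x - 1).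
Proof.
have [x2|x2] := ltP x 2.
  by apply: ltr_pwDl; [apply: flat1_gt0; lra|exact: flat1_ge0].
by apply: ltr_wpDl; [exact: flat1_ge0|apply: flat1_gt0; lra].
Qed.

Lemma smooth_step1 x : x <= 1 -> smooth_step x = 1.
Proof.
move=> x1; have := smooth_step_den x; rewrite /smooth_step.
by rewrite (@flat1_eq0 (x - 1)) ?subr_le0// addr0 => h; rewrite divff ?gt_eqF.
Qed.

Lemma smooth_step0 x : 2 <= x -> smooth_step x = 0.
Proof. by move=> x2; rewrite /smooth_step flat1_eq0 ?subr_le0// mul0r. Qed.

Lemma Ck_smooth_step k : Ck k setT smooth_step.
Proof.
have cid : Ck k setT (@id R) by apply: (@Ck_linear _ _ k setT (@idfun R)) => x; exact:
  cvg_id.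
have c1 : Ck k setT (fun x => flat 1 (2 - x)).
  apply: (@Ck_comp1 _ R k setT setT (flat 1)) => //; [exact: openT|exact: openT|exact:
    Ck_flat|].
  apply: eq_Ck (CkD openT (Ck_cst k setT 2) (CkM openT (Ck_cst k setT (-1)) cid)) => [|x _].
    exact: openT.
  by rewrite /= mulN1r.
have c2 : Ck k setT (fun x => flat 1 (x - 1)).
  apply: (@Ck_comp1 _ R k setT setT (flat 1)) => //; [exact: openT|exact: openT|exact:
    Ck_flat|].
  exact: (CkD openT cid (Ck_cst k setT (-1))).
apply: (CkM openT c1 (CkV openT _ (CkD openT c1 c2))) => x _.
by rewrite gt_eqF ?smooth_step_den.
Qed.

End SmoothStep.

(** * Smooth functions and bump functions on a manifold *)

Lemma open_preimage {T S : topologicalType} (A : set T) (f : T -> S) (O : set S) :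
  open A -> (forall x, A x -> {for x, continuous f}) -> open O ->
  open (A `&` f @^-1` O).
Proof.
move=> oA fc oO; rewrite openE => x [Ax Ofx]; apply: filterI.
  exact: open_nbhs_nbhs.
by apply: (fc x Ax); exact: open_nbhs_nbhs.
Qed.

Section Smooth.
Context {R : realType} {V : normedModType R}.
Implicit Types (f g : V -> R) (x v : V) (U : set V).

Lemma smooth_subset U U' f : U' `<=` U -> smooth U f -> smooth U' f.
Proof. by move=> UU' fs k; exact: Ck_subset UU' (fs k). Qed.

Lemma eq_smooth U f g : open U -> (forall x, U x -> f x = g x) ->
  smooth U f -> smooth U g.
Proof. by move=> oU fg fs k; exact: eq_Ck fg (fs k). Qed.

Lemma smooth_local U f :
  (forall x, U x -> exists2 U', U' x & smooth U' f) -> smooth U f.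
Proof.
by move=> Uf k; apply: Ck_local => x /Uf[U' U'x fs]; exists U'.
Qed.

Lemma smooth_cst U (a : R) : smooth U (cst a).
Proof. by move=> k; exact: Ck_cst. Qed.

Lemma smoothD U f g : open U -> smooth U f -> smooth U g ->
  smooth U (fun x => f x + g x).
Proof. by move=> oU fs gs k; exact: CkD. Qed.

Lemma smoothM U f g : open U -> smooth U f -> smooth U g ->
  smooth U (fun x => f x * g x).
Proof. by move=> oU fs gs k; exact: CkM. Qed.

Lemma smoothV U f : open U -> (forall x, U x -> f x != 0) -> smooth U f ->
  smooth U (fun x => (f x)^-1).
Proof. by move=> oU f0 fs k; exact: CkV. Qed.

Lemma smooth_derivable U f x v : smooth U f -> U x -> derivable f x v.
Proof. by move=> /(_ 1%N)[_ /(_ v)[+ _]]; apply. Qed.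

Lemma smooth_derive U f v : smooth U f -> smooth U (fun x => 'D_v f x).
Proof. by move=> fs k; have [_ /(_ v)[]] := fs k.+1. Qed.

Lemma smooth_continuous U f x : smooth U f -> U x -> {for x, continuous f}.
Proof. by move=> /(_ 0%N)[+ _]; apply. Qed.

Lemma smooth_comp {W : normedModType R} {I : finType} (e : I -> W)
    (U : set V) (O : set W) (f : W -> R) (c : I -> V -> R) :
  open U -> open O -> smooth O f -> (forall j, smooth U (c j)) ->
  (forall x, U x -> O (\sum_j c j x *: e j)) ->
  smooth U (fun x => f (\sum_j c j x *: e j)).
Proof.
move=> oU oO fs cs UO k.
by apply: Ck_comp (fs k) _ UO => // j; exact: cs.
Qed.

Lemma smooth_comp1 (U : set V) (O : set R) (f : R -> R) (g : V -> R) :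
  open U -> open O -> smooth O f -> smooth U g -> (forall x, U x -> O (g x)) ->
  smooth U (fun x => f (g x)).
Proof. by move=> oU oO fs gs UO k; apply: Ck_comp1 (fs k) (gs k) UO. Qed.

End Smooth.

Lemma smooth_fst {R : realType} {V W : normedModType R} (U : set V) (U' : set (V * W))
    (f : V -> R) :
  open U -> open U' -> smooth U f -> (forall p, U' p -> U p.1) ->
  smooth U' (fun p => f p.1).
Proof.
move=> oU oU' fs UU' k; elim: k f fs => [|k IH] f fs.
  split=> // p U'p; apply: (@continuous_comp _ _ _ fst f); first exact: cvg_fst.
  by apply: smooth_continuous fs _; exact: UU'.
split=> [p U'p|v].
  apply: (@continuous_comp _ _ _ fst f); first exact: cvg_fst.
  by apply: smooth_continuous fs _; exact: UU'.
have dd p : U' p -> is_derive p v (fun p => f p.1) ('D_(v.1) f p.1).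
  move=> U'p; have fd := @smooth_derivable _ _ U f p.1 v.1 fs (UU' p U'p).
  by split.
split=> [p U'p|]; first by have [] := dd p U'p.
apply: eq_Ck (IH _ (@smooth_derive _ _ U f v.1 fs)).
  exact: oU'.
by move=> p U'p; have [_ ->] := dd p U'p.
Qed.

Lemma smooth_coord {R : realType} {n : nat} (U : set 'rV[R]_n) i :
  smooth U (fun x : 'rV[R]_n => x 0 i).
Proof.
move=> k; have lx : linear (fun x : 'rV[R]_n => x 0 i) by move=> a x y; rewrite !mxE.
pose L := GRing.isLinear.Build _ _ _ _ _ lx.
pose f : {linear 'rV[R]_n -> R} := HB.pack (fun x : 'rV[R]_n => x 0 i) L.
by apply: (@Ck_linear _ _ k U f) => x; exact: coord_continuous.
Qed.

Section ManifoldSmooth.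
Context {R : realType} {n : nat} {M : manifold R n}.
Implicit Types (c : chart R n M) (U O : set M) (f g : M -> R) (m : M).

Lemma open_cimgI c U : atlas c -> open U -> open (cimg c `&` cinv c @^-1` U).
Proof.
move=> ac oU; apply: open_preimage => //; first exact: (atlas_open ac).2.
by move=> x; exact: atlas_inv_cont.
Qed.

Lemma open_cdomI c (O : set 'rV[R]_n) : atlas c -> open O ->
  open (cdom c `&` cmap c @^-1` O).
Proof.
move=> ac oO; apply: open_preimage => //; first exact: (atlas_open ac).1.
by move=> x; exact: atlas_map_cont.
Qed.

Lemma smooth_on_subset U O f : O `<=` U -> smooth_on U f -> smooth_on O f.
Proof.
move=> OU fs c ac; apply: smooth_subset (fs c ac) => x [cx Ox].
by split=> //; exact: OU.
Qed.

Lemma eq_smooth_on U f g : open U -> (forall m, U m -> f m = g m) ->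
  smooth_on U f -> smooth_on U g.
Proof.
move=> oU fg fs c ac; apply: eq_smooth (fs c ac); first exact: open_cimgI.
by move=> x [_ /fg].
Qed.

Lemma smooth_on_local U f :
  (forall m, U m -> exists2 U', U' m & smooth_on U' f) -> smooth_on U f.
Proof.
move=> Uf c ac; apply: smooth_local => x [cx /Uf[U' U'x fs]].
by exists (cimg c `&` cinv c @^-1` U') => //; exact: fs.
Qed.

Lemma smooth_on_cst U (a : R) : smooth_on U (cst a).
Proof. by move=> c ac; exact: smooth_cst. Qed.

Lemma smooth_onD U f g : open U -> smooth_on U f -> smooth_on U g ->
  smooth_on U (fun m => f m + g m).
Proof.
by move=> oU fs gs c ac; apply: smoothD (fs c ac) (gs c ac); exact: open_cimgI.
Qed.

Lemma smooth_onM U f g : open U -> smooth_on U f -> smooth_on U g ->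
  smooth_on U (fun m => f m * g m).
Proof.
by move=> oU fs gs c ac; apply: smoothM (fs c ac) (gs c ac); exact: open_cimgI.
Qed.

Lemma smooth_onN U f : open U -> smooth_on U f -> smooth_on U (fun m => - f m).
Proof.
move=> oU fs; apply: eq_smooth_on (smooth_onM oU (smooth_on_cst U (-1)) fs) => //.
by move=> m _; rewrite /= mulN1r.
Qed.

Lemma smooth_onV U f : open U -> (forall m, U m -> f m != 0) -> smooth_on U f ->
  smooth_on U (fun m => (f m)^-1).
Proof.
move=> oU f0 fs c ac; apply: smoothV (fs c ac); first exact: open_cimgI.
by move=> x [_ /f0].
Qed.

Lemma smooth_on_sum U (I : Type) (s : seq I) (P : pred I) (f : I -> M -> R) :
  open U -> (forall i, P i -> smooth_on U (f i)) ->
  smooth_on U (fun m => \sum_(i <- s | P i) f i m).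
Proof.
move=> oU fs; elim: s => [|i s IH].
  by apply: eq_smooth_on (smooth_on_cst U 0) => // m _; rewrite big_nil.
have [Pi|Pi] := boolP (P i).
  apply: eq_smooth_on (smooth_onD oU (fs i Pi) IH) => // m _.
  by rewrite big_cons Pi.
by apply: eq_smooth_on IH => // m _; rewrite big_cons (negbTE Pi).
Qed.

Lemma smooth_on_prod U (I : Type) (s : seq I) (P : pred I) (f : I -> M -> R) :
  open U -> (forall i, P i -> smooth_on U (f i)) ->
  smooth_on U (fun m => \prod_(i <- s | P i) f i m).
Proof.
move=> oU fs; elim: s => [|i s IH].
  by apply: eq_smooth_on (smooth_on_cst U 1) => // m _; rewrite big_nil.
have [Pi|Pi] := boolP (P i).
  apply: eq_smooth_on (smooth_onM oU (fs i Pi) IH) => // m _.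
  by rewrite big_cons Pi.
by apply: eq_smooth_on IH => // m _; rewrite big_cons (negbTE Pi).
Qed.

Lemma smooth_onU U O f : smooth_on U f -> smooth_on O f -> smooth_on (U `|` O) f.
Proof.
by move=> fU fO; apply: smooth_on_local => m [Um|Om]; [exists U|exists O].
Qed.

Lemma smooth_on_chart c (O : set 'rV[R]_n) (f : 'rV[R]_n -> R) : atlas c ->
  open O -> smooth O f -> smooth_on (cdom c `&` cmap c @^-1` O) (f \o cmap c).
Proof.
move=> ac oO fs c' ac'.
set U := _ `&` _; have oU : open U by apply: open_cimgI => //; exact: open_cdomI.
have E x : \sum_j cmap c (cinv c' x) 0 j *: delta_mx 0 j = cmap c (cinv c' x).
  by rewrite -row_sum_delta.
apply: (@eq_smooth _ _ _
  (fun x => f (\sum_j cmap c (cinv c' x) 0 j *: delta_mx 0 j))) => //.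
  by move=> x _ /=; rewrite E.
apply: (@smooth_comp _ _ _ _ _ U O f) => //.
  by move=> j; apply: smooth_subset (atlas_smooth ac' ac j) => x [? []].
by move=> x [_ [_]]; rewrite E.
Qed.

Lemma smooth_on_coord c i : atlas c -> smooth_on (cdom c) (fun m => cmap c m 0 i).
Proof.
move=> ac; apply: smooth_on_subset (smooth_on_chart ac openT (@smooth_coord _ _ setT i)).
by move=> m.
Qed.

Definition dchart c (v : 'rV[R]_n) f m : R := 'D_v (f \o cinv c) (cmap c m).

Lemma smooth_on_dchart c v U f : atlas c -> open U -> smooth_on U f ->
  smooth_on (cdom c `&` U) (dchart c v f).
Proof.
move=> ac oU fs.
have h := smooth_on_chart ac (open_cimgI ac oU) (@smooth_derive _ _ _ _ v (fs c ac)).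
apply: smooth_on_subset h => m [cm Um]; split=> //=.
by have [? ->] := atlas_map ac cm.
Qed.

(** Extension by zero: [f] is [g] on [O] and 0 on the open complement of [C], and these two open
    sets cover everything. In this way data living over a chart domain become global after
    multiplication by a bump function. *)
Lemma smooth_on_ext0 U O C f g : open U -> open O -> closed C -> C `<=` O ->
  smooth_on (U `&` O) g -> (forall m, O m -> f m = g m) ->
  (forall m, ~ C m -> f m = 0) -> smooth_on U f.
Proof.
move=> oU oO cC CO gs fg f0.
have oC : open (~` C) by rewrite openC.
have h1 : smooth_on (U `&` O) f.
  by apply: eq_smooth_on gs => //; [exact: openI|move=> m [_ /fg]].
have h2 : smooth_on (~` C) f.
  by apply: eq_smooth_on (smooth_on_cst _ 0) => // m /f0.
apply: smooth_on_subset (smooth_onU h1 h2) => m Um.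
by have [/CO Om|nC] := pselect (C m); [left|right].
Qed.

(** A smooth step of the squared Euclidean distance in a chart; the norm of ['rV[R]_n] is a maximum
    and not smooth. The function vanishes outside the image [C] of a closed ball, which is compact
    and therefore closed, [M] being Hausdorff. *)
Lemma exists_bump m O : open O -> O m -> exists phi : M -> R,
  [/\ Cinf phi, exists U, [/\ open U, U m, U `<=` O & forall y, U y -> phi y = 1] &
      exists C, [/\ closed C, C `<=` O & forall y, ~ C y -> phi y = 0]].
Proof.
move=> oO Om; have [c ac cm] := atlas_cover m.
set a := cmap c m; have [ca ia] := atlas_map ac cm; rewrite -/a in ca ia.
have oO' := open_cimgI ac oO.
have nO : nbhs a (cimg c `&` cinv c @^-1` O).
  by apply: open_nbhs_nbhs; split=> //; split=> //=; rewrite ia.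
have [r /= r0 br] := (nbhs_ballP _ _).1 nO.
(* Outside the closed ball of radius [r / 2] some coordinate differs from that of [a] by more than
   [2 * rho], so [q] is at least 4 there, beyond the point 2 from which the step vanishes. *)
pose rho := r / 4; have rho0 : 0 < rho by rewrite divr_gt0.
pose q (x : 'rV[R]_n) := (rho ^- 2) * \sum_i (x 0 i - a 0 i) ^+ 2.
have qs (U : set 'rV[R]_n) : open U -> smooth U q.
  move=> oU; apply: smoothM => //; first exact: smooth_cst.
  move=> k; apply: (@Ck_sum R 'rV[R]_n k U 'I_n (index_enum 'I_n)
    (fun i (x : 'rV[R]_n) => (x 0 i - a 0 i) ^+ 2)) => // i.
  have hc : Ck k U (fun x : 'rV[R]_n => x 0 i - a 0 i).
    by apply: CkD => //; [exact: smooth_coord|exact: Ck_cst].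
  exact: (CkM oU hc hc).
have qbig x : ~ closed_ball a (r / 2) x -> 2 <= q x.
  rewrite closed_ballE ?divr_gt0// /closed_ball_ /= => /negP; rewrite -ltNge => rax.
  have [i hi] : exists i, r / 2 < `|a 0 i - x 0 i|.
    apply/not_existsP => h; move: rax; apply/negP; rewrite -leNgt.
    rewrite [leLHS]/Num.Def.normr/= mx_normrE bigmax_le ?divr_ge0 ?(ltW r0)//.
    move=> [i j] _ /=; rewrite ord1 !mxE leNgt; apply/negP; exact: h.
  have h2 : rho ^+ 2 * 4 <= (x 0 i - a 0 i) ^+ 2.
    have -> : (x 0 i - a 0 i) ^+ 2 = `|a 0 i - x 0 i| ^+ 2.
      by rewrite distrC real_normK ?num_real.
    by rewrite /rho; nra.
  rewrite /q ler_pdivlMl ?exprn_gt0// (bigD1 i)//=.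
  have : 0 <= \sum_(j | j != i) (x 0 j - a 0 j) ^+ 2.
    by apply: sumr_ge0 => j _; exact: sqr_ge0.
  have : 0 <= rho ^+ 2 by exact: sqr_ge0.
  lra.
pose phi y := if `[< cdom c y >] then smooth_step (q (cmap c y)) else 0.
pose C := cinv c @` closed_ball a (r / 2).
have r2 : 0 < r / 2 by rewrite divr_gt0.
have ballO x : closed_ball a (r / 2) x -> cimg c x /\ O (cinv c x).
  by move=> hx; apply: br; apply: closed_ball_subset hx => //; lra.
have cC : closed C.
  apply: compact_closed; first exact: carrier_hausdorff.
  apply: continuous_compact.
    apply: continuous_in_subspaceT => x; rewrite inE => /ballO[cx _].
    exact: atlas_inv_cont.
  apply: bounded_closed_compact; last exact: closed_ball_closed.
  exists (`|a| + r / 2); split=> [|t rt x]; first exact: num_real.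
  rewrite closed_ballE// /closed_ball_ /= => ax.
  rewrite (le_trans _ (ltW rt))// -[x](subrK a) -[a in X in _ <= `|X| + _]addr0 addrC.
  rewrite addr0 (le_trans (ler_normD _ _))// lerD2l -normrN opprB//.
have CO : C `<=` O by move=> _ [x /ballO[_ ?] <-].
have phi0 y : ~ C y -> phi y = 0.
  move=> nC; rewrite /phi; case: asboolP => // cy; apply/smooth_step0/qbig => h.
  by apply: nC; exists (cmap c y) => //; have [] := atlas_map ac cy.
have Ccd : C `<=` cdom c.
  by move=> _ [x /ballO[cx _] <-]; have [] := atlas_inv ac cx.
have oc := (atlas_open ac).1.
have ss : smooth setT (@smooth_step R) by move=> k; exact: Ck_smooth_step.
exists phi; split.
- apply: (@smooth_on_ext0 setT (cdom c) C _ ((smooth_step \o q) \o cmap c)) => //.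
  + exact: openT.
  + rewrite setTI; have h : smooth setT (smooth_step \o q).
      by apply: smooth_comp1 ss (qs _ openT) _ => //; exact: openT.
    by apply: smooth_on_subset (smooth_on_chart ac openT h) => y.
  + by move=> y cy; rewrite /phi asboolT.
- exists ((cdom c `&` cmap c @^-1` (setT `&` q @^-1` [set t | t < 1] `&` ball a r))); split.
  + apply: open_cdomI => //; apply: openI; last exact: ball_open.
    apply: open_preimage; [exact: openT| |exact: open_lt].
    by move=> x _; exact: smooth_continuous (qs _ openT) _.
  + split=> //=; split; last exact: ballxx.
    split=> //=; rewrite /q big1 ?mulr0// => i _.
    by rewrite subrr expr0n.
  + by move=> y [cy [_ /br[_ /=]]]; have [_ ->] := atlas_map ac cy.
  + by move=> y [cy [[_ /= /ltW qy] _]]; rewrite /phi asboolT// smooth_step1.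
- by exists C.
Qed.

End ManifoldSmooth.

Lemma smooth_snd {R : realType} {V : normedModType R} (U : set (V * R)) : smooth U (fun p
  => p.2).
Proof.
move=> k; have lx : linear (fun p : V * R => p.2) by [].
pose L := GRing.isLinear.Build _ _ _ _ _ lx.
pose f : {linear (V * R)%type -> R} := HB.pack (fun p : V * R => p.2) L.
by apply: (@Ck_linear _ _ k U f) => x; exact: cvg_snd.
Qed.

(** * Smooth functions and sections of an AV-bundle *)

Section AVBundle.
Context {R : realType} {n : nat} {M : manifold R n} {Z : avbundle M}.
Implicit Types (z : Z) (F G : Z -> R) (f g : M -> R) (sigma : M -> Z) (m : M).

Lemma zsub_addl z z' t : zeta z = zeta z' -> zsub (zadd z t) z' = zsub z z' + t.
Proof. by move=> /esym/zsubK zz'; rewrite -{1}zz' -zaddD zaddK. Qed.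

Lemma zsub_addr z z' t : zeta z = zeta z' -> zsub z (zadd z' t) = zsub z z' - t.
Proof.
move=> zz'; have e : zeta (zadd z' t) = zeta z by rewrite zeta_add.
by rewrite -[in RHS](zsubK e) -zaddD zaddK addrAC subrr add0r.
Qed.

Lemma zsubxx z : zsub z z = 0.
Proof. by rewrite -{1}(zadd0 z) zaddK. Qed.

Lemma zsub_trans z z' z'' : zeta z = zeta z' -> zeta z' = zeta z'' ->
  zsub z z'' = zsub z' z'' + zsub z z'.
Proof. by move=> /esym zz' z'z''; rewrite -zsub_addl// zsubK. Qed.

Lemma zpointP z : exists c tau p,
  [/\ atlas c, ltriv tau, zdom c tau p & zpoint c tau p = z].
Proof.
have [c ac cz] := atlas_cover (zeta z); have [tau lt tz] := @ltriv_cover _ _ _ Z (zeta z).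
have [ci ic] := atlas_map ac cz.
exists c, tau, (cmap c (zeta z), zsub z (tau.2 (zeta z))); split=> //.
  by split=> //=; rewrite ic.
by rewrite /zpoint /= ic zsubK//; exact: ltriv_sec.
Qed.

Lemma zeta_zpoint c (tau : set M * (M -> Z)) p : ltriv tau -> zdom c tau p ->
  zeta (zpoint c tau p) = cinv c p.1.
Proof. by move=> lt [_ tp]; rewrite /zpoint zeta_add; exact: ltriv_sec. Qed.

Lemma open_zdom c (tau : set M * (M -> Z)) : atlas c -> ltriv tau -> open (zdom c tau).
Proof.
move=> ac lt.
rewrite (_ : zdom c tau = setT `&` fst @^-1` (cimg c `&` cinv c @^-1` tau.1)).
  apply: open_preimage; first exact: openT.
    by move=> p _; exact: cvg_fst.
  by apply: open_cimgI => //; exact: ltriv_open.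
by rewrite setTI.
Qed.

Lemma zpoint_zadd c (tau : set M * (M -> Z)) p t :
  zadd (zpoint c tau p) t = zpoint c tau (p.1, p.2 + t).
Proof. by rewrite /zpoint zaddD. Qed.

Lemma CinfZ_cst (a : R) : CinfZ (cst a : Z -> R).
Proof. by move=> c tau _ _; exact: smooth_cst. Qed.

Lemma CinfZD F G : CinfZ F -> CinfZ G -> CinfZ (F + G).
Proof.
by move=> FC GC c tau ac lt; apply: smoothD (FC _ _ ac lt) (GC _ _ ac lt); exact: open_zdom.
Qed.

Lemma CinfZM F G : CinfZ F -> CinfZ G -> CinfZ (F * G).
Proof.
by move=> FC GC c tau ac lt; apply: smoothM (FC _ _ ac lt) (GC _ _ ac lt); exact: open_zdom.
Qed.

Lemma CinfZZ (t : R) F : CinfZ F -> CinfZ (t *: F).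
Proof. by move=> FC; exact: CinfZM (CinfZ_cst t) FC. Qed.

Lemma CinfZN F : CinfZ F -> CinfZ (- F).
Proof. by move=> FC; rewrite -scaleN1r; exact: CinfZZ. Qed.

Lemma CinfZB F G : CinfZ F -> CinfZ G -> CinfZ (F - G).
Proof. by move=> FC GC; apply: CinfZD => //; exact: CinfZN. Qed.

Lemma CinfZ_Ffun f : Cinf f -> CinfZ (Ffun f : Z -> R).
Proof.
move=> fC c tau ac lt.
have h : smooth (zdom c tau) (fun p => (f \o cinv c) p.1).
  apply: smooth_fst (fC c ac) _; [exact: open_cimgI ac openT|exact: open_zdom|].
  by move=> p [cp _].
apply: eq_smooth h; first exact: open_zdom.
by move=> p zp /=; rewrite /Ffun zeta_zpoint.
Qed.

Lemma Fsec_zpoint sigma c (tau : set M * (M -> Z)) p : SecZ sigma ->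
  ltriv tau -> zdom c tau p -> Fsec sigma (zpoint c tau p) =
    zsub (sigma (cinv c p.1)) (tau.2 (cinv c p.1)) - p.2.
Proof.
move=> [sz _] lt zp; rewrite /Fsec zeta_zpoint// /zpoint zsub_addr//.
by rewrite sz ltriv_sec//; case: zp.
Qed.

Lemma CinfZ_Fsec sigma : SecZ sigma -> CinfZ (Fsec sigma).
Proof.
move=> ss c tau ac lt; have oz := open_zdom ac lt.
have h : smooth (zdom c tau) (fun p =>
    ((fun m => zsub (sigma m) (tau.2 m)) \o cinv c) p.1 + (-1) * p.2).
  apply: smoothD => //.
    apply: smooth_fst (ss.2 tau lt c ac) _ => //.
      by apply: open_cimgI => //; exact: ltriv_open.
  by apply: smoothM => //; [exact: smooth_cst|exact: smooth_snd].
apply: eq_smooth h => // p zp /=.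
by rewrite Fsec_zpoint// mulN1r.
Qed.

Lemma Fsec_zadd sigma z t : SecZ sigma -> Fsec sigma (zadd z t) = Fsec sigma z - t.
Proof. by move=> [sz _]; rewrite /Fsec zeta_add zsub_addr// sz. Qed.

Lemma Fsec_at sigma m : SecZ sigma -> Fsec sigma (sigma m) = 0.
Proof. by move=> [sz _]; rewrite /Fsec sz zsubxx. Qed.

Definition frameZ (i : 'I_n + unit) : 'rV[R]_n * R :=
  match i with inl a => (delta_mx 0 a, 0) | inr _ => (0, 1) end.

Lemma sum_frameZ (W : lmodType R) (h : 'I_n + unit -> W) :
  \sum_i h i = \sum_a h (inl a) + h (inr tt).
Proof. by rewrite big_sumType /=; congr (_ + _); rewrite (big_pred1 tt)//; case. Qed.

Lemma decomp_frameZ (p : 'rV[R]_n * R) :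
  p = \sum_i (match i with inl a => p.1 0 a | inr _ => p.2 end) *: frameZ i.
Proof.
have E1 (k : nat) (h : 'I_k -> 'rV[R]_n * R) : (\sum_a h a).1 = \sum_a (h a).1.
  exact: (big_morph (fun p => p.1)).
have E2 (k : nat) (h : 'I_k -> 'rV[R]_n * R) : (\sum_a h a).2 = \sum_a (h a).2.
  exact: (big_morph (fun p => p.2)).
rewrite sum_frameZ; apply/eqP; rewrite /eq_op /=; apply/andP; split; apply/eqP.
  by rewrite E1 /= scaler0 addr0 {1}[p.1]row_sum_delta.
rewrite E2 /= big1 ?add0r; first by rewrite [RHS]mulr1.
by move=> a _; rewrite scaler0.
Qed.

Lemma Cinf_comp_sec F sigma : CinfZ F -> SecZ sigma -> Cinf (F \o sigma).
Proof.
move=> FC ss; apply: smooth_on_local => m _.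
have [tau lt tm] := @ltriv_cover _ _ _ Z m.
exists tau.1 => // c ac; have ot := @ltriv_open _ _ _ _ _ lt.
have oU := open_cimgI ac ot.
pose co (i : 'I_n + unit) (x : 'rV[R]_n) := match i with
  | inl a => x 0 a | inr _ => zsub (sigma (cinv c x)) (tau.2 (cinv c x)) end.
have E x : (x, zsub (sigma (cinv c x)) (tau.2 (cinv c x))) = \sum_i co i x *: frameZ i.
  rewrite [LHS]decomp_frameZ; apply: eq_bigr; case=> //.
apply: (@eq_smooth _ _ _ (fun x => (F \o zpoint c tau) (\sum_i co i x *: frameZ i))) => //.
  move=> x [cx tx] /=; rewrite -E /zpoint /= zsubK//.
  by rewrite ltriv_sec//; case: ss.
apply: smooth_comp (FC c tau ac lt) _ _ => //; first exact: open_zdom.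
  case=> [a|?] /=; first exact: smooth_coord.
  exact: ss.2.
by move=> x [cx tx]; rewrite -E.
Qed.

End AVBundle.

(** The codes of the basic open sets serve as indices: [h k] is some [y] such that [U y] contains a
    basic set of code [k], and [None] if there is no such [y]. *)
Lemma lindelof {T : topologicalType} (U : T -> set T) :
  @second_countable T -> (forall x, open (U x) /\ U x x) ->
  exists h : nat -> option T, forall x, exists k y, h k = Some y /\ U y x.
Proof.
move=> [B /countable_injP[f finj] [_ Bx]] oU.
pose P k y := exists b, [/\ B b, f b = k & b `<=` U y].
pose h k := if pselect (exists y, P k y) is left e then Some (projT1 (cid e)) else None.
exists h => x.
have [b [/= Bb bx] bU] : filter_from [set V | B V /\ V x] id (U x).
  by apply: Bx; exact: open_nbhs_nbhs.
exists (f b); rewrite /h; case: pselect => [e|[]]; last by exists x, b.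
exists (projT1 (cid e)); split=> //.
have [b' [Bb' fb' b'U]] := projT2 (cid e).
have E : b' = b by apply: finj; rewrite ?inE.
by apply: b'U; rewrite E.
Qed.

(** * Existence of a global section *)

Section GlobalSection.
Context {R : realType} {n : nat} {M : manifold R n} (Z : avbundle M).

(* The functions b k * \prod_(j < k) (1 - b j) sum to 1 as soon as some b k is
   equal to 1, and all those of index larger than k vanish where b k = 1; they
   thus form a partition of unity that is locally finite without any choice of a
   locally finite refinement. *)
Lemma telescoping_weights (b : nat -> R) N :
  \sum_(k < N) b k * \prod_(j < k) (1 - b j) = 1 - \prod_(j < N) (1 - b j).
Proof.
elim: N => [|N IH]; first by rewrite !big_ord0 subrr.
by rewrite big_ord_recr big_ord_recr /= IH; ring.
Qed.

(** Each [w k y] weights the displacement from [z] to a local section, and adding the weighted sum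
    to [z] gives an affine combination of local sections. As the weights sum to 1, the result does
    not depend on the base point [z] in the fibre; near a given point it can thus be computed from
    any member of [ltriv] defined there. *)
Lemma exists_section : exists sigma : M -> Z, SecZ sigma.
Proof.
have tauP (m : M) : exists t : set M * (M -> Z), ltriv t /\ t.1 m.
  by have [t ? ?] := @ltriv_cover _ _ _ Z m; exists t.
have [tau tauC] := choice tauP.
have bumpP (m : M) : exists d : (M -> R) * set M * set M,
    [/\ Cinf d.1.1, open d.1.2 /\ d.1.2 m, forall y, d.1.2 y -> d.1.1 y = 1,
        closed d.2 & d.2 `<=` (tau m).1 /\ forall y, ~ d.2 y -> d.1.1 y = 0].
  have [lt tm] := tauC m; have ot := @ltriv_open _ _ _ _ _ lt.
  have [phi [pC [U [oU Um _ U1]] [C [cC Ct C0]]]] := exists_bump ot tm.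
  by exists (phi, U, C).
have [d dP] := choice bumpP.
have [h hP] := @lindelof M (fun m => (d m).1.2) (@carrier_second_countable _ _ M)
  (fun m => let: And5 _ x _ _ _ := dP m in x).
pose b k y := if h k is Some m then (d m).1.1 y else 0.
pose T k y (z : Z) := if h k is Some m then zsub ((tau m).2 y) z else 0.
pose w k y := b k y * \prod_(j < k) (1 - b j y).
have bC k : Cinf (b k).
  rewrite /b; case: (h k) => [m|]; last exact: smooth_on_cst.
  by case: (dP m).
have wC k : Cinf (w k).
  apply: smooth_onM; [exact: openT|exact: bC|].
  apply: smooth_on_prod; first exact: openT.
  move=> j _; apply: smooth_onD; [exact: openT|exact: smooth_on_cst|].
  by apply: smooth_onN; [exact: openT|exact: bC].
have sumw y N k : (k < N)%N -> b k y = 1 -> \sum_(k < N) w k y = 1.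
  move=> kN bk; rewrite (telescoping_weights (fun k => b k y)) (bigD1 (Ordinal kN))//= bk.
  by rewrite subrr mul0r subr0.
(* Where the trivialisation of index [k] is not defined, its section takes an arbitrary value, but
   the weight vanishes. *)
have wT k y z z' : zeta z = y -> zeta z' = y -> w k y * T k y z' =
    w k y * T k y z + w k y * zsub z z'.
  move=> zy zy'; rewrite /T /w /b; case: (h k) => [m|]; last by rewrite !mul0r addr0.
  have [_ _ _ _ [Ct C0]] := dP m; have [ym|ym] := pselect ((tau m).1 y); last first.
    by rewrite C0 ?mul0r ?addr0// => /Ct.
  have tz : zeta ((tau m).2 y) = y by apply: ltriv_sec => //; case: (tauC m).
  by rewrite -mulrDr addrC -(@zsub_trans _ _ _ _ _ z z') ?zy ?tz ?zy'.
pose S N y z := zadd z (\sum_(k < N) w k y * T k y z).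
have SE N k y z z' : zeta z = y -> zeta z' = y -> (k < N)%N -> b k y = 1 ->
    S N y z = S N y z'.
  move=> zy zy' kN bk; rewrite /S.
  rewrite [X in zadd z' X](eq_bigr (fun k : 'I_N => w k y * T k y z + w k y * zsub z z')).
    rewrite big_split /= -mulr_suml (sumw y N k)// mul1r addrC zaddD zsubK//.
    by rewrite zy' zy.
  by move=> j _; exact: wT.
(* Every weight of index greater than [k] contains the factor [1 - b k y], which is 0. *)
have SN N N' k y z : (k < N)%N -> (N <= N')%N -> b k y = 1 -> S N' y z = S N y z.
  move=> kN NN' bk; rewrite /S; congr zadd.
  rewrite -(subnKC NN') big_split_ord /= [X in _ + X]big1 ?addr0// => i _.
  have ki : (k < N + i)%N by rewrite ltn_addr.
  by rewrite /w (bigD1 (Ordinal ki))//= bk subrr mul0r mulr0 mul0r.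
have bP y : exists k, b k y = 1.
  have [k [m [hk my]]] := hP y; exists k; rewrite /b hk.
  by have [_ _ + _ _] := dP m; apply.
have [K KP] := choice bP.
pose sigma y := S (K y).+1 y ((tau y).2 y).
have tz y : zeta ((tau y).2 y) = y by have [? ?] := tauC y; exact: ltriv_sec.
have sE k y z : zeta z = y -> b k y = 1 -> sigma y = S k.+1 y z.
  move=> zy bk; rewrite /sigma (SE _ (K y) y _ z)//.
  have [kK|/ltnW Kk] := leqP k (K y); first exact: (SN _ _ k).
  by rewrite -(SN _ k.+1 (K y)).
have sz y : zeta (sigma y) = y by rewrite /sigma /S zeta_add.
exists sigma; split=> // t lt; apply: smooth_on_local => y0 ty0.
have ot := @ltriv_open _ _ _ _ _ lt.
have [k [m [hk my0]]] := hP y0; have [_ [oU _] U1 _ _] := dP m.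
exists ((d m).1.2 `&` t.1) => //; have oI := openI oU ot.
apply: (@eq_smooth_on _ _ _ _ (fun y => \sum_(j < k.+1) w j y * T j y (t.2 y))) => //.
  move=> y [my ty]; have tyz : zeta (t.2 y) = y by exact: ltriv_sec.
  rewrite (sE k y (t.2 y))//; last by rewrite /b hk U1.
  by rewrite /S zsub_addl// zsubxx add0r.
apply: smooth_on_sum => // j _; rewrite /T /w /b.
case hj : (h j) => [mj|]; last first.
  by apply: eq_smooth_on (smooth_on_cst _ 0) => // y _; rewrite mulr0.
have [_ _ _ cC [Ct C0]] := dP mj; have [ltj _] := tauC mj.
have otj := @ltriv_open _ _ _ _ _ ltj.
apply: (smooth_on_ext0 oI otj cC Ct _ (fun _ _ => erefl)).
  apply: smooth_onM; first exact: openI.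
    by have := wC j; rewrite /w /b hj; apply: smooth_on_subset.
  by apply: smooth_on_subset (ltriv_smooth lt ltj) => y [[_ ty] tjy]; split.
by move=> y nC; rewrite C0// mul0r mul0r.
Qed.

End GlobalSection.

Lemma is_derive_bigsum {R : realType} {V : normedModType R} (I : Type) (s : seq I)
    (h : I -> V -> R) (dh : I -> R) (x v : V) :
  (forall i, is_derive x v (h i) (dh i)) ->
  is_derive x v (fun y => \sum_(i <- s) h i y) (\sum_(i <- s) dh i).
Proof.
move=> hd; elim: s => [|i s IH].
  rewrite big_nil (_ : (fun y => _) = cst 0); first exact: is_derive_cst.
  by apply/funext => y; rewrite big_nil.
rewrite big_cons (_ : (fun y => _) = h i + (fun y => \sum_(i <- s) h i y)).
  exact: is_deriveD.
by apply/funext => y; rewrite big_cons.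
Qed.

(** * First-order operators *)

Section Operators.
Context {R : realType} {n : nat} {M : manifold R n} {Z : avbundle M}.
Implicit Types (z : Z) (F G : Z -> R) (f g : M -> R) (sigma : M -> Z) (m : M)
  (D : @op R n M Z).

Local Notation frame := (@frameZ R n).

Lemma foP D : first_order_operator D <->
  (forall F, ~ CinfZ F -> D F = 0) /\
  forall c tau, atlas c -> ltriv tau ->
    exists (G : 'I_n + unit -> 'rV[R]_n * R -> R) (k : 'rV[R]_n * R -> R),
      [/\ forall i, smooth (zdom c tau) (G i), smooth (zdom c tau) k &
          forall F p, CinfZ F -> zdom c tau p ->
            D F (zpoint c tau p) =
              \sum_i G i p * 'D_(frame i) (F \o zpoint c tau) p + k p * F (zpoint c tau p)].
Proof.
split=> -[D0 DC]; split=> // c tau ac lt; have := DC c tau ac lt.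
  move=> [g [h [k [gs hs ks E]]]].
  exists (fun i => match i with inl a => g a | inr _ => h end), k; split=> //.
    by case.
  by move=> F p FC zp; rewrite E// sum_frameZ.
move=> [G [k [Gs ks E]]]; exists (fun a => G (inl a)), (G (inr tt)), k; split=> //.
by move=> F p FC zp; rewrite E// sum_frameZ.
Qed.

Lemma fo_CinfZ D F : first_order_operator D -> CinfZ (D F).
Proof.
move=> /foP[D0 DC]; have [FC|nF] := pselect (CinfZ F); last by rewrite D0//; exact:
  CinfZ_cst.
move=> c tau ac lt; have [G [k [Gs ks E]]] := DC c tau ac lt.
have oz := open_zdom ac lt.
apply: (@eq_smooth _ _ _ (fun p => \sum_i G i p * 'D_(frame i) (F \o zpoint c tau) p
   + k p * (F \o zpoint c tau) p)) => //.
  by move=> p zp; rewrite /= E.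
apply: smoothD => //; last by apply: smoothM => //; exact: FC.
move=> j; apply: Ck_sum => // i; apply: CkM => //; first exact: Gs.
exact: smooth_derive (FC c tau ac lt) j.
Qed.

Lemma CinfZ_derivable F c (tau : set M * (M -> Z)) p v : atlas c -> ltriv tau ->
  CinfZ F -> zdom c tau p -> derivable (F \o zpoint c tau) p v.
Proof. by move=> ac lt FC zp; exact: smooth_derivable (FC c tau ac lt) zp. Qed.

Lemma fo_linear D (t : R) F G : first_order_operator D -> CinfZ F -> CinfZ G ->
  D (t *: F + G) = t *: D F + D G.
Proof.
move=> /foP[D0 DC] FC GC; apply/funext => z.
have [c [tau [p [ac lt zp <-]]]] := zpointP z.
have [g [k [gs ks E]]] := DC c tau ac lt.
have FGC : CinfZ (t *: F + G) by apply: CinfZD => //; exact: CinfZZ.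
rewrite -[RHS]/(t * D F (zpoint c tau p) + D G (zpoint c tau p)) !E//.
rewrite -[(t *: F + G) _]/(t * F (zpoint c tau p) + G (zpoint c tau p)).
rewrite [LHS](_ : _ = \sum_i (t * (g i p * 'D_(frame i) (F \o zpoint c tau) p) +
   g i p * 'D_(frame i) (G \o zpoint c tau) p) + k p * (t * F (zpoint c tau p) + G
     (zpoint c tau p))).
  by rewrite big_split /= -mulr_sumr; ring.
congr (_ + _); apply: eq_bigr => i _.
have dF := derivableP (CinfZ_derivable (v := frame i) ac lt FC zp).
have dG := derivableP (CinfZ_derivable (v := frame i) ac lt GC zp).
have -> : (t *: F + G) \o zpoint c tau = t \*: (F \o zpoint c tau) + (G \o zpoint c tau)
  by [].
by rewrite derive_val -[_ *: _]/(_ * _); ring.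
Qed.

Lemma fo0 D : first_order_operator D -> D 0 = 0.
Proof.
move=> Df; have := @fo_linear D 1 0 0 Df (CinfZ_cst 0) (CinfZ_cst 0).
by rewrite scaler0 addr0 scale1r => /eqP; rewrite -subr_eq0 opprD addrA subrr sub0r
  oppr_eq0 => /eqP.
Qed.

Lemma foD D F G : first_order_operator D -> CinfZ F -> CinfZ G ->
  D (F + G) = D F + D G.
Proof. by move=> Df FC GC; rewrite -[F in LHS]scale1r fo_linear// scale1r. Qed.

Lemma foZ D t F : first_order_operator D -> CinfZ F -> D (t *: F) = t *: D F.
Proof.
move=> Df FC; rewrite -[in LHS](addr0 (t *: F)) fo_linear//; last exact: CinfZ_cst.
by rewrite fo0// addr0.
Qed.

Lemma foN D F : first_order_operator D -> CinfZ F -> D (- F) = - D F.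
Proof. by move=> Df FC; rewrite -[in LHS]scaleN1r foZ// scaleN1r. Qed.

Lemma foB D F G : first_order_operator D -> CinfZ F -> CinfZ G ->
  D (F - G) = D F - D G.
Proof. by move=> Df FC GC; rewrite (foD Df FC (CinfZN GC)) foN. Qed.

(** Both [F * D G] and [G * D F] contain the zeroth-order contribution [F * G * D 1], which must be
    counted once. *)
Lemma fo_leibniz D F G : first_order_operator D -> CinfZ F -> CinfZ G ->
  D (F * G) = F * D G + G * D F - F * G * D 1.
Proof.
move=> /foP[D0 DC] FC GC; apply/funext => z.
have [c [tau [p [ac lt zp <-]]]] := zpointP z.
have [g [k [gs ks E]]] := DC c tau ac lt; set q := zpoint c tau p.
have C1 : CinfZ (1 : Z -> R) by exact: (CinfZ_cst 1).
rewrite -[RHS]/(F q * D G q + G q * D F q - F q * G q * D 1 q) !E//; last exact: CinfZM.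
rewrite -[(F * G) _]/(F q * G q).
rewrite [X in _ = _ - _ * (X + _)]big1 => [|i _]; last first.
  rewrite (_ : 1 \o zpoint c tau = cst 1); last by [].
  by rewrite derive_cst mulr0.
rewrite -[1 _]/(1 : R).
rewrite [X in X + _ = _](_ : _ = \sum_i (F q * (g i p * 'D_(frame i) (G \o zpoint c tau)
  p) +
   G q * (g i p * 'D_(frame i) (F \o zpoint c tau) p))).
  by rewrite big_split /= -!mulr_sumr; ring.
apply: eq_bigr => i _.
have dF := derivableP (CinfZ_derivable (v := frame i) ac lt FC zp).
have dG := derivableP (CinfZ_derivable (v := frame i) ac lt GC zp).
have -> : (F * G) \o zpoint c tau = (F \o zpoint c tau) * (G \o zpoint c tau) by [].
by rewrite derive_val -![_ *: _]/(_ * _) /=; ring.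
Qed.

Lemma derive_Ffun c (tau : set M * (M -> Z)) f p w : atlas c -> ltriv tau ->
  zdom c tau p -> 'D_w (Ffun f \o zpoint c tau) p = 'D_(w.1) (f \o cinv c) p.1.
Proof.
move=> ac lt zp.
have h : {near p, Ffun f \o zpoint c tau =1 (fun p => (f \o cinv c) p.1)}.
  apply: (@eq_on_near _ _ (zdom c tau)) => //; first exact: open_zdom.
  by move=> y zy; rewrite /= /Ffun zeta_zpoint.
by rewrite (near_eq_derive _ h).
Qed.

Lemma XZ_zpoint c (tau : set M * (M -> Z)) F p : atlas c -> ltriv tau ->
  CinfZ F -> zdom c tau p ->
  XZ Z F (zpoint c tau p) = - 'D_(0, 1) (F \o zpoint c tau) p.
Proof.
move=> ac lt FC zp; rewrite /XZ asboolT// derive1E.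
have dF : derivable (F \o zpoint c tau) p (0, 1) by exact: CinfZ_derivable.
have [d1 d2] := @deriveZv _ _ (F \o zpoint c tau) p (0, 1) (-1) dF.
have d1' : derivable (F \o zpoint c tau) (p + (0 : R) *: (-1 *: (0, 1))) (-1 *: (0, 1)).
  by rewrite scale0r addr0.
have [_] := is_derive_line d1'; rewrite scale0r addr0 d2 mulN1r => <-.
apply: (f_equal (fun h : R -> R => derive h 0 1)).
apply/funext => s /=; rewrite zpoint_zadd; apply: (f_equal (fun q => F (zpoint c tau q))).
case: (p) => a b.
by rewrite scalerA mulrN1 -[RHS]/(a + (- s) *: 0, b + (- s) *: (1 : R)) scaler0 addr0 [(-
  s) *: _]mulr1.
Qed.

Lemma is_derive_fiber F z (t : R) : CinfZ F ->
  is_derive t 1 (fun s => F (zadd z s)) (- XZ Z F (zadd z t)).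
Proof.
move=> FC; have [c [tau [p [ac lt zp <-]]]] := zpointP z.
have L s : zadd (zpoint c tau p) s = zpoint c tau (p + s *: (0, 1)).
  rewrite zpoint_zadd; congr zpoint; case: (p) => a b /=.
  by rewrite /GRing.scale /= /GRing.add /= /add_pair /= scaler0 addr0 [s *: 1]mulr1.
have zs s : zdom c tau (p + s *: (0, 1)).
  by case: (p) zp => a b [/= h1 h2]; split; rewrite /= scaler0 addr0.
have dF s : derivable (F \o zpoint c tau) (p + s *: (0, 1)) (0, 1).
  exact: CinfZ_derivable.
rewrite L XZ_zpoint// opprK (_ : (fun s => _) = (fun s => (F \o zpoint c tau) (p + s *:
  (0, 1)))).
  exact: is_derive_line.
by apply/funext => s; rewrite L.
Qed.

End Operators.

Section OperatorAlgebra.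
Context {R : realType} {n : nat} {M : manifold R n} {Z : avbundle M}.
Implicit Types (z : Z) (F G : Z -> R) (f g : M -> R) (sigma : M -> Z) (m : M)
  (D : @op R n M Z).

Local Notation frame := (@frameZ R n).

(** Operators take global smooth functions as arguments, so the coordinates of a chart must be cut
    off by a bump function before they can serve as test functions. *)
Lemma local_coordinates c m : atlas c -> cdom c m ->
  exists (y : 'I_n -> M -> R) (U : set M),
    [/\ forall a, Cinf (y a), open U, U m, U `<=` cdom c &
        forall m' a, U m' -> y a m' = cmap c m' 0 a].
Proof.
move=> ac cm; have oc := (atlas_open ac).1.
have [phi [pC [U [oU Um Uc U1]] [C [cC CO C0]]]] := exists_bump oc cm.
exists (fun a m => phi m * cmap c m 0 a), U; split=> //.
  move=> a; apply: (smooth_on_ext0 (@openT M) oc cC CO _ (fun _ _ => erefl)).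
    rewrite setTI; apply: smooth_onM => //; last exact: smooth_on_coord.
    exact: smooth_on_subset pC.
  by move=> y nC; rewrite C0// mul0r.
by move=> y a Uy; rewrite U1// mul1r.
Qed.

Lemma derive_coord (x v : 'rV[R]_n) a : 'D_v (fun x : 'rV[R]_n => x 0 a) x = v 0 a.
Proof.
have h : derivable (@id 'rV[R]_n) x v by exact: derivable_id.
have e := derive_mx h; rewrite derive_id in e; by rewrite [in RHS]e mxE.
Qed.

Lemma derive_local_coordinates c m U (y : 'I_n -> M -> R) v a : atlas c -> open U ->
  U `<=` cdom c -> (forall m' a, U m' -> y a m' = cmap c m' 0 a) -> U m ->
  'D_v (y a \o cinv c) (cmap c m) = v 0 a.
Proof.
move=> ac oU Uc yE Um; rewrite -(derive_coord (cmap c m)).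
apply: near_eq_derive.
have := @eq_on_near _ _ (cimg c `&` cinv c @^-1` U) (y a \o cinv c)
  (fun x : 'rV[R]_n => x 0 a) (cmap c m); apply.
- exact: open_cimgI.
- by move=> x [cx Ux] /=; rewrite yE//; have [_ ->] := atlas_inv ac cx.
- by have [? E] := atlas_map ac (Uc _ Um); split; rewrite //= E.
Qed.

(** The constant 1 isolates [k], the cut-off coordinates isolate the base coefficients, and
    [Fsec sigma], whose derivative along the fibre is -1, isolates the last one. *)
Lemma coefficients_eq0 sigma c (tau : set M * (M -> Z)) p (G : 'I_n + unit -> R) (k : R) :
  SecZ sigma -> atlas c -> ltriv tau -> zdom c tau p ->
  (forall F, ((exists2 f, Cinf f & F = Ffun f) \/ F = Fsec sigma) ->
     \sum_i G i * 'D_(frame i) (F \o zpoint c tau) p + k * F (zpoint c tau p) = 0) ->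
  (forall i, G i = 0) /\ k = 0.
Proof.
move=> ss ac lt zp H; have [cp tp] := zp.
have [cic icc] := atlas_inv ac cp.
have k0 : k = 0.
  have := H (cst 1) (or_introl (ex_intro2 _ _ (cst 1) (smooth_on_cst _ 1) erefl)).
  rewrite big1 ?add0r ?mulr1// => i _.
  by rewrite (_ : cst 1 \o _ = cst 1)// derive_cst mulr0.
have [y [U [yC oU Um Uc yE]]] := local_coordinates ac cic.
have Ga a : G (inl a) = 0.
  have := H (Ffun (y a)) (or_introl (ex_intro2 _ _ (y a) (yC a) erefl)).
  rewrite k0 mul0r addr0 sum_frameZ !derive_Ffun//= derive0 mulr0 addr0.
  rewrite (bigD1 a)//= big1 ?addr0 => [|b ba].
    rewrite derive_Ffun//= -icc (derive_local_coordinates _ _ ac oU Uc yE)//.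
    by rewrite mxE !eqxx mulr1.
  rewrite derive_Ffun//= -icc (derive_local_coordinates _ _ ac oU Uc yE)//.
  by rewrite mxE eqxx eq_sym (negbTE ba) mulr0.
split=> //; case=> [//|[]].
have := H (Fsec sigma) (or_intror erefl).
rewrite k0 mul0r addr0 sum_frameZ big1 ?add0r => [|a _]; last by rewrite Ga mul0r.
have := XZ_zpoint ac lt (CinfZ_Fsec ss) zp.
rewrite /XZ asboolT; last exact: CinfZ_Fsec.
rewrite (_ : (fun t => _) = shift (Fsec sigma (zpoint c tau p))); last first.
  by apply/funext => t; rewrite Fsec_zadd// opprK addrC.
rewrite derive1E; have [_ ->] := is_derive_shift (0 : R) 1 (Fsec sigma (zpoint c tau p))
  => e.
by rewrite -[X in _ * X]opprK -e mulrN1 => /eqP; rewrite oppr_eq0 => /eqP.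
Qed.

Lemma fo_determined D sigma z F : first_order_operator D -> SecZ sigma ->
  (forall f, Cinf f -> D (Ffun f) z = 0) -> D (Fsec sigma) z = 0 -> D F z = 0.
Proof.
move=> /foP[D0 DC] ss Df Ds; have [FC|nF] := pselect (CinfZ F); last by rewrite D0.
have [c [tau [p [ac lt zp zE]]]] := zpointP z.
have [g [k [gs ks E]]] := DC c tau ac lt.
have [|G0 k0] := @coefficients_eq0 sigma c tau p (g ^~ p) (k p) ss ac lt zp.
  move=> F'; case=> [[f fC ->]|->]; rewrite -E ?zE//; [exact: Df|exact: CinfZ_Ffun|exact:
    CinfZ_Fsec].
by rewrite -zE E// k0 mul0r addr0 big1// => i _; rewrite G0 mul0r.
Qed.

(** A first-order operator must have smooth coefficients on the whole of [zdom c tau], while the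
    local operators give them only near each point. By [coefficients_eq0] the various local
    coefficients agree wherever two of them represent [D], so they patch together. *)
Lemma fo_glue D : (forall F, ~ CinfZ F -> D F = 0) ->
  (forall m, exists U D', [/\ open U, U m, first_order_operator D' &
     forall F z, CinfZ F -> U (zeta z) -> D F z = D' F z]) ->
  first_order_operator D.
Proof.
move=> D0 DU; apply/foP; split=> // c tau ac lt.
have oz := open_zdom ac lt.
have DP (p : 'rV[R]_n * R) : exists d : set M * ('I_n + unit -> 'rV[R]_n * R -> R) *
  ('rV[R]_n * R -> R),
   [/\ open d.1.1, d.1.1 (cinv c p.1), forall i, smooth (zdom c tau) (d.1.2 i),
      smooth (zdom c tau) d.2 &
      forall F q, CinfZ F -> zdom c tau q -> d.1.1 (cinv c q.1) -> D F (zpoint c tau q) =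
              \sum_i d.1.2 i q * 'D_(frame i) (F \o zpoint c tau) q + d.2 q * F (zpoint c
                tau q)].
  have [U [D' [oU Um /foP[_ D'C] DE]]] := DU (cinv c p.1).
  have [G [k [Gs ks E]]] := D'C c tau ac lt.
  exists (U, G, k); split=> //= F q FC zq Uq.
  by rewrite DE// ?zeta_zpoint// E.
have [d dP] := choice DP.
have [sigma ss] := exists_section Z.
have dE p q : zdom c tau q -> (d p).1.1 (cinv c q.1) ->
    (forall i, (d p).1.2 i q = (d q).1.2 i q) /\ (d p).2 q = (d q).2 q.
  move=> zq pq; have [_ _ _ _ Ep] := dP p; have [_ qq _ _ Eq] := dP q.
  have [|h1 h2] := @coefficients_eq0 sigma c tau q (fun i => (d p).1.2 i q - (d q).1.2 i q)
     ((d p).2 q - (d q).2 q) ss ac lt zq.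
    move=> F HF; have FC : CinfZ F.
      by case: HF => [[f fC ->]|->]; [exact: CinfZ_Ffun|exact: CinfZ_Fsec].
    under eq_bigr do rewrite mulrBl.
    by rewrite sumrB mulrBl addrACA -opprD -Ep// -Eq// subrr.
  split; first by move=> i; apply/eqP; rewrite -subr_eq0 h1.
  by apply/eqP; rewrite -subr_eq0 h2.
have oU p : open (zdom c tau `&` (fun q => cinv c q.1) @^-1` (d p).1.1).
  rewrite (_ : _ `&` _ = zdom c tau `&` fst @^-1` (cimg c `&` cinv c @^-1` (d p).1.1)).
    apply: (@open_preimage _ _ (zdom c tau) fst); first exact: oz.
      by move=> q _; exact: cvg_fst.
    by apply: open_cimgI => //; have [] := dP p.
  by apply/seteqP; split=> q [zq]; [case: (zq) => cq _ dq|case=> cq dq].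
(* At [p] the coefficients are those of the local operator chosen for [p] itself; near [p] they
   coincide with the smooth ones of that fixed operator. *)
exists (fun i p => (d p).1.2 i p), (fun p => (d p).2 p); split.
- move=> i; apply: smooth_local => p zp; exists (zdom c tau `&` (fun q => cinv c q.1)
  @^-1` (d p).1.1).
    by split=> //=; have [] := dP p.
  apply: (@eq_smooth _ _ _ ((d p).1.2 i)) => //; first by move=> q [zq dq]; exact: (dE p
    q zq dq).1.
  by have [_ _ + _ _] := dP p => /(_ i); apply: smooth_subset => q [].
- apply: smooth_local => p zp; exists (zdom c tau `&` (fun q => cinv c q.1) @^-1` (d
  p).1.1).
    by split=> //=; have [] := dP p.
  apply: (@eq_smooth _ _ _ ((d p).2)) => //; first by move=> q [zq dq]; exact: (dE p q zq
    dq).2.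
  by have [_ _ _ + _] := dP p; apply: smooth_subset => q [].
- by move=> F p FC zp; have [_ pp _ _ ->] := dP p.
Qed.

Lemma fo_comb D D' F : first_order_operator D -> first_order_operator D' -> CinfZ F ->
  first_order_operator (fun G => F * D G + D' G : Z -> R).
Proof.
move=> /foP[D0 DC] /foP[D0' DC'] FC; apply/foP; split.
  by move=> G nG; rewrite D0// D0'// mulr0 addr0.
move=> c tau ac lt; have [g [k [gs ks E]]] := DC c tau ac lt.
have [g' [k' [gs' ks' E']]] := DC' c tau ac lt; have oz := open_zdom ac lt.
exists (fun i p => (F \o zpoint c tau) p * g i p + g' i p),
  (fun p => (F \o zpoint c tau) p * k p + k' p); split.
- by move=> i; apply: smoothD => //; apply: smoothM => //; exact: FC.
- by apply: smoothD => //; apply: smoothM => //; exact: FC.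
- move=> G p GC zp; rewrite -[LHS]/(F (zpoint c tau p) * D G (zpoint c tau p) + D' G
  (zpoint c tau p)).
  rewrite E// E'//; under [in RHS]eq_bigr do rewrite mulrDl -mulrA.
  by rewrite big_split /= -mulr_sumr; ring.
Qed.

Lemma fo_zero : first_order_operator (fun _ => 0 : Z -> R).
Proof.
apply/foP; split=> // c tau ac lt; exists (fun _ => cst 0), (cst 0); split=> [i||F p FC zp];
  try exact: smooth_cst.
by rewrite mul0r addr0 big1// => i _; rewrite mul0r.
Qed.

Lemma foM D F : first_order_operator D -> CinfZ F ->
  first_order_operator (fun G => F * D G : Z -> R).
Proof.
move=> Df FC; have := fo_comb Df fo_zero FC.
by congr first_order_operator; apply/funext => G; rewrite addr0.
Qed.

Lemma fo_lin D D' t : first_order_operator D -> first_order_operator D' ->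
  first_order_operator (t *: D + D').
Proof. by move=> Df Df'; exact: fo_comb Df Df' (CinfZ_cst t). Qed.

Definition opid : @op R n M Z := fun F => if `[< CinfZ F >] then F else 0.

Lemma opidE F : CinfZ F -> opid F = F.
Proof. by move=> FC; rewrite /opid asboolT. Qed.

Lemma fo_opid : first_order_operator opid.
Proof.
apply/foP; split; first by move=> F nF; rewrite /opid asboolF.
move=> c tau ac lt; exists (fun _ => cst 0), (cst 1); split=> [i||F p FC zp];
  try exact: smooth_cst.
by rewrite opidE// mul1r big1 ?add0r// => i _; rewrite mul0r.
Qed.

Lemma fo_XZ : first_order_operator (XZ Z).
Proof.
apply/foP; split; first by move=> F nF; rewrite /XZ asboolF.
move=> c tau ac lt; exists (fun i => match i with inl _ => cst 0 | inr _ => cst (-1)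
  end), (cst 0).
split; [by case=> ?; exact: smooth_cst|exact: smooth_cst|].
move=> F p FC zp; rewrite sum_frameZ big1 => [|a _]; last by rewrite mul0r.
by rewrite XZ_zpoint// mul0r addr0 add0r mulN1r.
Qed.

(** The composites in the two orders have the same second-order terms, by symmetry of second
    derivatives. The terms mixing a zeroth-order coefficient with undifferentiated data cancel as
    well, which leaves derivatives of the coefficients. *)
Lemma fo_commutator D D' : first_order_operator D -> first_order_operator D' ->
  first_order_operator (fun F => D (D' F) - D' (D F)).
Proof.
move=> Df Df'; have [[D0 DC] [D0' DC']] := ((foP _).1 Df, (foP _).1 Df').
apply/foP; split; first by move=> F nF; rewrite (D0 F nF) (D0' F nF) (fo0 Df) (fo0 Df')
  subrr.
move=> c tau ac lt; have [g [k [gs ks E]]] := DC c tau ac lt.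
have [g' [k' [gs' ks' E']]] := DC' c tau ac lt; have oz := open_zdom ac lt.
exists (fun i p => \sum_j (g j p * 'D_(frame j) (g' i) p - g' j p * 'D_(frame j) (g i) p)),
  (fun p => \sum_j (g j p * 'D_(frame j) k' p - g' j p * 'D_(frame j) k p)); split.
- move=> i r; apply: Ck_sum => // j.
  have h (u v : 'rV[R]_n * R -> R) : smooth (zdom c tau) u -> smooth (zdom c tau) v ->
      smooth (zdom c tau) (fun p => u p * 'D_(frame j) v p).
    by move=> us vs; apply: smoothM => //; exact: smooth_derive.
  apply: CkD => //; first exact: h.
  by apply: eq_Ck (CkM oz (Ck_cst r _ (-1)) (h _ _ (gs' j) (gs i) r)) => // p _; rewrite
    mulN1r.
- move=> r; apply: Ck_sum => // j.
  have h (u v : 'rV[R]_n * R -> R) : smooth (zdom c tau) u -> smooth (zdom c tau) v ->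
      smooth (zdom c tau) (fun p => u p * 'D_(frame j) v p).
    by move=> us vs; apply: smoothM => //; exact: smooth_derive.
  apply: CkD => //; first exact: h.
  by apply: eq_Ck (CkM oz (Ck_cst r _ (-1)) (h _ _ (gs' j) ks r)) => // p _; rewrite mulN1r.
move=> F p FC zp; pose Fl := F \o zpoint c tau.
have Fs : smooth (zdom c tau) Fl by exact: FC.
have DD (B B' : @op R n M Z) (h h' : 'I_n + unit -> 'rV[R]_n * R -> R) (l l' : 'rV[R]_n *
  R -> R) :
   first_order_operator B' ->
   (forall i, smooth (zdom c tau) (h' i)) -> smooth (zdom c tau) l' ->
   (forall F p, CinfZ F -> zdom c tau p -> B F (zpoint c tau p) =
      \sum_i h i p * 'D_(frame i) (F \o zpoint c tau) p + l p * F (zpoint c tau p)) ->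
   (forall F p, CinfZ F -> zdom c tau p -> B' F (zpoint c tau p) =
      \sum_i h' i p * 'D_(frame i) (F \o zpoint c tau) p + l' p * F (zpoint c tau p)) ->
   B (B' F) (zpoint c tau p) =
     \sum_i (\sum_j h j p * 'D_(frame j) (h' i) p) * 'D_(frame i) Fl p +
     \sum_i \sum_j h j p * h' i p * 'D_(frame j) (fun q => 'D_(frame i) Fl q) p +
     ((\sum_j h j p * 'D_(frame j) l' p) * Fl p + l' p * (\sum_j h j p * 'D_(frame j) Fl
       p)) +
     l p * (\sum_i h' i p * 'D_(frame i) Fl p + l' p * Fl p).
  move=> Bf' hs' ls' BE BE'; rewrite BE//; last exact: fo_CinfZ.
  rewrite BE'//; congr (_ + _).
  have dj j : 'D_(frame j) (B' F \o zpoint c tau) p =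
     \sum_i (h' i p * 'D_(frame j) (fun q => 'D_(frame i) Fl q) p + 'D_(frame i) Fl p *
       'D_(frame j) (h' i) p)
     + (l' p * 'D_(frame j) Fl p + Fl p * 'D_(frame j) l' p).
    have near : {near p, B' F \o zpoint c tau =1
       (fun q => \sum_i h' i q * 'D_(frame i) Fl q) + l' * Fl}.
      by apply: (@eq_on_near _ _ (zdom c tau)) => // q zq; rewrite /= BE'.
    rewrite (near_eq_derive _ near).
    have dF := derivableP (smooth_derivable (v := frame j) Fs zp).
    have dl := derivableP (smooth_derivable (v := frame j) ls' zp).
    have ds : is_derive p (frame j) (fun q => \sum_i h' i q * 'D_(frame i) Fl q)
       (\sum_i (h' i p * 'D_(frame j) (fun q => 'D_(frame i) Fl q) p + 'D_(frame i) Fl p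
         * 'D_(frame j) (h' i) p)).
      apply: is_derive_bigsum => i.
      have d1 := derivableP (smooth_derivable (v := frame j) (hs' i) zp).
      have d2 := derivableP (smooth_derivable (v := frame j)
         (@smooth_derive _ _ _ _ (frame i) Fs) zp).
      exact: (is_deriveM d1 d2).
    by have [_ ->] := is_deriveD ds (is_deriveM dl dF).
  under eq_bigr do rewrite dj mulrDr big_distrr /= mulrDr.
  rewrite big_split /= exchange_big /=; congr (_ + _).
    rewrite -big_split /=; apply: eq_bigr => i _.
    rewrite mulr_suml -big_split /=; apply: eq_bigr => j _; ring.
  rewrite big_split /= addrC mulr_suml mulr_sumr; congr (_ + _);
    by apply: eq_bigr => j _; ring.
rewrite -[LHS]/(D (D' F) (zpoint c tau p) - D' (D F) (zpoint c tau p)).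
rewrite (DD D D' g g' k k')// (DD D' D g' g k' k)//.
have sym : \sum_i \sum_j g j p * g' i p * 'D_(frame j) (fun q => 'D_(frame i) Fl q) p =
   \sum_i \sum_j g' j p * g i p * 'D_(frame j) (fun q => 'D_(frame i) Fl q) p.
  rewrite exchange_big /=; apply: eq_bigr => i _; apply: eq_bigr => j _.
  by rewrite (@derive_symmetric _ _ _ _ _ (frame i) (frame j) oz (Fs 2%N) zp) [g i p *
    _]mulrC.
rewrite sym; under [in RHS]eq_bigr do rewrite sumrB mulrBl.
rewrite !sumrB.
have rg (A A' S B B' P P' K K' f : R) : A + S + (B * f + K' * P) + K * (P' + K' * f) -
    (A' + S + (B' * f + K * P') + K' * (P + K * f)) = A - A' + (B - B') * f by ring.
exact: rg.
Qed.

End OperatorAlgebra.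

(** * Operators preserving fibrewise polynomials *)

Section PolynomialOperators.
Context {R : realType} {n : nat} {M : manifold R n} {Z : avbundle M}.
Implicit Types (z : Z) (F G : Z -> R) (f g : M -> R) (sigma : M -> Z) (m : M)
  (D : @op R n M Z).

Local Notation X := (XZ Z).

Lemma XZE F z : CinfZ F -> X F z = derive1 (fun t : R => F (zadd z (- t))) 0.
Proof. by move=> FC; rewrite /XZ asboolT. Qed.

Lemma XZ_eq_fiber F G m : CinfZ F -> CinfZ G ->
  (forall z, zeta z = m -> F z = G z) -> forall z, zeta z = m -> X F z = X G z.
Proof.
move=> FC GC FG z zm; rewrite /XZ !asboolT//; congr (derive1 _ 0).
by apply/funext => t; apply: FG; rewrite zeta_add.
Qed.

Lemma XZ_Ffun f : Cinf f -> X (Ffun f) = 0.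
Proof.
move=> fC; apply/funext => z; rewrite /XZ asboolT; last exact: CinfZ_Ffun.
rewrite (_ : (fun t => _) = cst (f (zeta z))); first by rewrite derive1_cst.
by apply/funext => t; rewrite /Ffun zeta_add.
Qed.

Lemma Cinf_cst (a : R) : Cinf (cst a : M -> R). Proof. exact: smooth_on_cst. Qed.

Lemma CinfD f g : Cinf f -> Cinf g -> Cinf (f + g).
Proof. by move=> fC gC; exact: smooth_onD openT fC gC. Qed.

Lemma CinfM f g : Cinf f -> Cinf g -> Cinf (f * g).
Proof. by move=> fC gC; exact: smooth_onM openT fC gC. Qed.

Lemma CinfN f : Cinf f -> Cinf (- f).
Proof. by move=> fC; exact: smooth_onN openT fC. Qed.

Lemma CinfB f g : Cinf f -> Cinf g -> Cinf (f - g).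
Proof. by move=> fC gC; apply: CinfD => //; exact: CinfN. Qed.

Lemma XZ1 : X 1 = 0. Proof. exact: (XZ_Ffun (Cinf_cst 1)). Qed.

Lemma CinfZ_XZ F : CinfZ (X F). Proof. exact: fo_CinfZ fo_XZ. Qed.

Lemma CinfZ1 : CinfZ (1 : Z -> R). Proof. exact: (CinfZ_cst 1). Qed.

Lemma XZ_leibniz F G : CinfZ F -> CinfZ G -> X (F * G) = F * X G + G * X F.
Proof. by move=> FC GC; rewrite (fo_leibniz fo_XZ)// XZ1 mulr0 subr0. Qed.

Lemma XZ_FfunM f G : Cinf f -> CinfZ G -> X (Ffun f * G) = Ffun f * X G.
Proof.
by move=> fC GC; rewrite XZ_leibniz ?XZ_Ffun ?mulr0 ?addr0//; exact: CinfZ_Ffun.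
Qed.

Lemma XZ_Fsec sigma : SecZ sigma -> X (Fsec sigma) = 1.
Proof.
move=> ss; apply/funext => z; rewrite /XZ asboolT; last exact: CinfZ_Fsec.
rewrite (_ : (fun t => _) = shift (Fsec sigma z)); last first.
  by apply/funext => t; rewrite Fsec_zadd// opprK addrC.
by rewrite derive1E; have [_ ->] := is_derive_shift (0 : R) 1 (Fsec sigma z).
Qed.

Lemma PolS k F : Pol k.+1 F <-> CinfZ F /\ Pol k (X F).
Proof.
rewrite /Pol /= -!iterS iterSr; split=> -[FC e]; split=> //.
  by split=> //; exact: CinfZ_XZ.
by case: e.
Qed.

Lemma Pol0P F : Pol 0 F <-> CinfZ F /\ X F = 0. Proof. by []. Qed.

Lemma Pol_CinfZ k F : Pol k F -> CinfZ F. Proof. by case. Qed.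

Lemma Pol_lin k t F G : Pol k F -> Pol k G -> Pol k (t *: F + G).
Proof.
elim: k F G => [|k IH] F G.
  move=> /Pol0P[FC XF] /Pol0P[GC XG]; apply/Pol0P; split.
    by apply: CinfZD => //; exact: CinfZZ.
  by rewrite (fo_linear _ fo_XZ)// XF XG scaler0 addr0.
move=> /PolS[FC XF] /PolS[GC XG]; apply/PolS; split.
  by apply: CinfZD => //; exact: CinfZZ.
by rewrite (fo_linear _ fo_XZ)//; exact: IH.
Qed.

Lemma PolD k F G : Pol k F -> Pol k G -> Pol k (F + G).
Proof. by move=> FP GP; rewrite -[F]scale1r; exact: Pol_lin. Qed.

Lemma PolB k F G : Pol k F -> Pol k G -> Pol k (F - G).
Proof. by move=> FP GP; rewrite addrC -scaleN1r; exact: Pol_lin. Qed.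

Lemma Pol_FfunM k f G : Cinf f -> Pol k G -> Pol k (Ffun f * G).
Proof.
move=> fC; elim: k G => [|k IH] G.
  move=> /Pol0P[GC XG]; apply/Pol0P; split.
    by apply: CinfZM => //; exact: CinfZ_Ffun.
  by rewrite XZ_FfunM// XG mulr0.
move=> /PolS[GC XG]; apply/PolS; split.
  by apply: CinfZM => //; exact: CinfZ_Ffun.
by rewrite XZ_FfunM//; exact: IH.
Qed.

Lemma XZ_FsecM sigma G : SecZ sigma -> CinfZ G ->
  X (Fsec sigma * G) = Fsec sigma * X G + G.
Proof.
move=> ss GC; rewrite XZ_leibniz// ?XZ_Fsec ?mulr1//; exact: CinfZ_Fsec.
Qed.

Lemma Pol_FsecM sigma k G : SecZ sigma -> Pol k G -> Pol k.+1 (Fsec sigma * G).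
Proof.
move=> ss; elim: k G => [|k IH] G GP; apply/PolS; have GC := Pol_CinfZ GP;
  rewrite (XZ_FsecM ss GC); (split; first exact: CinfZM (CinfZ_Fsec ss) GC).
  by have [_ ->] := (Pol0P _).1 GP; rewrite mulr0 add0r.
exact: PolD (IH _ ((PolS _ _).1 GP).2) GP.
Qed.

Lemma Pol_Ffun f : Cinf f -> Pol 0 (Ffun f : Z -> R).
Proof. by move=> fC; apply/Pol0P; split; [exact: CinfZ_Ffun|exact: XZ_Ffun]. Qed.

Lemma Pol_Fsec sigma : SecZ sigma -> Pol 1 (Fsec sigma).
Proof.
move=> ss; rewrite -[Fsec sigma]mulr1; apply: Pol_FsecM => //.
exact: (Pol_Ffun (Cinf_cst 1)).
Qed.

(** The derivative along the fibre vanishes identically, so [F] has at [z] the value it has where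
    [sigma] meets the fibre of [z]. *)
Lemma Pol0_Ffun sigma F : SecZ sigma -> Pol 0 F -> F = Ffun (F \o sigma).
Proof.
move=> ss /Pol0P[FC XF]; apply/funext => z; rewrite /Ffun /=.
have dz t : is_derive t (1 : R) (fun s => F (zadd (sigma (zeta z)) s)) 0.
  by have := is_derive_fiber (sigma (zeta z)) t FC; rewrite XF oppr0.
have := is_derive_0_is_cst (zsub z (sigma (zeta z))) 0 dz.
by rewrite zadd0 zsubK//; case: ss.
Qed.

Section Coefficients.
Variables (sigma : M -> Z) (ss : SecZ sigma).

(* If D is f_a d/dx^a - (alpha s + beta) d/ds + gamma in the trivialisation given by
   sigma, these are gamma, beta and alpha, and f |-> f_a df/dx^a. *)
Definition opgamma D m : R := D 1 (sigma m).
Definition opbeta D m : R := D (Fsec sigma) (sigma m).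
Definition opalpha D m : R := opgamma D m - X (D (Fsec sigma)) (sigma m).
Definition opsymbol D f m : R := D (Ffun f) (sigma m) - opgamma D m * f m.

Variables (D : @op R n M Z) (DO : OpZ D).

Let Df : first_order_operator D. Proof. by case: DO. Qed.

Lemma Cinf_opgamma : Cinf (opgamma D).
Proof. exact: Cinf_comp_sec (fo_CinfZ _ Df) ss. Qed.

Lemma Cinf_opbeta : Cinf (opbeta D).
Proof. exact: Cinf_comp_sec (fo_CinfZ _ Df) ss. Qed.

Lemma Cinf_opalpha : Cinf (opalpha D).
Proof.
apply: CinfB; first exact: Cinf_opgamma.
exact: (Cinf_comp_sec (CinfZ_XZ (D (Fsec sigma))) ss).
Qed.

Lemma Cinf_opsymbol f : Cinf f -> Cinf (opsymbol D f).
Proof.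
move=> fC; apply: CinfB; last by apply: CinfM => //; exact: Cinf_opgamma.
exact: Cinf_comp_sec (fo_CinfZ _ Df) ss.
Qed.

Lemma op1 : D 1 = Ffun (opgamma D).
Proof.
apply: Pol0_Ffun => //; apply: DO.2; exact: (Pol_Ffun (Cinf_cst 1)).
Qed.

Lemma op_Ffun f : Cinf f -> D (Ffun f) = Ffun (opsymbol D f) + Ffun (opgamma D) * Ffun f.
Proof.
move=> fC; rewrite [LHS](Pol0_Ffun ss); last by apply: DO.2; exact: Pol_Ffun.
apply/funext => z; rewrite /Ffun /= -[RHS]/(opsymbol D f (zeta z) + opgamma D (zeta z) *
  f (zeta z)).
by rewrite /opsymbol subrK.
Qed.

Lemma op_XZ F : CinfZ F -> D (X F) - X (D F) = Ffun (opalpha D) * X F.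
Proof.
move=> FC; apply/eqP; rewrite -subr_eq0; apply/eqP/funext => z.
have a0C : Cinf (- opalpha D) by apply: CinfN; exact: Cinf_opalpha.
have oF := fo_comb fo_XZ (fo_commutator Df fo_XZ) (CinfZ_Ffun a0C).
have E G : (Ffun (- opalpha D) * X G + (D (X G) - X (D G))) z =
    (D (X G) - X (D G) - Ffun (opalpha D) * X G) z.
  rewrite -[LHS]/(- opalpha D (zeta z) * X G z + (D (X G) z - X (D G) z)).
  by rewrite -[RHS]/(D (X G) z - X (D G) z - opalpha D (zeta z) * X G z) addrC mulNr.
rewrite -E; apply: (fo_determined _ oF ss) => [f fC|].
  rewrite E XZ_Ffun// fo0// op_Ffun// sub0r mulr0 subr0.
  rewrite (_ : _ + _ = Ffun (opsymbol D f + opgamma D * f))// XZ_Ffun ?oppr0//.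
  apply: CinfD; first exact: Cinf_opsymbol.
  by apply: CinfM => //; exact: Cinf_opgamma.
rewrite E XZ_Fsec// op1 mulr1.
(* As [D] preserves [Pol 1], this function is constant along the fibres; hence [opalpha], which is
   read off on [sigma], gives the commutator at every point of the fibre. *)
have P1 : Pol 0 (X (D (Fsec sigma))).
  by apply: ((PolS _ _).1 (DO.2 _ _ (Pol_Fsec ss))).2.
rewrite (Pol0_Ffun ss P1) -[LHS]/(opgamma D (zeta z) - _ - opalpha D (zeta z)) /opalpha.
by rewrite /Ffun /=; ring.
Qed.

Lemma XZ_op_Fsec : X (D (Fsec sigma)) = Ffun (opgamma D - opalpha D).
Proof.
have := op_XZ (CinfZ_Fsec ss); rewrite XZ_Fsec// op1 mulr1 => /eqP.
rewrite subr_eq => /eqP e; apply/funext => z.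
have e' : opgamma D (zeta z) = opalpha D (zeta z) + X (D (Fsec sigma)) z.
  exact: (congr1 (fun h => h z) e).
by rewrite -[RHS]/(opgamma D (zeta z) - opalpha D (zeta z)) e' addrAC subrr add0r.
Qed.

(** In coordinates [Fsec sigma] is - s, and the value is beta + (alpha - gamma) s. Subtracting the
    second term leaves a function of the base, which is read off on [sigma], where [Fsec sigma]
    vanishes. *)
Lemma op_Fsec : D (Fsec sigma) = Ffun (opbeta D) + Ffun (opgamma D - opalpha D) * Fsec
  sigma.
Proof.
have hC : Cinf (opgamma D - opalpha D) by apply: CinfB; [exact: Cinf_opgamma|exact:
  Cinf_opalpha].
have P : Pol 0 (D (Fsec sigma) - Ffun (opgamma D - opalpha D) * Fsec sigma).
  have C1 := fo_CinfZ (Fsec sigma) Df; have C2 := CinfZM (CinfZ_Ffun hC) (CinfZ_Fsec ss).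
  apply/Pol0P; split; first exact: CinfZB.
  by rewrite (foB fo_XZ)// XZ_FfunM ?XZ_Fsec ?mulr1 ?XZ_op_Fsec ?subrr//; exact: CinfZ_Fsec.
apply/eqP; rewrite -subr_eq (Pol0_Ffun ss P); apply/eqP/funext => z.
rewrite /Ffun /= -[LHS]/(D (Fsec sigma) (sigma (zeta z)) - _ * Fsec sigma (sigma (zeta z))).
by rewrite Fsec_at// mulr0 subr0.
Qed.

(** The [get] is resolved by exhibiting one admissible value and evaluating at [sigma m], a point of
    the fibre, where the value is forced. The same works for [phi0], tested on [Fsec sigma], whose
    image under [X] is 1, and for [anchor]. *)
Lemma phi1_field m : phi1 m (field_of D m) = opgamma D m.
Proof.
rewrite /phi1; set P := (X in get X).
have Pe : exists c, P c.
  exists (opgamma D m) => z zm; rewrite /field_of asboolT// -[cst 1]/(1 : Z -> R) op1.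
  by rewrite /Ffun zm.
have sm := ss.1 m.
by rewrite -(getPex Pe (sigma m) sm) /field_of asboolT.
Qed.

Lemma phi0_field m : phi0 m (field_of D m) = opalpha D m.
Proof.
rewrite /phi0; set P := (X in get X).
have E F z : CinfZ F -> zeta z = m -> field_of D m (X F) z -
    derive1 (fun t : R => field_of D m F (zadd z (- t))) 0 = opalpha D m * X F z.
  move=> FC zm; rewrite {1}/field_of asboolT//.
  rewrite (_ : (fun t : R => _) = (fun t : R => D F (zadd z (- t)))); last first.
    by apply/funext => t; rewrite /field_of asboolT// zeta_add.
  have e : D (X F) z - X (D F) z = opalpha D (zeta z) * X F z.
    exact: (congr1 (fun h => h z) (op_XZ FC)).
  rewrite -zm -e.
  by rewrite (XZE _ (fo_CinfZ F Df)).
have Pe : exists c, P c by exists (opalpha D m) => F z; exact: E.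
have sm := ss.1 m; have := getPex Pe (Fsec sigma) (sigma m) (CinfZ_Fsec ss) sm.
rewrite E//; last exact: CinfZ_Fsec.
by rewrite XZ_Fsec// !mulr1 => ->.
Qed.

Lemma anchor_field m f : Cinf f -> anchor Z m (field_of D m) f = opsymbol D f m.
Proof.
move=> fC; rewrite /anchor; set P := (X in get X).
have E z : zeta z = m ->
    field_of D m (Ffun f) z - field_of D m (cst 1) z * f m = opsymbol D f m.
  move=> zm; rewrite /field_of !asboolT// -[cst 1]/(1 : Z -> R) op1 op_Ffun//.
  rewrite -[(_ + _) z]/(opsymbol D f (zeta z) + opgamma D (zeta z) * f (zeta z)) /Ffun zm.
  by rewrite addrK.
have Pe : exists c, P c by exists (opsymbol D f m) => z; exact: E.
have sm := ss.1 m; by rewrite -(getPex Pe (sigma m) sm) E.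
Qed.

Lemma op_FfunM f G : Cinf f -> CinfZ G ->
  D (Ffun f * G) = Ffun f * D G + Ffun (opsymbol D f) * G.
Proof.
move=> fC GC; rewrite (fo_leibniz Df (CinfZ_Ffun fC) GC) op_Ffun// op1.
have rg (a b c d e : R) : a * b + c * (d + e * a) - a * c * e = a * b + d * c by ring.
by apply/funext => z; exact: rg.
Qed.

Lemma opsymbol_lin t f g m : Cinf f -> Cinf g ->
  opsymbol D (t *: f + g) m = t * opsymbol D f m + opsymbol D g m.
Proof.
move=> fC gC; rewrite /opsymbol (_ : Ffun (t *: f + g) = t *: Ffun f + Ffun g :> (Z ->
  R))//.
rewrite (fo_linear _ Df (CinfZ_Ffun fC) (CinfZ_Ffun gC)).
rewrite -[(_ + _) (sigma m)]/(t * D (Ffun f) (sigma m) + D (Ffun g) (sigma m)).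
by rewrite -[(_ + _) m]/(t * f m + g m); ring.
Qed.

Lemma opsymbolB f g m : Cinf f -> Cinf g ->
  opsymbol D (f - g) m = opsymbol D f m - opsymbol D g m.
Proof. by move=> fC gC; rewrite addrC -scaleN1r opsymbol_lin// mulN1r addrC. Qed.

Lemma opsymbolM f g m : Cinf f -> Cinf g ->
  opsymbol D (f * g) m = opsymbol D f m * g m + f m * opsymbol D g m.
Proof.
move=> fC gC; rewrite {1}/opsymbol (_ : Ffun (f * g) = Ffun f * Ffun g :> (Z -> R))//.
rewrite (op_FfunM fC (CinfZ_Ffun gC)).
rewrite -[(_ + _) (sigma m)]/(f (zeta (sigma m)) * D (Ffun g) (sigma m) +
   opsymbol D f (zeta (sigma m)) * g (zeta (sigma m))) ss.1.
rewrite -[(f * g) m]/(f m * g m) -[opsymbol D g m]/(D (Ffun g) (sigma m) - opgamma D m *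
  g m); ring.
Qed.

Lemma opsymbol_cst a m : opsymbol D (cst a) m = 0.
Proof.
rewrite /opsymbol (_ : Ffun (cst a) = a *: (1 : Z -> R)); last first.
  by apply/funext => z; rewrite -[RHS]/(a * 1) mulr1.
rewrite (foZ _ Df CinfZ1) -[(a *: _) _]/(a * D 1 (sigma m)) -[cst a m]/a /opgamma; ring.
Qed.

End Coefficients.

Section Closure.

(** Converse to [op_XZ]: since [X (D F)] is [D (X F)] up to a base function times [X F], induction
    on the degree shows that [D] preserves every [Pol k]. All the concrete operators are shown to
    lie in [OpZ] by this criterion. *)
Lemma OpZ_of_commutator_XZ D (alpha : M -> R) : first_order_operator D -> Cinf alpha ->
  (forall F, CinfZ F -> D (X F) - X (D F) = Ffun alpha * X F) -> OpZ D.
Proof.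
move=> Df aC DX; have DXF F : CinfZ F -> X (D F) = D (X F) - Ffun alpha * X F.
  by move=> /DX <-; rewrite opprB addrC subrK.
split=> // k; elim: k => [|k IH] F.
  move=> /Pol0P[FC XF]; apply/Pol0P; split; first exact: fo_CinfZ.
  by rewrite DXF// XF mulr0 subr0 fo0.
move=> /PolS[FC XF]; apply/PolS; split; first exact: fo_CinfZ.
rewrite (DXF _ FC); exact: PolB (IH _ XF) (Pol_FfunM aC XF).
Qed.

Lemma OpZ_XZ : OpZ X.
Proof.
apply: (OpZ_of_commutator_XZ fo_XZ (Cinf_cst 0)) => F FC.
by rewrite subrr; apply/funext => z; rewrite -[RHS]/(0 * X F z) mul0r.
Qed.

Lemma OpZ_opid : OpZ (@opid R n M Z).
Proof.
apply: (OpZ_of_commutator_XZ fo_opid (Cinf_cst 0)) => F FC.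
rewrite !opidE ?subrr//; last exact: CinfZ_XZ.
by apply/funext => z; rewrite -[RHS]/(0 * X F z) mul0r.
Qed.

(* In the trivialisation given by sigma, F_sigma is - s and X is - d/ds, so that
   this is s d/ds. *)
Definition euler sigma : @op R n M Z := fun F => Fsec sigma * X F.

Lemma OpZ_euler sigma : SecZ sigma -> OpZ (euler sigma).
Proof.
move=> ss; apply: (OpZ_of_commutator_XZ (foM fo_XZ (CinfZ_Fsec ss)) (Cinf_cst (-1))) => F
  FC.
rewrite /euler (XZ_FsecM ss (CinfZ_XZ F)) opprD addrA subrr sub0r.
by apply/funext => z; rewrite -[RHS]/(- 1 * X F z) mulN1r.
Qed.

Lemma OpZ_comb D D' f : OpZ D -> OpZ D' -> Cinf f ->
  OpZ (fun G => Ffun f * D G + D' G : Z -> R).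
Proof.
move=> [Df DP] [Df' DP'] fC; split; first exact: fo_comb Df Df' (CinfZ_Ffun fC).
by move=> k F FP; exact: PolD (Pol_FfunM fC (DP _ _ FP)) (DP' _ _ FP).
Qed.

Lemma OpZ_lin D D' t : OpZ D -> OpZ D' -> OpZ (t *: D + D').
Proof. by move=> DO DO'; exact: OpZ_comb DO DO' (Cinf_cst t). Qed.

Lemma OpZ_commutator D D' : OpZ D -> OpZ D' -> OpZ (fun F => D (D' F) - D' (D F)).
Proof.
move=> [Df DP] [Df' DP']; split; first exact: fo_commutator.
by move=> k F FP; exact: PolB (DP _ _ (DP' _ _ FP)) (DP' _ _ (DP _ _ FP)).
Qed.

(** [X] differentiates along the fibres, so for a smooth function membership in [Pol k] only depends
    on the restrictions to the single fibres. *)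
Lemma Pol_local k F : CinfZ F ->
  (forall m, exists2 G, Pol k G & forall z, zeta z = m -> F z = G z) -> Pol k F.
Proof.
elim: k F => [|k IH] F FC FG.
  apply/Pol0P; split=> //; apply/funext => z; have [G /Pol0P[GC XG] GE] := FG (zeta z).
  by rewrite (XZ_eq_fiber FC GC GE)// XG.
apply/PolS; split=> //; apply: IH; first exact: CinfZ_XZ.
move=> m; have [G /PolS[GC XG] GE] := FG m; exists (X G) => //.
exact: XZ_eq_fiber.
Qed.

Lemma OpZ_glue D : (forall F, ~ CinfZ F -> D F = 0) ->
  (forall m, exists U D', [/\ open U, U m, OpZ D' &
     forall F z, CinfZ F -> U (zeta z) -> D F z = D' F z]) -> OpZ D.
Proof.
move=> D0 DU; have Df : first_order_operator D.
  apply: fo_glue => // m; have [U [D' [oU Um [Df' _] DE]]] := DU m.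
  by exists U, D'.
split=> // k F FP; apply: Pol_local; first exact: fo_CinfZ.
move=> m; have [U [D' [oU Um [_ DP'] DE]]] := DU m.
exists (D' F); first exact: DP'.
by move=> z zm; apply: DE; [exact: Pol_CinfZ FP|rewrite zm].
Qed.

End Closure.

Section FieldOf.

Lemma op_ofK D : op_of (field_of D) = D.
Proof. by apply/funext => F; apply/funext => z; rewrite /op_of /field_of asboolT. Qed.

Lemma op_commutator_field D D' :
  op_commutator Z (field_of D) (field_of D') = field_of (fun F => D (D' F) - D' (D F)).
Proof. by rewrite /op_commutator !op_ofK. Qed.

Lemma field_of_comb f D D' m :
  field_of (fun G => Ffun f * D G + D' G : Z -> R) m = f m *: field_of D m + field_of D' m.
Proof.
apply/funext => F; apply/funext => z.
rewrite -[RHS]/(f m * field_of D m F z + field_of D' m F z) /field_of.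
case: asboolP => [zm|_]; last by rewrite mulr0 addr0.
by rewrite -[LHS]/(f (zeta z) * D F z + D' F z) zm.
Qed.

Lemma field_of_lin t D D' :
  field_of (t *: D + D') = t *: field_of D + field_of D'.
Proof. by apply/funext => m; exact: (field_of_comb (cst t)). Qed.

Lemma field_of_eq sigma D D' m : SecZ sigma -> OpZ D -> OpZ D' ->
  (forall f, Cinf f -> opsymbol sigma D f m = opsymbol sigma D' f m) ->
  opgamma sigma D m = opgamma sigma D' m -> opalpha sigma D m = opalpha sigma D' m ->
  opbeta sigma D m = opbeta sigma D' m -> field_of D m = field_of D' m.
Proof.
move=> ss DO DO' eT e1 e0 eX; apply/funext => F; apply/funext => z.
rewrite /field_of; case: asboolP => // zm.
have [Df _] := DO; have [Df' _] := DO'.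
have sub_eq (a b : R) : -1 * a + b = 0 -> a = b.
  by rewrite mulN1r addrC => /eqP; rewrite subr_eq0 => /eqP.
apply: sub_eq; have dD := fo_lin (-1) Df Df'.
rewrite -[LHS]/((-1 *: D + D') F z).
apply: (fo_determined _ dD ss) => [f fC|].
  rewrite -[LHS]/(-1 * D (Ffun f) z + D' (Ffun f) z).
  rewrite (op_Ffun ss DO)// (op_Ffun ss DO')//.
  rewrite -[X in _ * X + _]/(opsymbol sigma D f (zeta z) + opgamma sigma D (zeta z) * f
    (zeta z)).
  rewrite -[X in _ + X]/(opsymbol sigma D' f (zeta z) + opgamma sigma D' (zeta z) * f
    (zeta z)).
  by rewrite zm eT// e1; ring.
rewrite -[LHS]/(-1 * D (Fsec sigma) z + D' (Fsec sigma) z).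
rewrite (op_Fsec ss DO) (op_Fsec ss DO').
rewrite -[X in _ * X + _]/(opbeta sigma D (zeta z) + (opgamma sigma D (zeta z) - opalpha
  sigma D (zeta z)) * Fsec sigma z).
rewrite -[X in _ + X]/(opbeta sigma D' (zeta z) + (opgamma sigma D' (zeta z) - opalpha
  sigma D' (zeta z)) * Fsec sigma z).
by rewrite zm eX e1 e0; ring.
Qed.

End FieldOf.

Section CoefficientValues.
Variables (sigma : M -> Z) (ss : SecZ sigma).

Lemma opgamma_comb f D D' m : opgamma sigma (fun G => Ffun f * D G + D' G : Z -> R) m =
  f m * opgamma sigma D m + opgamma sigma D' m.
Proof. by rewrite -[LHS]/(f (zeta (sigma m)) * _ + _) ss.1. Qed.

Lemma opbeta_comb f D D' m : opbeta sigma (fun G => Ffun f * D G + D' G : Z -> R) m =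
  f m * opbeta sigma D m + opbeta sigma D' m.
Proof. by rewrite -[LHS]/(f (zeta (sigma m)) * _ + _) ss.1. Qed.

Lemma opsymbol_comb f D D' g m : opsymbol sigma (fun G => Ffun f * D G + D' G : Z -> R) g
  m =
  f m * opsymbol sigma D g m + opsymbol sigma D' g m.
Proof.
rewrite /opsymbol opgamma_comb -[X in X - _]/(f (zeta (sigma m)) * D (Ffun g) (sigma m) +
  D' (Ffun g) (sigma m)).
by rewrite ss.1; ring.
Qed.

Lemma opalpha_comb f D D' m : OpZ D -> OpZ D' -> Cinf f ->
  opalpha sigma (fun G => Ffun f * D G + D' G : Z -> R) m =
  f m * opalpha sigma D m + opalpha sigma D' m.
Proof.
move=> [Df _] [Df' _] fC; rewrite /opalpha opgamma_comb.
have C1 := fo_CinfZ (Fsec sigma) Df; have C2 := fo_CinfZ (Fsec sigma) Df'.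
rewrite (foD fo_XZ (CinfZM (CinfZ_Ffun fC) C1) C2) (XZ_FfunM fC C1).
rewrite -[X in _ - X]/(f (zeta (sigma m)) * X (D (Fsec sigma)) (sigma m) + X (D' (Fsec
  sigma)) (sigma m)).
by rewrite ss.1; ring.
Qed.

Lemma XZ_parts m : [/\ opgamma sigma X m = 0, opalpha sigma X m = 0, opbeta sigma X m = 1 &
  forall f, Cinf f -> opsymbol sigma X f m = 0].
Proof.
by split=> [|||f fC]; rewrite /opsymbol /opalpha /opgamma /opbeta ?XZ_Fsec// ?XZ1
  ?XZ_Ffun// ?mul0r ?subrr.
Qed.

Lemma opid_parts m : [/\ opgamma sigma (@opid R n M Z) m = 1, opalpha sigma (@opid R n M
  Z) m = 0,
  opbeta sigma (@opid R n M Z) m = 0 & forall f, Cinf f -> opsymbol sigma (@opid R n M Z)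
    f m = 0].
Proof.
have e1 : opgamma sigma (@opid R n M Z) m = 1 by rewrite /opgamma opidE//; exact: CinfZ1.
have eF : opid (Fsec sigma) = Fsec sigma by apply: opidE; exact: CinfZ_Fsec.
split=> //.
- by rewrite /opalpha e1 eF XZ_Fsec// subrr.
- by rewrite /opbeta eF Fsec_at.
- move=> f fC; rewrite /opsymbol e1 opidE; last exact: CinfZ_Ffun.
  by rewrite /Ffun ss.1 mul1r subrr.
Qed.

Lemma euler_parts m : [/\ opgamma sigma (euler sigma) m = 0, opalpha sigma (euler sigma)
  m = -1,
  opbeta sigma (euler sigma) m = 0 & forall f, Cinf f -> opsymbol sigma (euler sigma) f m
    = 0].
Proof.
have e1 : opgamma sigma (euler sigma) m = 0 by rewrite /opgamma /euler XZ1 mulr0.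
split=> //.
- by rewrite /opalpha e1 /euler XZ_Fsec// mulr1 XZ_Fsec// sub0r.
- by rewrite /opbeta /euler XZ_Fsec// mulr1 Fsec_at.
- by move=> f fC; rewrite /opsymbol e1 /euler XZ_Ffun// mulr0 mul0r subrr.
Qed.

Section Commutator.
Variables (D D' : @op R n M Z) (DO : OpZ D) (DO' : OpZ D').
Let C : @op R n M Z := fun F => D (D' F) - D' (D F).

Lemma opgamma_commutator m :
  opgamma sigma C m = opsymbol sigma D (opgamma sigma D') m - opsymbol sigma D' (opgamma
    sigma D) m.
Proof.
rewrite {1}/opgamma -[C 1 _]/(D (D' 1) (sigma m) - D' (D 1) (sigma m)).
rewrite (op1 ss DO) (op1 ss DO') /opsymbol; ring.
Qed.

(** [h] and [h'] are the coefficients of [Fsec sigma] in [B (Fsec sigma)] and [B' (Fsec sigma)].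
    Their product is symmetric, so in a commutator only the derivatives of [h] and [h'] along the
    symbols survive. *)
Lemma XZ_op_op_Fsec (B B' : @op R n M Z) : OpZ B -> OpZ B' ->
  let h := opgamma sigma B - opalpha sigma B in let h' := opgamma sigma B' - opalpha
    sigma B' in
  X (B (B' (Fsec sigma))) = Ffun (h * h') + Ffun (opsymbol sigma B h').
Proof.
move=> BO BO' h h'; have [Bf _] := BO.
have h'C : Cinf h' by apply: CinfB; [exact: Cinf_opgamma|exact: Cinf_opalpha].
have hC : Cinf h by apply: CinfB; [exact: Cinf_opgamma|exact: Cinf_opalpha].
have ThC : Cinf (opsymbol sigma B h') by exact: Cinf_opsymbol.
have FC := CinfZ_Fsec ss.
have bC : Cinf (opbeta sigma B') by exact: Cinf_opbeta.
have bP : Pol 0 (B (Ffun (opbeta sigma B'))) by apply: BO.2; exact: Pol_Ffun.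
rewrite (op_Fsec ss BO') (foD Bf (CinfZ_Ffun bC) (CinfZM (CinfZ_Ffun h'C) FC)).
rewrite (op_FfunM ss BO h'C FC).
have C1 := CinfZM (CinfZ_Ffun h'C) (fo_CinfZ (Fsec sigma) Bf).
have C2 := CinfZM (CinfZ_Ffun ThC) FC.
rewrite (foD fo_XZ (Pol_CinfZ bP) (CinfZD C1 C2)) (foD fo_XZ C1 C2).
rewrite ((Pol0P _).1 bP).2 add0r (XZ_FfunM h'C (fo_CinfZ _ Bf)) (XZ_FfunM ThC FC).
by rewrite XZ_Fsec// mulr1 (XZ_op_Fsec ss BO) mulrC.
Qed.

Lemma opalpha_commutator m :
  opalpha sigma C m = opsymbol sigma D (opalpha sigma D') m - opsymbol sigma D' (opalpha
    sigma D) m.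
Proof.
have [[Df _] [Df' _]] := (DO, DO').
have C1 := fo_CinfZ (D' (Fsec sigma)) Df; have C2 := fo_CinfZ (D (Fsec sigma)) Df'.
have c1 := Cinf_opgamma ss DO; have c0 := Cinf_opalpha ss DO.
have c1' := Cinf_opgamma ss DO'; have c0' := Cinf_opalpha ss DO'.
rewrite /opalpha -/(opalpha sigma D) -/(opalpha sigma D') opgamma_commutator (foB fo_XZ
  C1 C2).
rewrite (XZ_op_op_Fsec DO DO') (XZ_op_op_Fsec DO' DO).
set h := _ - opalpha sigma D; set h' := _ - opalpha sigma D'.
rewrite -[X in _ - X]/(h (zeta (sigma m)) * h' (zeta (sigma m)) + opsymbol sigma D h'
  (zeta (sigma m))
   - (h' (zeta (sigma m)) * h (zeta (sigma m)) + opsymbol sigma D' h (zeta (sigma m))))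
     ss.1.
rewrite (opsymbolB sigma DO)// (opsymbolB sigma DO')//; ring.
Qed.

End Commutator.
End CoefficientValues.
End PolynomialOperators.

(** * Local frames *)

Section VectorBundleCriterion.
Context {R : realType} {n : nat} {M : manifold R n}.
Implicit Types (U : set M) (m : M).

Lemma smooth_on_det U r (P : M -> 'M[R]_r) : open U ->
  (forall i j, smooth_on U (fun m => P m i j)) -> smooth_on U (fun m => \det (P m)).
Proof.
move=> oU Ps; apply: smooth_on_sum => // s _; apply: smooth_onM => //.
  exact: smooth_on_cst.
by apply: smooth_on_prod.
Qed.

Lemma smooth_on_invmx U r (P : M -> 'M[R]_r) i j : open U ->
  (forall i j, smooth_on U (fun m => P m i j)) -> (forall m, U m -> P m \in unitmx) ->
  smooth_on U (fun m => invmx (P m) i j).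
Proof.
move=> oU Ps Pu.
apply: (@eq_smooth_on _ _ _ _ (fun m => (\det (P m))^-1 *
   ((-1) ^+ (j + i) * \det (row' j (col' i (P m)))))) => //.
  by move=> m Um; rewrite /invmx Pu// !mxE.
apply: smooth_onM => //.
  apply: smooth_onV => //; last exact: smooth_on_det.
  by move=> m Um; rewrite -unitfE; have := Pu m Um; rewrite unitmxE.
apply: smooth_onM => //; first exact: smooth_on_cst.
apply: smooth_on_det => // i' j'.
apply: (@eq_smooth_on _ _ _ _ (fun m => P m (lift j i') (lift i j'))) => // m _.
by rewrite !mxE.
Qed.

Context {W : lmodType R}.
Implicit Types (E : @bundle R n M W).

Lemma fib_sum E m (I : Type) (s : seq I) (a : I -> R) (v : I -> W) :
  fib E m 0 ->
  (forall (t : R) v w, fib E m v -> fib E m w -> fib E m (t *: v + w)) ->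
  (forall i, fib E m (v i)) -> fib E m (\sum_(i <- s) a i *: v i).
Proof.
move=> E0 El Ev; elim: s => [|i s IH]; first by rewrite big_nil.
by rewrite big_cons; exact: El.
Qed.

(** A vector bundle must have smooth coefficients in every local frame; one good frame about each
    point suffices. An arbitrary frame consists of sections, so its matrix [P] in the good frame is
    smooth; it is also invertible, and its inverse is smooth by the cofactor formula. *)
Lemma vector_bundle_of_frames E r :
  (forall m, fib E m 0) ->
  (forall m (t : R) v w, fib E m v -> fib E m w -> fib E m (t *: v + w)) ->
  (forall m, exists U (e : 'I_r -> M -> W), [/\ local_frame E U e, U m &
     forall s, sec E s -> exists a : 'I_r -> M -> R, (forall i, smooth_on U (a i)) /\
       forall y, U y -> s y = \sum_i a i y *: e i y]) ->
  (forall s, (forall m, exists U (e : 'I_r -> M -> W), U m /\ exists a : 'I_r -> M -> R,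
     [/\ local_frame E U e, forall i, smooth_on U (a i) &
       forall y, U y -> s y = \sum_i a i y *: e i y]) -> sec E s) ->
  vector_bundle r E.
Proof.
move=> E0 El good glue; split=> //.
  by move=> m; have [U [e [fe Um _]]] := good m; exists U, e.
move=> s; split=> [ss U e fe|H]; last first.
  apply: glue => m; have [U [e [fe Um _]]] := good m.
  by have [a [as_ aE]] := H U e fe; exists U, e; split=> //; exists a.
have sfib y : fib E y (s y).
  have [U' [e' [[_ _ fe'] Uy' /(_ s ss)[a [_ ->//]]]]] := good y.
  by apply: (fib_sum _ _ (E0 y) (El y)); exact: (fe' y Uy').1.
have AP y : exists a : 'rV[R]_r, U y -> s y = \sum_i a 0 i *: e i y.
  have [Uy|nU] := pselect (U y); last by exists 0.
  case: fe => _ _ /(_ y Uy)[_ /(_ _ (sfib y))[a [aE _]]].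
  by exists a.
have [A AE] := choice AP.
exists (fun i y => A y 0 i); split=> // i; apply: smooth_on_local => y0 Uy0.
have [U' [e' [fe' Uy' H]]] := good y0.
have [b [bs bE]] := H s ss.
have [oU es ef] := fe; have [oU' es' ef'] := fe'.
have [p pP] := choice (fun j => H (e j) (es j)).
pose P y : 'M[R]_r := \matrix_(j, k) p j k y.
have oI := openI oU oU'.
have Ps j k : smooth_on (U `&` U') (fun y => P y j k).
  apply: (@eq_smooth_on _ _ _ _ (p j k)) => //; first by move=> y _; rewrite mxE.
  by apply: smooth_on_subset ((pP j).1 k) => y [].
have comb y (u : 'rV[R]_r) : U' y -> \sum_j u 0 j *: e j y = \sum_k (u *m P y) 0 k *: e'
  k y.
  move=> U'y; under eq_bigr do rewrite (pP _).2// scaler_sumr.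
  rewrite exchange_big /=; apply: eq_bigr => k _.
  rewrite mxE scaler_suml; apply: eq_bigr => j _; by rewrite scalerA mxE.
have uniq0 y (u : 'rV[R]_r) : U y -> \sum_j u 0 j *: e j y = 0 -> u = 0.
  move=> Uy u0; have [_ /(_ 0 (E0 y))[a [_ au]]] := ef y Uy.
  rewrite -(au u (esym u0)); apply: au.
  by rewrite big1// => j _; rewrite mxE scale0r.
(* A linear relation between the rows of [P y] would be one between the [e j y]. *)
have Pu y : (U `&` U') y -> P y \in unitmx.
  move=> [Uy U'y]; rewrite -row_free_unit; apply: inj_row_free => u uP.
  apply: (uniq0 y) => //; rewrite comb// uP big1// => k _.
  by rewrite mxE scale0r.
have uniq' y (u v : 'rV[R]_r) : U' y -> \sum_k u 0 k *: e' k y = \sum_k v 0 k *: e' k y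
  -> u = v.
  move=> U'y uv; have [fe'y /(_ (\sum_k u 0 k *: e' k y))] := ef' y U'y.
  have f1 : fib E y (\sum_k u 0 k *: e' k y) by apply: (fib_sum _ _ (E0 y) (El y));
    exact: fe'y.
  by move=> /(_ f1)[a [_ au]]; rewrite -(au u erefl) -(au v uv).
exists (U `&` U') => //.
apply: (@eq_smooth_on _ _ _ _ (fun y => \sum_k b k y * invmx (P y) k i)) => //.
  move=> y [Uy U'y]; have e1 : A y *m P y = \row_k b k y.
    apply: (uniq' y) => //; rewrite -comb// -AE// bE//.
    by apply: eq_bigr => k _; rewrite mxE.
  have -> : A y = (\row_k b k y) *m invmx (P y) by rewrite -e1 mulmxK// Pu.
  by rewrite mxE; apply: eq_bigr => k _; rewrite mxE.
apply: smooth_on_sum => // k _; apply: smooth_onM => //; last exact: smooth_on_invmx.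
by apply: smooth_on_subset (bs k) => y [].
Qed.

End VectorBundleCriterion.

(** * Horizontal lifts of cut-off coordinate vector fields *)

Section HorizontalLift.
Context {R : realType} {n : nat} {M : manifold R n} {Z : avbundle M}.
Variables (sigma : M -> Z) (ss : SecZ sigma) (c : chart R n M) (ac : atlas c).
Variables (phi : M -> R) (phiC : Cinf phi) (C : set M) (cC : closed C)
  (Cc : C `<=` cdom c) (phi_out : forall m, ~ C m -> phi m = 0).

(* The lift of phi d/dv that is tangent to all the translates of sigma. *)
Definition hlift (v : 'rV[R]_n) : @op R n M Z := fun F z =>
  if `[< CinfZ F >] then
    phi (zeta z) * dchart c v (fun m => F (zadd (sigma m) (zsub z (sigma (zeta z)))))
      (zeta z)
  else 0.

(** The chart [c'] and the trivialisation [tau] are unrelated to [c] and [sigma], so the chain rule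
    is needed: [h] lists the coordinates of [sigma] with respect to [c'] and [tau], and the
    coefficients are [phi] times the derivatives of [h] along [v]. Extension by zero makes them
    smooth on all of [U'], even outside the domain of [c]. *)
Lemma fo_hlift v : first_order_operator (hlift v).
Proof.
apply/foP; split; first by move=> F nF; apply/funext => z; rewrite /hlift asboolF.
move=> c' tau ac' lt; have ot := @ltriv_open _ _ _ _ _ lt.
have oc := (atlas_open ac).1; have oc' := (atlas_open ac').1.
pose h (i : 'I_n + unit) m := match i with
  inl b => cmap c' m 0 b | inr _ => zsub (sigma m) (tau.2 m) end.
pose q i m := phi m * dchart c v (h i) m.
pose U' := cdom c' `&` tau.1; have oU' : open U' by exact: openI.
have hs i : smooth_on U' (h i).
  case: i => [b|?]; first by apply: smooth_on_subset (smooth_on_coord b ac') => m [].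
  by apply: smooth_on_subset (ss.2 _ lt) => m [].
have qs i : smooth_on U' (q i).
  apply: (smooth_on_ext0 oU' oc cC Cc _ (fun _ _ => erefl)); last first.
    by move=> m nC; rewrite /q phi_out// mul0r.
  rewrite setIC; apply: smooth_onM; first exact: openI.
    exact: smooth_on_subset phiC.
  exact: smooth_on_dchart.
have oz := open_zdom ac' lt.
exists (fun i p => q i (cinv c' p.1)), (cst 0); split; last 1 first.
- move=> F p FC zp; rewrite mul0r addr0 /hlift asboolT// zeta_zpoint//.
  have [cp tp] := zp; set m := cinv c' p.1; have [c'm c'E] := atlas_inv ac' cp.
  rewrite -/m in c'm c'E.
  have [cm|ncm] := pselect (cdom c m); last first.
    have nC : ~ C m by move=> /Cc.
    by rewrite phi_out// mul0r big1// => i _; rewrite /q -/m phi_out// !mul0r.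
  rewrite /q -/m; under eq_bigr do rewrite -mulrA.
  rewrite -mulr_sumr; congr (_ * _).
  set s := zsub (zpoint c' tau p) (sigma m).
  (* Coordinates of the translate of [sigma] by the constant [s], the one that passes through the
     given point. *)
  pose co (i : 'I_n + unit) (x : 'rV[R]_n) := match i with
    inl b => h (inl b) (cinv c x) | inr u => s + h (inr u) (cinv c x) end.
  have [cx cE] := atlas_map ac cm.
  have mz : zeta (zpoint c' tau p) = m by rewrite zeta_zpoint.
  have tz : zeta (tau.2 m) = m by exact: ltriv_sec.
  have pE : \sum_i co i (cmap c m) *: frameZ i = p.
    rewrite [RHS]decomp_frameZ; apply: eq_bigr => -[b|u] _ /=; rewrite cE.
      by rewrite c'E.
    congr (_ *: _).
    have z0 : zsub (sigma m) (tau.2 m) + zsub (tau.2 m) (sigma m) = 0.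
      by rewrite -zsub_trans ?tz ?ss.1// zsubxx.
    rewrite /s /zpoint -/m zsub_addl ?tz ?ss.1//.
    by rewrite addrAC [zsub (tau.2 m) _ + _]addrC z0 add0r.
  have oV := open_cimgI ac oU'; set V := _ `&` _ in oV.
  have Vx : V (cmap c m) by split=> //=; rewrite cE.
  have hV i : smooth V (h i \o cinv c) by exact: (hs i c ac).
  have nE : {near cmap c m, (fun x => F (zadd (sigma (cinv c x)) s)) =1
      (fun x => (F \o zpoint c' tau) (\sum_i co i x *: frameZ i))}.
    apply: (@eq_on_near _ _ V) => // x [cix [c'x tx]].
    have -> : \sum_i co i x *: frameZ i = (cmap c' (cinv c x), co (inr tt) x).
      by rewrite [RHS]decomp_frameZ; apply: eq_bigr => -[b|[]].
    rewrite /= /zpoint /=; have [_ ->] := atlas_map ac' c'x.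
    by rewrite addrC zaddD zsubK// ltriv_sec// ss.1.
  rewrite /dchart [LHS](near_eq_derive _ nE).
  have dco i : is_derive (cmap c m) v (co i) (dchart c v (h i) m).
    have dh := derivableP (smooth_derivable (v := v) (hV i) Vx).
    case: i dh => [b|u] dh; first exact: dh.
    have := is_deriveD (is_derive_cst s (cmap c m) v) dh; rewrite add0r.
    exact.
  have zp' : zdom c' tau (\sum_i co i (cmap c m) *: frameZ i) by rewrite pE.
  have [_ ->] := is_derive_chain oz (FC c' tau ac' lt 1%N) zp' (fun i => @ex_derive _ _ _
    _ _ _ _ (dco i)).
  rewrite pE; apply: eq_bigr => i _.
  by have [_ ->] := dco i.
- move=> i; have Q := qs i c' ac'.
  apply: (smooth_fst (open_cimgI ac' oU') oz Q) => p [cp tp]; split=> //=.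
  by have [] := atlas_inv ac' cp.
- exact: smooth_cst.
Qed.

Lemma hlift_Fsec v : hlift v (Fsec sigma) = 0.
Proof.
apply/funext => z; rewrite /hlift asboolT; last exact: CinfZ_Fsec.
rewrite /dchart (_ : _ \o _ = cst (- zsub z (sigma (zeta z)))).
  by rewrite derive_cst mulr0.
by apply/funext => x /=; rewrite Fsec_zadd// Fsec_at// sub0r.
Qed.

Lemma hlift_Ffun v f : Cinf f -> hlift v (Ffun f) = Ffun (fun m => phi m * dchart c v f m).
Proof.
move=> fC; apply/funext => z; rewrite /hlift asboolT; last exact: CinfZ_Ffun.
rewrite /Ffun; congr (_ * _); rewrite /dchart; congr (derive _ _ _).
by apply/funext => x /=; rewrite zeta_add ss.1.
Qed.

Lemma hlift1 v : hlift v 1 = 0.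
Proof.
rewrite -[1]/(Ffun (cst 1)) hlift_Ffun; last exact: Cinf_cst.
apply/funext => z; rewrite /Ffun /dchart (_ : _ \o _ = cst 1)//.
by rewrite derive_cst mulr0.
Qed.

Lemma OpZ_hlift v : OpZ (hlift v).
Proof.
have Df := fo_hlift v.
have XF f : Cinf f -> XZ Z (hlift v (Ffun f)) = 0.
  move=> fC; apply/funext => z; rewrite (XZE _ (fo_CinfZ _ Df)) hlift_Ffun//.
  rewrite (_ : (fun t => _) = cst (phi (zeta z) * dchart c v f (zeta z))).
    by rewrite derive1_cst.
  by apply/funext => t; rewrite /Ffun zeta_add.
apply: (OpZ_of_commutator_XZ Df (Cinf_cst 0)) => F FC.
apply/funext => z; rewrite -[RHS]/(0 * XZ Z F z) mul0r.
apply: (fo_determined F (fo_commutator Df fo_XZ) ss) => [f fC|].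
  by rewrite XZ_Ffun// fo0// XF// subrr.
by rewrite hlift_Fsec XZ_Fsec// hlift1 fo0 ?subrr//; exact: fo_XZ.
Qed.

Lemma hlift_parts v m : [/\ opgamma sigma (hlift v) m = 0, opalpha sigma (hlift v) m = 0,
  opbeta sigma (hlift v) m = 0 &
  forall f, Cinf f -> opsymbol sigma (hlift v) f m = phi m * dchart c v f m].
Proof.
have e1 : opgamma sigma (hlift v) m = 0 by rewrite /opgamma hlift1.
split=> //.
- by rewrite /opalpha e1 hlift_Fsec fo0 ?subrr//; exact: fo_XZ.
- by rewrite /opbeta hlift_Fsec.
- by move=> f fC; rewrite /opsymbol e1 hlift_Ffun// /Ffun ss.1 mul0r subr0.
Qed.

End HorizontalLift.

Lemma sum_split {V : nmodType} (p q : nat) (g : 'I_p + 'I_q -> V) :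
  \sum_(k < p + q) g (fintype.split k) = \sum_i g (inl i) + \sum_j g (inr j).
Proof.
rewrite big_split_ord /=; congr (_ + _); apply: eq_bigr => i _; congr g.
  exact: (unsplitK (inl i)).
exact: (unsplitK (inr i)).
Qed.

(** * Combinations of operators with coefficients on the base *)

Section OperatorSums.
Context {R : realType} {n : nat} {M : manifold R n} {Z : avbundle M}.
Variables (sigma : M -> Z) (ss : SecZ sigma).
Implicit Types (D : @op R n M Z) (m : M) (f : M -> R).

Lemma OpZ_zero : OpZ (fun _ => 0 : Z -> R).
Proof.
apply: (OpZ_of_commutator_XZ fo_zero (Cinf_cst 0)) => F FC.
rewrite (fo0 fo_XZ) subrr; apply/funext => z.
by rewrite -[RHS]/(0 * XZ Z F z) mul0r.
Qed.

Lemma field_of_zero m : field_of (fun _ => 0 : Z -> R) m = 0.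
Proof. by apply/funext => F; apply/funext => z; rewrite /field_of; case: asboolP. Qed.

Lemma op_zero_parts m : [/\ opgamma sigma (fun _ => 0 : Z -> R) m = 0,
  opalpha sigma (fun _ => 0 : Z -> R) m = 0, opbeta sigma (fun _ => 0 : Z -> R) m = 0 &
  forall f, opsymbol sigma (fun _ => 0 : Z -> R) f m = 0].
Proof.
split=> [|||f] //.
- by rewrite /opalpha /opgamma fo0 ?subrr//; exact: fo_XZ.
- by rewrite /opsymbol /opgamma mul0r subr0.
Qed.

Definition opsum (I : Type) (s : seq I) (a : I -> M -> R) (e : I -> @op R n M Z) :
  @op R n M Z := fun F => \sum_(i <- s) Ffun (a i) * e i F.

Lemma opsum_cons I (i : I) s a e : opsum (i :: s) a e =
  (fun F => Ffun (a i) * e i F + opsum s a e F).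
Proof. by apply/funext => F; rewrite /opsum big_cons. Qed.

Lemma opsum_nil I a (e : I -> @op R n M Z) : opsum [::] a e = (fun _ => 0).
Proof. by apply/funext => F; rewrite /opsum big_nil. Qed.

Lemma OpZ_opsum I (s : seq I) a e : (forall i, Cinf (a i)) -> (forall i, OpZ (e i)) ->
  OpZ (opsum s a e).
Proof.
move=> aC eO; elim: s => [|i s IH]; first by rewrite opsum_nil; exact: OpZ_zero.
by rewrite opsum_cons; exact: OpZ_comb.
Qed.

Lemma field_of_opsum I (s : seq I) a e m :
  field_of (opsum s a e) m = \sum_(i <- s) a i m *: field_of (e i) m.
Proof.
elim: s => [|i s IH]; first by rewrite opsum_nil big_nil field_of_zero.
by rewrite opsum_cons big_cons field_of_comb IH.
Qed.

Lemma opgamma_opsum I (s : seq I) a e m :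
  opgamma sigma (opsum s a e) m = \sum_(i <- s) a i m * opgamma sigma (e i) m.
Proof.
elim: s => [|i s IH]; first by rewrite opsum_nil big_nil.
by rewrite opsum_cons big_cons (opgamma_comb ss) IH.
Qed.

Lemma opbeta_opsum I (s : seq I) a e m :
  opbeta sigma (opsum s a e) m = \sum_(i <- s) a i m * opbeta sigma (e i) m.
Proof.
elim: s => [|i s IH]; first by rewrite opsum_nil big_nil.
by rewrite opsum_cons big_cons (opbeta_comb ss) IH.
Qed.

Lemma opsymbol_opsum I (s : seq I) a e f m :
  opsymbol sigma (opsum s a e) f m = \sum_(i <- s) a i m * opsymbol sigma (e i) f m.
Proof.
elim: s => [|i s IH].
  by rewrite opsum_nil big_nil; have [_ _ _ ->] := op_zero_parts m.
by rewrite opsum_cons big_cons (opsymbol_comb ss) IH.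
Qed.

Lemma opalpha_opsum I (s : seq I) a e m : (forall i, Cinf (a i)) -> (forall i, OpZ (e i)) ->
  opalpha sigma (opsum s a e) m = \sum_(i <- s) a i m * opalpha sigma (e i) m.
Proof.
move=> aC eO; elim: s => [|i s IH].
  by rewrite opsum_nil big_nil; have [_ -> _ _] := op_zero_parts m.
rewrite opsum_cons big_cons (opalpha_comb ss) ?IH//; exact: OpZ_opsum.
Qed.

Lemma field_of_inj_parts D D' m : OpZ D -> OpZ D' -> field_of D m = field_of D' m ->
  [/\ forall f, opsymbol sigma D f m = opsymbol sigma D' f m,
      opgamma sigma D m = opgamma sigma D' m, opalpha sigma D m = opalpha sigma D' m &
      opbeta sigma D m = opbeta sigma D' m].
Proof.
move=> DO DO' e.
have E F : D F (sigma m) = D' F (sigma m).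
  have := congr1 (fun v : @op R n M Z => v F (sigma m)) e.
  by rewrite /field_of asboolT//; exact: ss.1.
split.
- by move=> f; rewrite /opsymbol /opgamma !E.
- exact: E.
- by rewrite -(phi0_field ss DO) -(phi0_field ss DO') e.
- exact: E.
Qed.

(** Functions of the base have no derivative along the fibre, and the subtraction of [opgamma]
    removes the zeroth-order term, so only the base derivatives remain. *)
Lemma opsymbol_chart D c m : first_order_operator D -> atlas c -> cdom c m ->
  exists g : 'I_n -> R, forall f, Cinf f ->
    opsymbol sigma D f m = \sum_a g a * dchart c (delta_mx 0 a) f m.
Proof.
move=> /foP[_ DC] ac cm; have [tau lt tm] := @ltriv_cover _ _ _ Z m.
have [G [k [_ _ E]]] := DC c tau ac lt; have [cx cE] := atlas_map ac cm.
pose p := (cmap c m, zsub (sigma m) (tau.2 m)).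
have zp : zdom c tau p by split=> //=; rewrite cE.
have pE : zpoint c tau p = sigma m.
  by rewrite /zpoint /= cE zsubK// ltriv_sec// ss.1.
exists (fun a => G (inl a) p) => f fC.
rewrite /opsymbol /opgamma -pE (E _ _ (CinfZ_Ffun fC) zp) (E _ _ CinfZ1 zp).
rewrite [X in _ - (X + _) * _]big1 ?add0r => [|i _]; last first.
  by rewrite -[1 \o _]/(cst 1) derive_cst mulr0.
rewrite pE /Ffun ss.1 -[1 (sigma m)]/(1 : R) mulr1 addrK sum_frameZ.
rewrite (derive_Ffun _ _ ac lt zp) /= derive0 mulr0 addr0.
by apply: eq_bigr => a _; rewrite (derive_Ffun _ _ ac lt zp).
Qed.

End OperatorSums.

(** * Local frames of the subbundles of [RZ] *)

Section Frames.
Context {R : realType} {n : nat} {M : manifold R n} {Z : avbundle M}.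
Variables (sigma : M -> Z) (ss : SecZ sigma).
(* The subbundles of RZ at hand are the preimages under (- phi0, phi1) of a
   subspace of R^2: it has basis (kE j, kI j), and the coordinates of (a, b) in
   this basis are lE j * a + lI j * b. *)
Variables (d : nat) (kE kI lE lI : 'I_d -> R).
Hypothesis klE : forall i j, lE i * kE j + lI i * kI j = (i == j)%:R.

Definition in_span (a b : R) := a = \sum_j (lE j * a + lI j * b) * kE j /\
  b = \sum_j (lE j * a + lI j * b) * kI j.

Variable E : @bundle R n M (@op R n M Z).
Hypothesis fibE : forall m v, fib E m v <->
  fib (RZ Z) m v /\ in_span (- phi0 m v) (phi1 m v).
Hypothesis secE : forall s, sec E s <-> sec (RZ Z) s /\ forall m, fib E m (s m).

(** E lies over (1, 0) and the identity over (0, 1) under (- [phi0], [phi1]), so this operator lies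
    over the basis vector ([kE j], [kI j]). *)
Definition vertical (j : 'I_d) : @op R n M Z := fun F =>
  Ffun (cst (kE j)) * euler sigma F + (Ffun (cst (kI j)) * opid F + 0).

Lemma OpZ_vertical j : OpZ (vertical j).
Proof.
apply: OpZ_comb; [exact: OpZ_euler| |exact: Cinf_cst].
by apply: OpZ_comb; [exact: OpZ_opid|exact: OpZ_zero|exact: Cinf_cst].
Qed.

Lemma vertical_parts j m : [/\ opgamma sigma (vertical j) m = kI j,
  opalpha sigma (vertical j) m = - kE j, opbeta sigma (vertical j) m = 0 &
  forall f, Cinf f -> opsymbol sigma (vertical j) f m = 0].
Proof.
have [e1 e2 e3 e4] := euler_parts ss m; have [i1 i2 i3 i4] := opid_parts ss m.
have [z1 z2 z3 z4] := @op_zero_parts R n M Z sigma m.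
have I0 := OpZ_comb (@OpZ_opid R n M Z) (@OpZ_zero R n M Z) (Cinf_cst (kI j)).
split.
- by rewrite /vertical !(opgamma_comb ss) e1 i1 z1 mulr0 add0r addr0 mulr1.
- rewrite /vertical (opalpha_comb ss m (OpZ_euler ss) I0 (Cinf_cst (kE j))).
  rewrite (opalpha_comb ss m (@OpZ_opid R n M Z) (@OpZ_zero R n M Z) (Cinf_cst (kI j))).
  by rewrite e2 i2 z2 mulr0 !addr0 mulrN1.
- by rewrite /vertical !(opbeta_comb ss) e3 i3 z3 !mulr0 !addr0.
- by move=> f fC; rewrite /vertical !(opsymbol_comb ss) e4// i4// z4 !mulr0 !addr0.
Qed.

Lemma fib_field D m : OpZ D -> fib E m (field_of D m) <->
  in_span (- opalpha sigma D m) (opgamma sigma D m).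
Proof.
move=> DO; rewrite -(phi0_field ss DO) -(phi1_field ss DO); split; first by move=> /fibE[].
by move=> h; apply/fibE; split=> //; exists D.
Qed.

Lemma in_span0 : in_span 0 0.
Proof. by split; rewrite big1// => j _; rewrite !mulr0 addr0 mul0r. Qed.

Lemma in_span_lin t a b a' b' : in_span a b -> in_span a' b' ->
  in_span (t * a + a') (t * b + b').
Proof.
move=> [ea eb] [ea' eb']; split.
  rewrite {1}ea {1}ea' mulr_sumr -big_split /=; apply: eq_bigr => j _; ring.
rewrite {1}eb {1}eb' mulr_sumr -big_split /=; apply: eq_bigr => j _; ring.
Qed.

Lemma in_span_comb (u : 'I_d -> R) : in_span (\sum_j u j * kE j) (\sum_j u j * kI j).
Proof.
have e i : lE i * (\sum_j u j * kE j) + lI i * (\sum_j u j * kI j) = u i.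
  rewrite !mulr_sumr -big_split /= (eq_bigr (fun j => u j * (i == j)%:R)).
    rewrite (bigD1 i)//= eqxx mulr1 big1 ?addr0// => j ji.
    by rewrite eq_sym (negbTE ji) mulr0.
  by move=> j _; rewrite -klE; ring.
by split; apply: eq_bigr => j _; rewrite e.
Qed.

Lemma fibE_RZ m v : fib E m v -> exists2 D, OpZ D & v = field_of D m.
Proof. by move=> /fibE[]. Qed.

Lemma fib0 m : fib E m 0.
Proof.
rewrite -(@field_of_zero R n M Z m); apply/(fib_field m (@OpZ_zero R n M Z)).
have [-> -> _ _] := @op_zero_parts R n M Z sigma m.
by rewrite oppr0; exact: in_span0.
Qed.

Lemma fib_lin m (t : R) v w : fib E m v -> fib E m w -> fib E m (t *: v + w).
Proof.
move=> Ev Ew; have [D DO vD] := fibE_RZ Ev; have [D' DO' wD] := fibE_RZ Ew.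
rewrite vD in Ev *; rewrite wD in Ew *.
have tC : Cinf (cst t : M -> R) by exact: Cinf_cst.
rewrite -[t in t *: _]/(cst t m) -(field_of_comb (cst t)).
apply/(fib_field _ (OpZ_comb DO DO' tC)).
rewrite (opalpha_comb ss m DO DO' tC) (opgamma_comb ss) opprD -mulrN.
by apply: in_span_lin; exact/fib_field.
Qed.

Definition frame_coord (x : 'I_n -> M -> R) D m (k : 'I_n + 'I_(1 + d)) : R :=
  match k with
  | inl a => opsymbol sigma D (x a) m
  | inr k' => match fintype.split k' with
    | inl _ => opbeta sigma D m
    | inr j => lE j * - opalpha sigma D m + lI j * opgamma sigma D m
    end
  end.

(** The frame consists of [n] horizontal lifts, [XZ] and the [d] vertical operators. The coordinates
    [frame_coord] are the symbol on the coordinate functions, [opbeta], and the dual functionals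
    ([lE j], [lI j]) applied to (- [opalpha], [opgamma]); for a global operator all of them are
    smooth. *)
Lemma exists_frame m : exists U (e : 'I_(n + (1 + d)) -> M -> @op R n M Z),
  [/\ local_frame E U e, U m & forall s, sec E s ->
     exists a : 'I_(n + (1 + d)) -> M -> R, (forall i, smooth_on U (a i)) /\
       forall y, U y -> s y = \sum_i a i y *: e i y].
Proof.
have [c ac cm] := atlas_cover m.
have [x [U [xC oU Um Uc xE]]] := local_coordinates ac cm.
have [phi [pC [U' [oU' U'm U'c U'1]] [C [cC Cc C0]]]] := exists_bump (atlas_open ac).1 cm.
pose fr' (k : 'I_n + 'I_(1 + d)) : @op R n M Z := match k with
  | inl a => hlift sigma c phi (delta_mx 0 a)
  | inr k' => match fintype.split k' with inl _ => XZ Z | inr j => vertical j end end.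
pose fr k := fr' (fintype.split k).
have frO' k : OpZ (fr' k).
  case: k => [a|k] /=; first exact: (OpZ_hlift ss ac pC cC Cc C0).
  by case: (fintype.split k) => [_|j]; [exact: OpZ_XZ|exact: OpZ_vertical].
have frO k : OpZ (fr k) by exact: frO'.
(* On [V] the functions [x a] are the chart coordinates and [phi] is 1, so the lifts are dual to the
   [x a] there. *)
pose V := U `&` U'; have oV : open V by exact: openI.
have hx y a b : V y -> dchart c (delta_mx 0 b) (x a) y = (a == b)%:R.
  move=> [Uy _]; rewrite /dchart (derive_local_coordinates _ _ ac oU Uc xE)//.
  by rewrite mxE.
have sumO (g : 'I_n + 'I_(1 + d) -> R) : \sum_k g (fintype.split k) =
    \sum_a g (inl a) + (g (inr (lshift d ord0)) + \sum_j g (inr (rshift 1 j))).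
  by rewrite sum_split big_split_ord /= big_ord1.
have spl : fintype.split (lshift d (ord0 : 'I_1)) = inl ord0 by exact: (unsplitK (inl _)).
have spr j : fintype.split (rshift 1 (j : 'I_d)) = inr j by exact: (unsplitK (inr _)).
have parts y (b : 'I_n + 'I_(1 + d) -> R) : V y ->
   let D := opsum (index_enum _) (fun k => cst (b (fintype.split k))) fr in
   [/\ OpZ D, forall f, Cinf f -> opsymbol sigma D f y =
         \sum_a b (inl a) * dchart c (delta_mx 0 a) f y,
       opgamma sigma D y = \sum_j b (inr (rshift 1 j)) * kI j,
       opalpha sigma D y = - \sum_j b (inr (rshift 1 j)) * kE j &
       opbeta sigma D y = b (inr (lshift d ord0))].
  move=> [Uy U'y] D.
  have bC k : Cinf (cst (b (fintype.split k)) : M -> R) by exact: Cinf_cst.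
  have [X1 X2 X3 X4] := XZ_parts ss y.
  split; first by apply: OpZ_opsum.
  - move=> f fC; rewrite /D (opsymbol_opsum ss).
    rewrite (sumO (fun k => b k * opsymbol sigma (fr' k) f y)) /= spl X4// mulr0 add0r.
    rewrite [X in _ + X]big1 ?addr0 => [|j _].
      apply: eq_bigr => a _; have [_ _ _ ->//] := hlift_parts ss c phi (delta_mx 0 a) y.
      by rewrite U'1// mul1r.
    by rewrite spr; have [_ _ _ ->] := vertical_parts j y; rewrite ?mulr0.
  - rewrite /D (opgamma_opsum ss).
    rewrite (sumO (fun k => b k * opgamma sigma (fr' k) y)) /= spl X1 mulr0 add0r.
    rewrite big1 ?add0r => [|a _].
      by apply: eq_bigr => j _; rewrite spr; have [-> _ _ _] := vertical_parts j y.
    by have [-> _ _ _] := hlift_parts ss c phi (delta_mx 0 a) y; rewrite mulr0.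
  - rewrite /D (opalpha_opsum ss)//.
    rewrite (sumO (fun k => b k * opalpha sigma (fr' k) y)) /= spl X2 mulr0 add0r.
    rewrite big1 ?add0r => [|a _].
      rewrite -sumrN; apply: eq_bigr => j _; rewrite spr.
      by have [_ -> _ _] := vertical_parts j y; rewrite mulrN.
    by have [_ -> _ _] := hlift_parts ss c phi (delta_mx 0 a) y; rewrite mulr0.
  - rewrite /D (opbeta_opsum ss).
    rewrite (sumO (fun k => b k * opbeta sigma (fr' k) y)) /= spl X3 mulr1.
    rewrite big1 ?add0r => [|a _].
      rewrite big1 ?addr0// => j _; rewrite spr.
      by have [_ _ -> _] := vertical_parts j y; rewrite mulr0.
    by have [_ _ -> _] := hlift_parts ss c phi (delta_mx 0 a) y; rewrite mulr0.
(* The condition [in_span] says that the dual coordinates recover both [opalpha] and [opgamma]; all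
   four coefficients of the two sides then agree. *)
have dec D y : V y -> OpZ D -> in_span (- opalpha sigma D y) (opgamma sigma D y) ->
    field_of D y = \sum_k frame_coord x D y (fintype.split k) *: field_of (fr k) y.
  move=> Vy DO [eE eI].
  have [CO s1 s2 s3 s4] := parts y (frame_coord x D y) Vy.
  rewrite -(field_of_opsum (index_enum _) (fun k => cst (frame_coord x D y (fintype.split
    k))) fr y).
  apply: (field_of_eq ss) => //.
  - move=> f fC; rewrite s1//=.
    have [g gE] := opsymbol_chart ss DO.1 ac (Uc y Vy.1).
    rewrite gE//; apply: eq_bigr => a _; congr (_ * _).
    rewrite gE// (bigD1 a)//= hx// eqxx mulr1 big1 ?addr0// => b ba.
    by rewrite hx// eq_sym (negbTE ba) mulr0.
  - by rewrite s2 [LHS]eI; apply: eq_bigr => j _; rewrite /= spr.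
  - apply: oppr_inj; rewrite s3 opprK [LHS]eE; apply: eq_bigr => j _.
    by rewrite /= spr.
  - by rewrite s4 /= spl.
have uniq y D (b : 'I_n + 'I_(1 + d) -> R) : V y -> OpZ D ->
    field_of D y = \sum_k b (fintype.split k) *: field_of (fr k) y ->
    b =1 frame_coord x D y.
  move=> Vy DO eD; have [CO s1 s2 s3 s4] := parts y b Vy.
  rewrite -(field_of_opsum (index_enum _) (fun k => cst (b (fintype.split k))) fr y) in eD.
  have [q1 q2 q3 q4] := field_of_inj_parts ss DO CO eD.
  case=> [a|k] /=.
    rewrite q1 s1// (bigD1 a)//= hx// eqxx mulr1 big1 ?addr0// => a' aa'.
    by rewrite hx// eq_sym (negbTE aa') mulr0.
  rewrite -[in LHS](splitK k); case: (fintype.split k) => [i|j] /=.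
    by rewrite q4 s4 ord1.
  rewrite q2 q3 s2 s3 opprK !mulr_sumr -big_split /=.
  rewrite (eq_bigr (fun i => b (inr (rshift 1 i)) * (j == i)%:R)).
    rewrite (bigD1 j)//= eqxx mulr1 big1 ?addr0// => i ij.
    by rewrite eq_sym (negbTE ij) mulr0.
  by move=> i _; rewrite -klE; ring.
have frE k y : fib E y (field_of (fr k) y).
  apply/(fib_field _ (frO k)); rewrite /fr; case: (fintype.split k) => [a|k'] /=.
    have [-> -> _ _] := hlift_parts ss c phi (delta_mx 0 a) y.
    by rewrite oppr0; exact: in_span0.
  case: (fintype.split k') => [_|j].
    by have [-> -> _ _] := XZ_parts ss y; rewrite oppr0; exact: in_span0.
  have [-> -> _ _] := vertical_parts j y; rewrite opprK.
  have := in_span_comb (fun i => (i == j)%:R).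
  by rewrite (bigD1 j)//= eqxx mul1r big1 ?addr0 => [|i /negbTE->];
    rewrite ?mul0r// (bigD1 j)//= eqxx mul1r big1 ?addr0 => [//|i /negbTE->]; rewrite mul0r.
exists V, (fun k => field_of (fr k)); split; last first.
- move=> s /secE[[D DO ->] sE].
  exists (fun k y => frame_coord x D y (fintype.split k)); split.
    move=> k; suff H k' : Cinf (fun y => frame_coord x D y k').
      by apply: smooth_on_subset (H (fintype.split k)).
    case: k' => [a|k'] /=; first exact: Cinf_opsymbol.
    case: (fintype.split k') => [_|j]; first exact: Cinf_opbeta.
    apply: smooth_onD; [exact: openT| |].
      apply: smooth_onM; [exact: openT|exact: smooth_on_cst|].
      by apply: smooth_onN; [exact: openT|exact: Cinf_opalpha].
    by apply: smooth_onM; [exact: openT|exact: smooth_on_cst|exact: Cinf_opgamma].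
  by move=> y Vy; apply: dec => //; exact/fib_field.
- by split.
- split=> //.
    by move=> k; apply/secE; split; [exists (fr k)|move=> y; exact: frE].
  move=> y Vy; split; first by move=> k; exact: frE.
  move=> v Ev; have [D DO vD] := fibE_RZ Ev; rewrite vD in Ev *.
  exists (\row_k frame_coord x D y (fintype.split k)); split.
    rewrite dec//; last exact/fib_field.
    by apply: eq_bigr => k _; rewrite mxE.
  move=> u uE; apply/rowP => k; rewrite mxE.
  have := uniq y D (fun k => u 0 (unsplit k)) Vy DO _ (fintype.split k).
  rewrite splitK => <-//; rewrite uE.
  by apply: eq_bigr => i _; rewrite splitK.
Qed.

(** The local coefficients are multiplied by a bump function, so that near each point [s] comes from
    a global operator in [OpZ]; these operators are then glued. *)
Lemma sec_of_frames s : (forall m, exists U (e : 'I_(n + (1 + d)) -> M -> @op R n M Z),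
    U m /\ exists a : 'I_(n + (1 + d)) -> M -> R,
    [/\ local_frame E U e, forall i, smooth_on U (a i) &
       forall y, U y -> s y = \sum_i a i y *: e i y]) -> sec E s.
Proof.
move=> H; apply/secE.
have sE m : fib E m (s m).
  have [U [e [Um [a [[_ _ fe] _ sU]]]]] := H m; rewrite sU//.
  by apply: (fib_sum _ _ (fib0 m) (@fib_lin m)) => i; exact: (fe m Um).1.
split=> //; exists (op_of s).
  apply: OpZ_glue.
    move=> F nF; apply/funext => z; rewrite /op_of.
    have [D [[D0 _] _] ->] := fibE_RZ (sE (zeta z)).
    by rewrite /field_of asboolT// D0.
  move=> m; have [U [e [Um [a [[oU es fe] as_ sU]]]]] := H m.
  have eP i : exists D, OpZ D /\ e i = field_of D.
    by have /secE[[D DO eD] _] := es i; exists D.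
  have [D DP] := choice eP.
  have [phi [pC [U' [oU' U'm U'U U'1]] [C [cC CU C0]]]] := exists_bump oU Um.
  have aC i : Cinf (fun y => phi y * a i y).
    apply: (smooth_on_ext0 (@openT M) oU cC CU _ (fun _ _ => erefl)).
      rewrite setTI; apply: smooth_onM => //; exact: smooth_on_subset pC.
    by move=> y nC; rewrite C0// mul0r.
  exists U', (opsum (index_enum _) (fun i y => phi y * a i y) D); split=> //.
    by apply: OpZ_opsum => // i; exact: (DP i).1.
  move=> F z FC U'z; rewrite /op_of sU; last exact: U'U.
  rewrite -[in RHS](op_ofK (opsum _ _ _)) /op_of field_of_opsum.
  congr (_ F z); apply: eq_bigr => i _.
  by rewrite U'1// mul1r (DP i).2.
apply/funext => m; apply/funext => F; apply/funext => z; rewrite /field_of /op_of.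
case: asboolP => [->//|nz]; have [D _ ->] := fibE_RZ (sE m).
by rewrite /field_of asboolF.
Qed.

Lemma vector_bundle_span : vector_bundle (n + (1 + d)) E.
Proof.
apply: vector_bundle_of_frames; [exact: fib0|exact: fib_lin|exact: exists_frame|exact:
  sec_of_frames].
Qed.

End Frames.

(** * Lie algebroid and Lie affgebroid structures *)

Section AlgebroidTheory.
Context {R : realType} {n : nat} {M : manifold R n} {W : lmodType R}.
Implicit Types (E A V H : @bundle R n M W) (f : M -> R) (X Y : M -> W).

Section Brackets.
Variables (E : @bundle R n M W) (br : (M -> W) -> (M -> W) -> (M -> W))
  (rho : M -> W -> (M -> R) -> R).
Hypothesis LE : lie_algebroid E br rho.
Hypothesis sec_lin : forall (t : R) X Y, sec E X -> sec E Y -> sec E (t *: X + Y).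
Hypothesis sec0 : sec E 0.

Let brL t X Y X' : sec E X -> sec E Y -> sec E X' ->
  br (t *: X + Y) X' = t *: br X X' + br Y X'.
Proof. by case: LE => _ [_ + _ _] _ _; apply. Qed.

Lemma br_skew X Y : sec E X -> sec E Y -> br X Y = - br Y X.
Proof. by case: LE => _ [_ _ + _] _ _; apply. Qed.

Lemma br0l X : sec E X -> br 0 X = 0.
Proof.
move=> sX; have := brL 1 sec0 sec0 sX; rewrite scaler0 addr0 scale1r => /eqP.
by rewrite -subr_eq0 opprD addrA subrr sub0r oppr_eq0 => /eqP.
Qed.

Lemma brDl X Y X' : sec E X -> sec E Y -> sec E X' -> br (X + Y) X' = br X X' + br Y X'.
Proof. by move=> sX sY sX'; rewrite -[X in LHS]scale1r brL// scale1r. Qed.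

Lemma brZl t X X' : sec E X -> sec E X' -> br (t *: X) X' = t *: br X X'.
Proof. by move=> sX sX'; rewrite -[t *: X]addr0 brL// br0l// addr0. Qed.

Lemma sec_scale t X : sec E X -> sec E (t *: X).
Proof. by move=> sX; rewrite -[t *: X]addr0; exact: sec_lin. Qed.

Lemma sec_add X Y : sec E X -> sec E Y -> sec E (X + Y).
Proof. by move=> sX sY; rewrite -[X]scale1r; exact: sec_lin. Qed.

Lemma brDr X Y X' : sec E X -> sec E Y -> sec E X' -> br X' (X + Y) = br X' X + br X' Y.
Proof.
move=> sX sY sX'; rewrite br_skew ?brDl//; last exact: sec_add.
by rewrite opprD -!br_skew.
Qed.

Lemma brZr t X X' : sec E X -> sec E X' -> br X' (t *: X) = t *: br X' X.
Proof.
move=> sX sX'; rewrite br_skew ?brZl//; last exact: sec_scale.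
by rewrite -scalerN -br_skew.
Qed.

Lemma br_leibniz X Y f : sec E X -> sec E Y -> Cinf f ->
  br X (fun m => f m *: Y m) = (fun m => f m *: br X Y m + rho m (X m) f *: Y m).
Proof. by case: LE => _ _ _; apply. Qed.

(** For a biadditive bracket the dependence on [s'] cancels, which reduces the Jacobi and Leibniz
    identities of an affgebroid to those of the algebroid. *)
Lemma linear_partE s s' X : sec E s -> sec E s' -> sec E X ->
  linear_part br s' s X = br s X.
Proof. by move=> ss ss' sX; rewrite /linear_part brDr// addrC addKr. Qed.

Lemma rho0 m f : fib E m 0 -> Cinf f -> rho m 0 f = 0.
Proof.
move=> E0 fC; case: LE => _ _ [_ rl _] _; have := rl m 1 0 0 f E0 E0 fC.
by rewrite scaler0 addr0 mul1r => /eqP; rewrite -subr_eq0 opprD addrA subrr sub0r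
  oppr_eq0 => /eqP.
Qed.

Lemma rho_lin m (t : R) v w f : fib E m v -> fib E m w -> Cinf f ->
  rho m (t *: v + w) f = t * rho m v f + rho m w f.
Proof. by case: LE => _ _ [_ + _] _; apply. Qed.

End Brackets.

(* Every section of H is f s0 + v with v a section of V, and x is a nowhere
   vanishing section of V: the bracket on affine sections determines the bracket
   of an affine section with f x, hence the anchor, hence everything. *)
Lemma hull_unique (H A V : @bundle R n M W) (s0 x : M -> W)
    (br br' : (M -> W) -> (M -> W) -> (M -> W)) (rho rho' : M -> W -> (M -> R) -> R) :
  lie_algebroid H br rho -> lie_algebroid H br' rho' ->
  (forall (t : R) X Y, sec H X -> sec H Y -> sec H (t *: X + Y)) -> sec H 0 ->
  (forall X m, sec H X -> fib H m (X m)) ->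
  (forall m v, fib H m v -> exists2 X, sec H X & v = X m) ->
  (forall v, sec V v -> sec H v) -> (forall s, sec A s -> sec H s) -> sec A s0 ->
  (forall v, sec V v -> sec A (s0 + v)) ->
  (forall f v, Cinf f -> sec V v -> sec V (fun m => f m *: v m)) ->
  (forall X, sec H X -> exists f v, [/\ Cinf f, sec V v & X = (fun m => f m *: s0 m) +
    v]) ->
  sec V x -> (forall m, x m <> 0) ->
  (forall s s', sec A s -> sec A s' -> br' s s' = br s s') ->
  (forall X Y, sec H X -> sec H Y -> br' X Y = br X Y) /\
  (forall m v f, fib H m v -> Cinf f -> rho' m v f = rho m v f).
Proof.
move=> L L' Hlin H0 Hfib Hext VH AH As0 AV Vf dec Vx x0 ext.
have Hs0 := AH _ As0.
have brAV s v : sec A s -> sec V v -> br' s v = br s v.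
  move=> As Vv; have e := ext s (s0 + v) As (AV v Vv).
  move: e; rewrite (brDr L' Hlin)//; [|exact: VH|exact: AH].
  rewrite (brDr L Hlin)//; [|exact: VH|exact: AH].
  by rewrite ext// => /addrI.
have brVV v w : sec V v -> sec V w -> br' v w = br v w.
  move=> Vv Vw; have := brAV (s0 + v) w (AV v Vv) Vw.
  rewrite (brDl L')//; [|exact: VH|exact: VH].
  rewrite (brDl L)//; [|exact: VH|exact: VH].
  by rewrite brAV// => /addrI.
have rhoA s m f : sec A s -> Cinf f -> rho' m (s m) f = rho m (s m) f.
  move=> As fC; have Vfx := Vf f x fC Vx.
  have := brAV s _ As Vfx.
  rewrite (br_leibniz L')//; [|exact: AH|exact: VH].
  rewrite (br_leibniz L)//; [|exact: AH|exact: VH].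
  move=> /(congr1 (fun h => h m)); rewrite brAV// => /addrI /eqP.
  rewrite -subr_eq0 -scalerBl scaler_eq0 => /orP[|/eqP/x0//].
  by rewrite subr_eq0 => /eqP.
have rhoV v m f : sec V v -> Cinf f -> rho' m (v m) f = rho m (v m) f.
  move=> Vv fC; have := rhoA _ m f (AV v Vv) fC.
  rewrite -[(s0 + v) m]/(s0 m + v m) -[s0 m in X in X -> _]scale1r.
  have f1 := Hfib _ m Hs0; have f2 := Hfib _ m (VH _ Vv).
  rewrite (rho_lin L' 1 f1 f2 fC) (rho_lin L 1 f1 f2 fC) rhoA//.
  by move/addrI.
have rhoH X m f : sec H X -> Cinf f -> rho' m (X m) f = rho m (X m) f.
  move=> HX fC; have [g [v [gC Vv ->]]] := dec X HX.
  rewrite -[(_ + v) m]/(g m *: s0 m + v m).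
  have f1 := Hfib _ m Hs0; have f2 := Hfib _ m (VH _ Vv).
  by rewrite (rho_lin L' _ f1 f2 fC) (rho_lin L _ f1 f2 fC) rhoA// rhoV.
(* For fixed [X], agreement on [s0] and on [V] spreads to all of [H] by the Leibniz rule, the
   anchors being already known to agree. It is used for [s0], then for sections of [V], and by
   skew-symmetry for every [X]. *)
have step X : sec H X -> br' X s0 = br X s0 -> (forall v, sec V v -> br' X v = br X v) ->
    forall Y, sec H Y -> br' X Y = br X Y.
  move=> HX e0 eV Y HY; have [g [v [gC Vv YE]]] := dec Y HY.
  have Hv := VH _ Vv.
  have Hg : sec H (fun m => g m *: s0 m).
    have -> : (fun m => g m *: s0 m) = (-1) *: v + Y.
      by rewrite YE scaleN1r addrC addrK.
    exact: Hlin.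
  rewrite YE (brDr L' Hlin)// (brDr L Hlin)// (br_leibniz L')// (br_leibniz L)//.
  rewrite e0 eV//; congr (_ + _); apply/funext => m.
  by rewrite rhoH.
have br_s0 := step s0 Hs0 (ext _ _ As0 As0) (brAV s0 ^~ As0).
have br_V v (Vv : sec V v) : forall Y, sec H Y -> br' v Y = br v Y.
  apply: (step v (VH _ Vv)) => [|w Vw]; last exact: brVV.
  have Hv := VH _ Vv.
  by rewrite (br_skew L')// brAV// -(br_skew L).
split=> [X Y HX HY|m v f Hv fC].
  apply: (step X HX) => // [|v Vv].
    by rewrite (br_skew L')// br_s0// -(br_skew L).
  have Hv := VH _ Vv.
  by rewrite (br_skew L')// br_V// -(br_skew L).
by have [X HX ->] := Hext m v Hv; exact: rhoH.
Qed.

End AlgebroidTheory.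

(** * The commutator bracket on sections of [RZ] and its subbundles *)

Section SpanAlgebroid.
Context {R : realType} {n : nat} {M : manifold R n} {Z : avbundle M}.
Implicit Types (D : @op R n M Z) (f : M -> R).

Lemma sec_RZ_field D : OpZ D -> sec (RZ Z) (field_of D).
Proof. by move=> DO; exists D. Qed.

Lemma field_of_M f D : (fun m => f m *: field_of D m) = field_of (fun F => Ffun f * D F :
  Z -> R).
Proof.
apply/funext => m; rewrite -[LHS]addr0 -(@field_of_zero R n M Z m) -field_of_comb.
by congr (field_of _ m); apply/funext => F; rewrite addr0.
Qed.

Lemma op_commutator_lin (t : R) D D' D'' : OpZ D -> OpZ D' -> OpZ D'' ->
  op_commutator Z (t *: field_of D + field_of D') (field_of D'') =
  t *: op_commutator Z (field_of D) (field_of D'') + op_commutator Z (field_of D')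
    (field_of D'').
Proof.
move=> [Df _] [Df' _] [Df'' _].
rewrite -field_of_lin !op_commutator_field -field_of_lin; congr field_of.
apply/funext => F; apply/funext => z.
rewrite -[(t *: D + D') F]/(t *: D F + D' F).
rewrite (fo_linear t Df'' (fo_CinfZ F Df) (fo_CinfZ F Df')).
rewrite -[LHS]/(t * D (D'' F) z + D' (D'' F) z - (t * D'' (D F) z + D'' (D' F) z)).
by rewrite -[RHS]/(t * (D (D'' F) z - D'' (D F) z) + (D' (D'' F) z - D'' (D' F) z)); ring.
Qed.

Lemma op_commutator_skew s s' : op_commutator Z s s' = - op_commutator Z s' s.
Proof.
apply/funext => m; apply/funext => F; apply/funext => z.
rewrite -[RHS]/(- op_commutator Z s' s m F z) /op_commutator /field_of.
by case: asboolP => _; [rewrite opprB|rewrite oppr0].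
Qed.

Lemma op_commutator_jacobi D D' D'' : OpZ D -> OpZ D' -> OpZ D'' ->
  let X := field_of D in let Y := field_of D' in let X' := field_of D'' in
  op_commutator Z X (op_commutator Z Y X') + op_commutator Z Y (op_commutator Z X' X) +
  op_commutator Z X' (op_commutator Z X Y) = 0.
Proof.
move=> [Df _] [Df' _] [Df'' _] X Y X'.
rewrite /X /Y /X' !op_commutator_field.
apply/funext => m; apply/funext => F; apply/funext => z.
set a1 := field_of _; set a2 := field_of _; set a3 := field_of _.
rewrite -[LHS]/(a1 m F z + a2 m F z + a3 m F z) -[RHS]/(0 : R) /a1 /a2 /a3 /field_of.
case: asboolP => _; last by rewrite !addr0.
rewrite (foB Df (fo_CinfZ _ Df') (fo_CinfZ _ Df'')) (foB Df' (fo_CinfZ _ Df'') (fo_CinfZ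
  _ Df)).
rewrite (foB Df'' (fo_CinfZ _ Df) (fo_CinfZ _ Df')).
have rg (u u' v v' w w' : R) :
  u - u' - (v - v') + (v - w - (w' - u')) + (w' - v' - (u - w)) = 0 by ring.
exact: rg.
Qed.

End SpanAlgebroid.

Section SpanBundle.
Context {R : realType} {n : nat} {M : manifold R n} {Z : avbundle M}.
Variables (sigma : M -> Z) (ss : SecZ sigma).
Variables (d : nat) (kE kI lE lI : 'I_d -> R).
Hypothesis klE : forall i j, lE i * kE j + lI i * kI j = (i == j)%:R.
Local Notation S := (in_span kE kI lE lI).

Variable E : @bundle R n M (@op R n M Z).
Hypothesis fibE : forall m v, fib E m v <->
  fib (RZ Z) m v /\ S (- phi0 m v) (phi1 m v).
Hypothesis secE : forall s, sec E s <-> sec (RZ Z) s /\ forall m, fib E m (s m).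

Lemma sec_field s : sec E s <-> exists D, [/\ OpZ D, s = field_of D &
  forall m, S (- opalpha sigma D m) (opgamma sigma D m)].
Proof.
split=> [/secE[[D DO sD] sE]|[D [DO -> DS]]].
  by exists D; split=> // m; apply/(fib_field ss fibE m DO); rewrite -sD.
apply/secE; split; first exact: sec_RZ_field.
by move=> m; apply/(fib_field ss fibE m DO).
Qed.

Lemma sec_span_lin (t : R) X Y : sec E X -> sec E Y -> sec E (t *: X + Y).
Proof.
move=> /sec_field[D [DO -> DS]] /sec_field[D' [DO' -> DS']]; apply/sec_field.
exists (t *: D + D'); split; [exact: OpZ_lin|by rewrite field_of_lin|] => m.
have tC : Cinf (cst t : M -> R) by exact: Cinf_cst.
rewrite (opalpha_comb ss m DO DO' tC) (opgamma_comb ss) opprD -mulrN.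
exact: in_span_lin.
Qed.

Lemma sec_span0 : sec E 0.
Proof.
apply/sec_field; exists (fun _ => 0); split; first exact: OpZ_zero.
  by apply/funext => m; rewrite field_of_zero.
move=> m; have [-> -> _ _] := @op_zero_parts R n M Z sigma m.
by rewrite oppr0; exact: in_span0.
Qed.

Lemma sec_span_fib X m : sec E X -> fib E m (X m).
Proof. by move=> /secE[]. Qed.

Lemma sec_span_M f X : Cinf f -> sec E X -> sec E (fun m => f m *: X m).
Proof.
move=> fC /sec_field[D [DO -> DS]]; apply/sec_field.
have O0 := @OpZ_zero R n M Z.
exists (fun F => Ffun f * D F + 0); split; first exact: OpZ_comb DO O0 fC.
  rewrite field_of_M; congr field_of; apply/funext => F; by rewrite addr0.
move=> m; have [z1 z2 _ _] := @op_zero_parts R n M Z sigma m.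
rewrite (opalpha_comb ss m DO O0 fC) (opgamma_comb ss) z1 z2 opprD oppr0 -mulrN.
by apply: in_span_lin => //; exact: in_span0.
Qed.

Lemma opsymbol_lin2 D (a b : M -> R) (u v : R) m : OpZ D -> Cinf a -> Cinf b ->
  opsymbol sigma D (u *: a + v *: b) m = u * opsymbol sigma D a m + v * opsymbol sigma D
    b m.
Proof.
move=> DO aC bC.
have vC : Cinf (v *: b) by exact: CinfM (Cinf_cst v) bC.
have c0 : Cinf (cst 0 : M -> R) by exact: Cinf_cst.
rewrite (opsymbol_lin sigma DO)//; congr (_ + _).
rewrite (_ : v *: b = v *: b + cst 0); last by apply/funext => y; rewrite addr0.
by rewrite (opsymbol_lin sigma DO)// (opsymbol_cst sigma DO) addr0.
Qed.

(** The condition is linear with constant coefficients, and [opsymbol sigma D] is linear, so it can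
    be applied to both equations. *)
Lemma in_span_symbol D (a b : M -> R) m : OpZ D -> Cinf a -> Cinf b ->
  (forall m, S (a m) (b m)) -> S (opsymbol sigma D a m) (opsymbol sigma D b m).
Proof.
move=> DO aC bC ab.
have e (k : 'I_d -> R) x y : \sum_j (lE j * x + lI j * y) * k j =
    (\sum_j lE j * k j) * x + (\sum_j lI j * k j) * y.
  by rewrite !mulr_suml -big_split /=; apply: eq_bigr => j _; ring.
have ea : a = (\sum_j lE j * kE j) *: a + (\sum_j lI j * kE j) *: b.
  by apply/funext => y; rewrite [LHS](ab y).1 e.
have eb : b = (\sum_j lE j * kI j) *: a + (\sum_j lI j * kI j) *: b.
  by apply/funext => y; rewrite [LHS](ab y).2 e.
by split; rewrite e -opsymbol_lin2// -?ea -?eb.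
Qed.

Lemma opsymbolN D (a : M -> R) m : OpZ D -> Cinf a ->
  opsymbol sigma D (- a) m = - opsymbol sigma D a m.
Proof.
move=> DO aC; rewrite (_ : - a = (-1) *: a + 0 *: a).
  by rewrite opsymbol_lin2// mul0r addr0 mulN1r.
by rewrite scale0r addr0 scaleN1r.
Qed.

Lemma op_commutator_parts D D' : OpZ D -> OpZ D' ->
  let C : @op R n M Z := fun F => D (D' F) - D' (D F) in forall m,
  opalpha sigma C m = opsymbol sigma D (opalpha sigma D') m - opsymbol sigma D' (opalpha
    sigma D) m /\
  opgamma sigma C m = opsymbol sigma D (opgamma sigma D') m - opsymbol sigma D' (opgamma
    sigma D) m.
Proof.
move=> DO DO' C m; split; [exact: opalpha_commutator|exact: opgamma_commutator].
Qed.

Lemma sec_span_commutator X Y : sec E X -> sec E Y -> sec E (op_commutator Z X Y).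
Proof.
move=> /sec_field[D [DO -> DS]] /sec_field[D' [DO' -> DS']]; apply/sec_field.
exists (fun F => D (D' F) - D' (D F)); split; [exact: OpZ_commutator|exact:
  op_commutator_field|] => m.
have [-> ->] := op_commutator_parts DO DO' m.
have aC := Cinf_opalpha ss DO; have gC := Cinf_opgamma ss DO.
have aC' := Cinf_opalpha ss DO'; have gC' := Cinf_opgamma ss DO'.
have h1 := in_span_symbol m DO (CinfN aC') gC' DS'.
have h2 := in_span_symbol m DO' (CinfN aC) gC DS.
rewrite opsymbolN// in h1; rewrite opsymbolN// in h2.
have h := in_span_lin (-1) h2 h1; rewrite !mulN1r opprK [- _ + _]addrC in h.
by rewrite opprB.
Qed.

Lemma lie_algebroid_span : lie_algebroid E (op_commutator Z) (anchor Z).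
Proof.
split.
- by exists (n + (1 + d))%N; exact: (vector_bundle_span ss klE fibE secE).
- split; first exact: sec_span_commutator.
  + move=> t X Y X' /sec_field[D [DO -> _]] /sec_field[D' [DO' -> _]] /sec_field[D''
    [DO'' -> _]].
    exact: op_commutator_lin.
  + by move=> X Y _ _; exact: op_commutator_skew.
  + move=> X Y X' /sec_field[D [DO -> _]] /sec_field[D' [DO' -> _]] /sec_field[D'' [DO''
    -> _]].
    exact: op_commutator_jacobi.
- split.
  + move=> m v /fibE[[D DO ->] _]; split=> [t f g fC gC|f g fC gC].
      rewrite !(anchor_field ss DO)//; first exact: opsymbol_lin.
      by apply: CinfD => //; exact: CinfM (Cinf_cst t) fC.
    rewrite !(anchor_field ss DO)//; first exact: opsymbolM.
    exact: CinfM.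
  + move=> m t v w f /fibE[[D DO ->] _] /fibE[[D' DO' ->] _] fC.
    rewrite -[t in t *: _]/(cst t m) -(field_of_comb (cst t)).
    have tC : Cinf (cst t : M -> R) by exact: Cinf_cst.
    rewrite (anchor_field ss DO)// (anchor_field ss DO')//.
    by rewrite (anchor_field ss (OpZ_comb DO DO' tC))// (opsymbol_comb ss).
  + move=> s f /sec_field[D [DO -> _]] fC.
    rewrite (_ : (fun m => _) = opsymbol sigma D f); first exact: Cinf_opsymbol.
    by apply/funext => m; rewrite (anchor_field ss DO).
- move=> X Y f /sec_field[D [DO -> _]] /sec_field[D' [DO' -> _]] fC.
  have [Df _] := DO; have [Df' _] := DO'.
  rewrite field_of_M !op_commutator_field; apply/funext => m.
  rewrite (anchor_field ss DO)//; apply/funext => F; apply/funext => z.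
  set B := (X in _ = (f m *: field_of X m + _) F z).
  rewrite -[RHS]/(f m * field_of B m F z + opsymbol sigma D f m * field_of D' m F z).
  rewrite /field_of; case: asboolP => [zm|_]; last by rewrite !mulr0 addr0.
  rewrite (op_FfunM ss DO fC (fo_CinfZ F Df')) /B -zm.
  rewrite -[LHS]/(f (zeta z) * D (D' F) z + opsymbol sigma D f (zeta z) * D' F z -
     f (zeta z) * D' (D F) z).
  by rewrite -[X in _ = _ * X + _]/(D (D' F) z - D' (D F) z); ring.
Qed.

Lemma fib_extends m v : fib E m v -> exists2 X, sec E X & v = X m.
Proof.
move=> Ev; have [U [e [fe Um _]]] := exists_frame ss klE fibE secE m.
case: fe => _ es /(_ m Um)[_ /(_ v Ev)[a [-> _]]].
exists (\sum_i a 0 i *: e i).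
  elim/big_rec : _ => [|i x _ sx]; first exact: sec_span0.
  by apply: sec_span_lin.
elim/big_rec2 : _ => [//|i x y _ ->]; by [].
Qed.

End SpanBundle.

Lemma bundle_eq {R : realType} {n : nat} {M : manifold R n} {W : lmodType R}
    (E A : @bundle R n M W) : (forall m v, fib E m v <-> fib A m v) ->
  (forall s, sec E s <-> sec A s) -> E = A.
Proof.
case: E A => fE sE [fA sA] /= fibE secE; congr Bundle.
  by apply/funext => m; apply/seteqP; split=> v /fibE.
by apply/seteqP; split=> s /secE.
Qed.

(** * [RZ] as the preimage of the whole plane *)

Section RZSpan.
Context {R : realType} {n : nat} {M : manifold R n} (Z : avbundle M).

Definition unit0 (j : 'I_2) : R := (j == ord0)%:R.
Definition unit1 (j : 'I_2) : R := (j == ord_max)%:R.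

Lemma unit_dual i j : unit0 i * unit0 j + unit1 i * unit1 j = (i == j)%:R.
Proof.
rewrite /unit0 /unit1.
by case: i j => [[|[|//]] ?] [[|[|//]] ?]; rewrite -!(inj_eq val_inj) /= ?mulr0 ?mul0r
  ?mulr1 ?addr0 ?add0r.
Qed.

Lemma in_span_full a b : in_span unit0 unit1 unit0 unit1 a b.
Proof.
by split; rewrite big_ord_recl big_ord1 /unit0 /unit1 -!(inj_eq val_inj) /=;
  rewrite ?mulr0 ?mul0r ?mulr1 ?mul1r ?addr0 ?add0r.
Qed.

Lemma fib_RZ_full m v : fib (RZ Z) m v <-> fib (RZ Z) m v /\
  in_span unit0 unit1 unit0 unit1 (- phi0 m v) (phi1 m v).
Proof. by split=> [h|[]//]; split=> //; exact: in_span_full. Qed.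

Lemma sec_RZ_fib s : sec (RZ Z) s <-> sec (RZ Z) s /\ forall m, fib (RZ Z) m (s m).
Proof. by split=> [[D DO ->]|[]//]; split=> [|m]; exists D. Qed.

End RZSpan.

(** * Operators and sections of the AV-bundle *)

Section SectionsOfZ.
Context {R : realType} {n : nat} {M : manifold R n} {Z : avbundle M}.
Implicit Types (sigma tau : M -> Z) (D : @op R n M Z) (f : M -> R).

Lemma SecZ_add sigma f : SecZ sigma -> Cinf f -> SecZ (fun m => zadd (sigma m) (f m)).
Proof.
move=> [sz sS] fC; split=> [m|t lt]; first by rewrite zeta_add.
have ot := @ltriv_open _ _ _ _ _ lt.
have fs : smooth_on t.1 f by exact: smooth_on_subset fC.
apply: eq_smooth_on (smooth_onD ot (sS _ lt) fs) => // m tm.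
by rewrite zsub_addl// sz ltriv_sec.
Qed.

Lemma Fsec_add sigma f : SecZ sigma ->
  Fsec (fun m => zadd (sigma m) (f m)) = Fsec sigma + Ffun f.
Proof. by move=> [sz _]; apply/funext => z; rewrite /Fsec zsub_addl ?sz. Qed.

Lemma Cinf_zsub sigma tau : SecZ sigma -> SecZ tau -> Cinf (fun m => zsub (sigma m) (tau
  m)).
Proof. by move=> ss ts; have := Cinf_comp_sec (CinfZ_Fsec ss) ts; rewrite /Fsec /comp;
  congr Cinf; apply/funext => m; rewrite ts.1. Qed.

Lemma Ffun_zsub sigma tau : SecZ sigma -> SecZ tau ->
  Ffun (fun m => zsub (sigma m) (tau m)) = Fsec sigma - Fsec tau :> (Z -> R).
Proof.
move=> ss ts; apply/funext => z; rewrite -[RHS]/(Fsec sigma z - Fsec tau z) /Ffun /Fsec.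
rewrite [zsub (sigma _) z](@zsub_trans _ _ _ _ _ (tau (zeta z))) ?ss.1 ?ts.1//.
by rewrite addrAC subrr add0r.
Qed.

Lemma Fsec_inj sigma tau : (forall m, zeta (sigma m) = m) -> (forall m, zeta (tau m) = m) ->
  Fsec sigma = Fsec tau -> sigma = tau.
Proof.
move=> sz tz e; apply/funext => m; have := congr1 (fun F => F (tau m)) e.
rewrite /Fsec tz zsubxx => e0; rewrite -(@zsubK _ _ _ _ (tau m) (sigma m)) ?sz ?tz//.
by rewrite e0 zadd0.
Qed.

(** Translating [sigma] by [f] adds [Ffun f] to [Fsec sigma], so the values on sections also give
    the values on functions of the base; together these determine the operator. *)
Lemma op_eq_on_sections D D' : OpZ D -> OpZ D' ->
  (forall sigma, SecZ sigma -> D (Fsec sigma) = D' (Fsec sigma)) -> D = D'.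
Proof.
move=> [Df _] [Df' _] DD; have [sigma ss] := exists_section Z.
have DF f : Cinf f -> D (Ffun f) = D' (Ffun f).
  move=> fC; have := DD _ (SecZ_add ss fC); rewrite (Fsec_add _ ss).
  rewrite (foD Df (CinfZ_Fsec ss) (CinfZ_Ffun fC)) (foD Df' (CinfZ_Fsec ss) (CinfZ_Ffun
    fC)).
  by rewrite DD// => /addrI.
apply/funext => F; apply/funext => z.
have sub_eq (a b : R) : -1 * a + b = 0 -> a = b.
  by rewrite mulN1r addrC => /eqP; rewrite subr_eq0 => /eqP.
apply: sub_eq; apply: (fo_determined F (fo_lin (-1) Df Df') ss) => [f fC|].
  by rewrite -[LHS]/(-1 * D (Ffun f) z + D' (Ffun f) z) DF//; ring.
by rewrite -[LHS]/(-1 * D (Fsec sigma) z + D' (Fsec sigma) z) DD//; ring.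
Qed.

End SectionsOfZ.

(** * The affine bundle [A] modelled on [V], and its hull [H] *)

Section AffineBundle.
Context {R : realType} {n : nat} {M : manifold R n} {Z : avbundle M}.
Implicit Types (tau : M -> Z) (D : @op R n M Z).
Variables (sigma : M -> Z) (ss : SecZ sigma).
Variables (d : nat) (kE kI lE lI : 'I_d -> R).
Hypothesis klE : forall i j, lE i * kE j + lI i * kI j = (i == j)%:R.
Local Notation S := (in_span kE kI lE lI).
Variables (d' : nat) (kE' kI' lE' lI' : 'I_d' -> R).
Hypothesis klE' : forall i j, lE' i * kE' j + lI' i * kI' j = (i == j)%:R.
Local Notation S' := (in_span kE' kI' lE' lI').
Variables V A H : @bundle R n M (@op R n M Z).
Hypothesis fibV : forall m v, fib V m v <-> fib (RZ Z) m v /\ S (- phi0 m v) (phi1 m v).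
Hypothesis secV : forall s, sec V s <-> sec (RZ Z) s /\ forall m, fib V m (s m).
(** Subtracting 1 from the first coordinate undoes the translation by E, which lies over (1, 0). *)
Hypothesis fibA : forall m v, fib A m v <-> fib (RZ Z) m v /\ S (- phi0 m v - 1) (phi1 m v).
Hypothesis secA : forall s, sec A s <-> sec (RZ Z) s /\ forall m, fib A m (s m).
Hypothesis fibH : forall m v, fib H m v <-> fib (RZ Z) m v /\ S' (- phi0 m v) (phi1 m v).
Hypothesis secH : forall s, sec H s <-> sec (RZ Z) s /\ forall m, fib H m (s m).
(** On [V] this reads [phi1 = phi0], hence on [A] the difference [phi1 - phi0] is 1. This is the
    coefficient of [Fsec tau] in [D (Fsec tau)], so [D (Fsec tau)] is again the function of a
    section. *)
Hypothesis S_sum : forall a b, S a b -> a + b = 0.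
(* H is V plus the line spanned by (1, 0), with projection (a, b) |-> tE a + tI b
   onto that line. *)
Variables tE tI : R.
Hypothesis S'S : forall a b, S' a b -> S (a - (tE * a + tI * b)) b.
Hypothesis SS' : forall a b t, S a b -> S' (a + t) b.

Local Notation s0 := (field_of (euler sigma)).

Lemma fib_fieldA D m : OpZ D -> fib A m (field_of D m) <->
  S (- opalpha sigma D m - 1) (opgamma sigma D m).
Proof.
move=> DO; rewrite -(phi0_field ss DO) -(phi1_field ss DO); split; first by move=> /fibA[].
by move=> h; apply/fibA; split=> //; exists D.
Qed.

Lemma sec_fieldA s : sec A s <-> exists D, [/\ OpZ D, s = field_of D &
  forall m, S (- opalpha sigma D m - 1) (opgamma sigma D m)].
Proof.
split=> [/secA[[D DO sD] sE]|[D [DO -> DS]]].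
  by exists D; split=> // m; apply/(fib_fieldA m DO); rewrite -sD.
apply/secA; split; first exact: sec_RZ_field.
by move=> m; apply/(fib_fieldA m DO).
Qed.

Lemma sec_euler : sec A s0.
Proof.
apply/sec_fieldA; exists (euler sigma); split=> // [|m]; first exact: OpZ_euler.
have [-> -> _ _] := euler_parts ss m.
by rewrite opprK subrr; exact: in_span0.
Qed.

Lemma sec_XZ : sec V (field_of (XZ Z)).
Proof.
apply/(sec_field ss fibV secV); exists (XZ Z); split=> // [|m]; first exact: OpZ_XZ.
by have [-> -> _ _] := XZ_parts ss m; rewrite oppr0; exact: in_span0.
Qed.

Lemma field_XZ_neq0 m : field_of (XZ Z) m <> 0.
Proof.
move=> /(congr1 (fun v : @op R n M Z => v (Fsec sigma) (sigma m))).
rewrite /field_of asboolT; last exact: ss.1.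
by rewrite XZ_Fsec// => /eqP; rewrite -[1 _]/(1 : R) -[X in _ == X]/(0 : R) oner_eq0.
Qed.

Lemma fib_A_translate m w : fib A m w <-> fib V m (w - s0 m).
Proof.
have Oe := OpZ_euler ss; have [g0 a0 _ _] := euler_parts ss m.
have c1 : Cinf (cst (-1) : M -> R) by exact: Cinf_cst.
have c2 : Cinf (cst 1 : M -> R) by exact: Cinf_cst.
split=> [/[dup] /fibA[[D DO ->] _] /(fib_fieldA m DO) h|].
  rewrite addrC -scaleN1r -[-1 in X in X *: _]/(cst (-1) m) -field_of_comb.
  apply/(fib_field ss fibV m (OpZ_comb Oe DO c1)).
  rewrite (opalpha_comb ss m Oe DO c1) (opgamma_comb ss) g0 a0 mulr0 add0r.
  by rewrite opprD /= mulN1r opprK addrC.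
move=> /[dup] /fibV[[D DO e] _]; rewrite e => /(fib_field ss fibV m DO) h.
have -> : w = field_of (fun F => Ffun (cst 1) * euler sigma F + D F : Z -> R) m.
  by rewrite field_of_comb scale1r -e addrC subrK.
apply/(fib_fieldA m (OpZ_comb Oe DO c2)).
rewrite (opalpha_comb ss m Oe DO c2) (opgamma_comb ss) g0 a0 mulr0 add0r mul1r.
by rewrite opprD opprK addrAC subrr add0r.
Qed.

Lemma sec_A_add v : sec V v -> sec A (s0 + v).
Proof.
move=> /secV[Rv Fv]; have /secA[Re _] := sec_euler; apply/secA; split.
  have [D DO ->] := Re; have [D' DO' ->] := Rv.
  exists (1 *: D + D'); first exact: OpZ_lin.
  by rewrite field_of_lin scale1r.
by move=> m; apply/fib_A_translate; rewrite -[(s0 + v) m]/(s0 m + v m) addrC addKr.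
Qed.

Lemma affine_subbundle_span (E : @bundle R n M (@op R n M Z)) :
  (forall s, sec E s <-> sec (RZ Z) s /\ forall m, fib E m (s m)) ->
  (forall m v, fib V m v -> fib E m v) -> (forall m v, fib A m v -> fib E m v) ->
  affine_subbundle E A V.
Proof.
move=> secE VE AE; have /secA[Re Fe] := sec_euler; split.
- by exists (n + (1 + d))%N; exact: (vector_bundle_span ss klE fibV secV).
- apply: bundle_eq => // s; split.
    by move=> /secV[sR sV]; split=> //; apply/secE; split=> // m; exact: VE.
  by move=> [/secE[sR _] sV]; apply/secV.
- apply: bundle_eq => // s; split.
    by move=> /secA[sR sA]; split=> //; apply/secE; split=> // m; exact: AE.
  by move=> [/secE[sR _] sA]; apply/secA.
- move=> m; exists setT, s0; split=> //; first exact: openT.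
    by apply/secE; split=> // y; exact: AE.
  by move=> y _; apply/seteqP; split=> w /fib_A_translate.
Qed.

Lemma special_affine_span :
  special_affine_subbundle (RZ Z) A V (field_of (XZ Z)).
Proof.
split; [|exact: sec_XZ|exact: field_XZ_neq0].
apply: affine_subbundle_span; first exact: sec_RZ_fib.
  by move=> m v /fibV[].
by move=> m v /fibA[].
Qed.

Lemma op_Fsec_A D tau : OpZ D -> (forall m, fib A m (field_of D m)) -> SecZ tau ->
  D (Fsec tau) = Ffun (opbeta tau D) + Fsec tau.
Proof.
move=> DO DA ts; rewrite (op_Fsec ts DO) (_ : _ - _ = cst 1).
  by congr (_ + _); apply/funext => z; rewrite -[LHS]/(1 * Fsec tau z) mul1r.
apply/funext => m; have /fibA[_ /S_sum] := DA m.
rewrite (phi0_field ts DO) (phi1_field ts DO) => e.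
rewrite -[LHS]/(opgamma tau D m - opalpha tau D m) -[RHS]/(1 : R); lra.
Qed.

Lemma act_field D tau : act (field_of D) tau = fun m => zadd (tau m) (opbeta tau D m).
Proof. by rewrite /act op_ofK. Qed.

Lemma act_A D tau : OpZ D -> (forall m, fib A m (field_of D m)) -> SecZ tau ->
  SecZ (act (field_of D) tau) /\ Fsec (act (field_of D) tau) = D (Fsec tau).
Proof.
move=> DO DA ts; rewrite act_field; split; first exact: SecZ_add ts (Cinf_opbeta ts DO).
by rewrite (Fsec_add _ ts) (op_Fsec_A DO DA ts) addrC.
Qed.

(** A section is determined by its function [Fsec], and affine combinations of sections correspond
    to those of functions, on which operators are linear. *)
Lemma affine_maps_span : affine_maps_on_SecZ A.
Proof.
split.
- by move=> s tau /secA[[D DO ->] DA] ts; rewrite op_ofK; exact: act_A.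
- move=> s tau tau' t /secA[[D DO ->] DA] ts ts'.
  have zC := Cinf_zsub ts' ts.
  have tC : Cinf (fun m => t * zsub (tau' m) (tau m)).
    by apply: CinfM => //; exact: Cinf_cst.
  have us := SecZ_add ts tC.
  have [a1 e1] := act_A DO DA us; have [a2 e2] := act_A DO DA ts.
  have [a3 e3] := act_A DO DA ts'.
  have F t1 t2 : SecZ t1 -> SecZ t2 ->
     Fsec (fun m => zadd (t1 m) (t * zsub (t2 m) (t1 m))) = t *: (Fsec t2 - Fsec t1) +
       Fsec t1 :> (Z -> R).
    move=> s1 s2; rewrite (Fsec_add _ s1) addrC; congr (_ + _).
    by rewrite -(Ffun_zsub s2 s1).
  apply: Fsec_inj; [exact: a1.1|by move=> m; rewrite zeta_add a2.1|].
  have C1 := CinfZ_Fsec ts; have C2 := CinfZ_Fsec ts'; have [Df _] := DO.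
  by rewrite F// e1 e2 e3 F// (fo_linear t Df (CinfZB C2 C1) C1) (foB Df C2 C1).
- move=> s s' /secA[[D DO ->] DA] /secA[[D' DO' ->] DA'] DD.
  congr field_of; apply: op_eq_on_sections => // tau ts.
  by have [_ <-] := act_A DO DA ts; have [_ <-] := act_A DO' DA' ts; rewrite DD.
Qed.

(** Operators in [OpZ] are determined by their values on the functions [Fsec tau], and there the
    difference of the two composites of [act] is the commutator of the operators. *)
Lemma bracket_is_commutator_span : bracket_is_commutator A V (op_commutator Z).
Proof.
move=> s s' X /secA[[D DO ->] DA] /secA[[D' DO' ->] DA'] /secV[[B BO ->] _].
rewrite op_commutator_field op_ofK.
have E tau : SecZ tau -> Ffun (commutator (field_of D) (field_of D') tau) =
    D (D' (Fsec tau)) - D' (D (Fsec tau)).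
  move=> ts; have [a1 e1] := act_A DO DA ts; have [a2 e2] := act_A DO' DA' ts.
  have [a3 e3] := act_A DO DA a2; have [a4 e4] := act_A DO' DA' a1.
  by rewrite -e1 -e2 -e3 -e4 -Ffun_zsub.
split=> [e tau ts|h].
  by rewrite E// -(op_ofK B) -e op_ofK.
congr field_of; apply: op_eq_on_sections => //; first exact: OpZ_commutator.
by move=> tau ts; rewrite h// E.
Qed.

Lemma sec_A_commutator s s' : sec A s -> sec A s' -> sec V (op_commutator Z s s').
Proof.
move=> /sec_fieldA[D [DO -> DS]] /sec_fieldA[D' [DO' -> DS']].
apply/(sec_field ss fibV secV).
exists (fun F => D (D' F) - D' (D F)); split; [exact: OpZ_commutator|exact:
  op_commutator_field|] => m.
have [-> ->] := op_commutator_parts ss DO DO' m.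
have c1 : Cinf (cst (-1) : M -> R) by exact: Cinf_cst.
(* The shift by 1 that distinguishes [A] from [V] is a constant and is killed by the symbol; hence
   the commutator lands in the model. *)
have N B f : OpZ B -> Cinf f -> opsymbol sigma B (- f + cst (-1)) m = - opsymbol sigma B
  f m.
  move=> BO fC; rewrite (_ : - f + cst (-1) = (-1) *: f + cst (-1)); last by rewrite
    scaleN1r.
  by rewrite (opsymbol_lin sigma BO)// (opsymbol_cst sigma BO) addr0 mulN1r.
have aC := Cinf_opalpha ss DO; have gC := Cinf_opgamma ss DO.
have aC' := Cinf_opalpha ss DO'; have gC' := Cinf_opgamma ss DO'.
have h1 := in_span_symbol sigma m DO (CinfD (CinfN aC') c1) gC' DS'.
have h2 := in_span_symbol sigma m DO' (CinfD (CinfN aC) c1) gC DS.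
rewrite N// in h1; rewrite N// in h2.
have h := in_span_lin (-1) h2 h1; rewrite !mulN1r opprK [- _ + _]addrC in h.
by rewrite opprB.
Qed.

Lemma sec_A_RZ s : sec A s -> sec (RZ Z) s. Proof. by move=> /secA[]. Qed.
Lemma sec_V_RZ s : sec V s -> sec (RZ Z) s. Proof. by move=> /secV[]. Qed.

(** The bracket and anchor are restricted from the Lie algebroid [RZ], and so are the identities;
    that the bracket takes its values in [V] is [sec_A_commutator]. *)
Lemma lie_affgebroid_span :
  lie_affgebroid (RZ Z) A V (op_commutator Z) (anchor Z).
Proof.
have L := lie_algebroid_span ss (@unit_dual R) (@fib_RZ_full _ _ _ Z) (@sec_RZ_fib _ _ _ Z).
have Rlin := sec_span_lin ss (@fib_RZ_full _ _ _ Z) (@sec_RZ_fib _ _ _ Z).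
have R0 := sec_span0 ss (@fib_RZ_full _ _ _ Z) (@sec_RZ_fib _ _ _ Z).
have AR := sec_A_RZ; have VR := sec_V_RZ.
have R_scale t X : sec (RZ Z) X -> sec (RZ Z) (t *: X) by exact: sec_scale Rlin R0 t X.
split; [by case: special_affine_span|exact: sec_A_commutator| | |].
- split.
  + move=> t s1 s2 s /AR h1 /AR h2 /AR h; split.
      rewrite (brDl L (R_scale t _ h1) (R_scale _ _ h2) h).
      by rewrite (brZl L R0 _ h1 h) (brZl L R0 _ h2 h).
    rewrite (brDr L Rlin (R_scale t _ h1) (R_scale _ _ h2) h).
    by rewrite (brZr L Rlin R0 _ h1 h) (brZr L Rlin R0 _ h2 h).
  + by move=> s s' _ _; exact: op_commutator_skew.
  + move=> s' s1 s2 s3 h' h1 h2 h3.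
    have V1 := VR _ (sec_A_commutator h2 h3); have V2 := VR _ (sec_A_commutator h3 h1).
    have V3 := VR _ (sec_A_commutator h1 h2).
    rewrite !(linear_partE L Rlin)//; [|exact: AR..].
    by case: L => _ [_ _ _ Jac] _ _; apply: Jac; exact: AR.
- split.
  + by move=> m v /fibA[Rv _]; case: L => _ _ [+ _ _] _; apply.
  + move=> m t v w f /fibA[Rv _] /fibA[Rw _] fC.
    have F0 : fib (RZ Z) m 0 by exact: (fib0 ss (@fib_RZ_full _ _ _ Z)).
    have F1 : fib (RZ Z) m ((1 - t) *: w + 0).
      exact: (fib_lin ss (@fib_RZ_full _ _ _ Z)).
    rewrite -[(1 - t) *: w]addr0 (rho_lin L t Rv F1 fC) (rho_lin L (1 - t) Rw F0 fC).
    by rewrite (rho0 L F0 fC) addr0.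
  + move=> U s f oU Rs _ fC.
    have h : Cinf (fun m => anchor Z m (s m) f).
      by case: L => _ _ [_ _ +] _; apply.
    exact: smooth_on_subset h.
- move=> s' s X f /AR h' /AR h /[dup] VX /VR hX fC.
  have hf : sec (RZ Z) (fun m => f m *: X m).
    exact: (sec_span_M ss (@fib_RZ_full _ _ _ Z) (@sec_RZ_fib _ _ _ Z) fC hX).
  by rewrite !(linear_partE L Rlin)// (br_leibniz L).
Qed.

Lemma in_V_H m v : fib V m v -> fib H m v.
Proof.
move=> /fibV[Rv Sv]; apply/fibH; split=> //.
by have := SS' 0 Sv; rewrite addr0.
Qed.

Lemma in_A_H m v : fib A m v -> fib H m v.
Proof.
move=> /fibA[Rv Sv]; apply/fibH; split=> //.
by have := SS' 1 Sv; rewrite subrK.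
Qed.

Lemma vector_hull_span : vector_hull A V H.
Proof.
split.
- by exists (n + (1 + d'))%N; exact: (vector_bundle_span ss klE' fibH secH).
- by apply: affine_subbundle_span => //; [exact: in_V_H|exact: in_A_H].
(* If 0 were in [A], then - E would be in [V]; but it lies over (-1, 0), against [S_sum]. *)
- move=> m /fib_A_translate /fibV[_]; rewrite sub0r.
  have Oe := OpZ_euler ss; have c1 : Cinf (cst (-1) : M -> R) by exact: Cinf_cst.
  have O0 := @OpZ_zero R n M Z.
  have -> : - s0 m = field_of (fun F => Ffun (cst (-1)) * euler sigma F + 0 : Z -> R) m.
    by rewrite (field_of_comb (cst (-1)) _ (fun _ => 0)) field_of_zero addr0 scaleN1r.
  rewrite (phi0_field ss (OpZ_comb Oe O0 c1)) (phi1_field ss (OpZ_comb Oe O0 c1)).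
  have [z1 z2 _ _] := @op_zero_parts R n M Z sigma m; have [g0 a0 _ _] := euler_parts ss m.
  rewrite (opalpha_comb ss m Oe O0 c1) (opgamma_comb ss) z1 z2 g0 a0 /= => /S_sum; lra.
- move=> m a v /[dup] /fibA[[D DO ->] _] /(fib_fieldA m DO) aA.
  move=> /[dup] /fibH[[D' DO' ->] _] /(fib_field ss fibH m DO') vH.
  (* The component of [v] along (1, 0). As [a] lies over (1, 0) up to [S], subtracting [t *: a]
     leaves an element over [S]. *)
  pose t : R := tE * - opalpha sigma D' m + tI * opgamma sigma D' m; exists t.
  have tC : Cinf (cst (- t) : M -> R) by exact: Cinf_cst.
  rewrite addrC -scaleNr -[X in X *: _]/(cst (- t) m) -field_of_comb.
  apply/(fib_field ss fibV m (OpZ_comb DO DO' tC)).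
  rewrite (opalpha_comb ss m DO DO' tC) (opgamma_comb ss).
  have := in_span_lin (- t) aA (S'S vH); rewrite -/t.
  by congr (S _ _); rewrite /=; ring.
Qed.

Lemma hull_decomposition X : sec H X -> exists f v,
  [/\ Cinf f, sec V v & X = (fun m => f m *: s0 m) + v].
Proof.
move=> /(sec_field ss fibH secH)[D [DO -> DH]].
have aC := Cinf_opalpha ss DO; have gC := Cinf_opgamma ss DO.
pose f : M -> R := tE *: - opalpha sigma D + tI *: opgamma sigma D.
have fC : Cinf f.
  by apply: CinfD; apply: CinfM; try exact: Cinf_cst; [exact: CinfN|].
have Oe := OpZ_euler ss; have fNC := CinfN fC.
pose B : @op R n M Z := fun F => Ffun (- f) * euler sigma F + D F.
have BO : OpZ B by exact: OpZ_comb Oe DO fNC.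
exists f, (field_of B); split=> //.
  apply/(sec_field ss fibV secV); exists B; split=> // m.
  have [g0 a0 _ _] := euler_parts ss m.
  rewrite (opalpha_comb ss m Oe DO fNC) (opgamma_comb ss) g0 a0 mulr0 add0r.
  have := S'S (DH m); congr (S _ _).
  by rewrite -[(- f) m]/(- (tE * - opalpha sigma D m + tI * opgamma sigma D m)); ring.
apply/funext => m; rewrite -[RHS]/(f m *: s0 m + field_of B m) /B field_of_comb.
by rewrite addrA -scalerDl -[(- f) m]/(- f m) subrr scale0r add0r.
Qed.

Lemma lie_algebroid_hull_span :
  lie_algebroid_hull A V (op_commutator Z) H (op_commutator Z) (anchor Z).
Proof.
have L := lie_algebroid_span ss klE' fibH secH.
split=> //; first exact: vector_hull_span.
move=> br' rho' L' ext.
apply: (@hull_unique _ _ _ _ H A V s0 (field_of (XZ Z)) _ _ _ _ L L') => //.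
- exact: (sec_span_lin ss fibH secH).
- exact: (sec_span0 ss fibH secH).
- exact: (sec_span_fib secH).
- exact: (fib_extends ss klE' fibH secH).
- by move=> v /secV[Rv Fv]; apply/secH; split=> // m; exact: in_V_H.
- by move=> v /secA[Rv Fv]; apply/secH; split=> // m; exact: in_A_H.
- exact: sec_euler.
- exact: sec_A_add.
- by move=> f v fC Vv; exact: (sec_span_M ss fibV secV fC Vv).
- exact: hull_decomposition.
- exact: sec_XZ.
- exact: field_XZ_neq0.
Qed.

End AffineBundle.

Theorem theorem20 (R : realType) (n : nat) (M : manifold R n)
    (Z : avbundle M) :
  [/\ special_affine_subbundle (RZ Z) (Tbar Z) (Ttilde Z) (field_of (XZ Z)),
      affine_maps_on_SecZ (Tbar Z) &
      exists br,
        [/\ lie_affgebroid (RZ Z) (Tbar Z) (Ttilde Z) br (anchor Z),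
            bracket_is_commutator (Tbar Z) (Ttilde Z) br &
            lie_algebroid_hull (Tbar Z) (Ttilde Z) br
              (Lbreve Z) (op_commutator Z) (anchor Z)]]
  /\
  [/\ special_affine_subbundle (RZ Z) (Lbar Z) (Ltilde Z) (field_of (XZ Z)),
      affine_maps_on_SecZ (Lbar Z) &
      exists br,
        [/\ lie_affgebroid (RZ Z) (Lbar Z) (Ltilde Z) br (anchor Z),
            bracket_is_commutator (Lbar Z) (Ltilde Z) br &
            lie_algebroid_hull (Lbar Z) (Ltilde Z) br
              (RZ Z) (op_commutator Z) (anchor Z)]].
Proof.
have [sigma ss] := exists_section Z.
have sub (P : M -> @op R n M Z -> Prop) s : sec (restr (RZ Z) P) s <->
    sec (RZ Z) s /\ forall m, fib (restr (RZ Z) P) m (s m) by [].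
split.
(* The model [Ttilde] lies over the zero subspace ([d = 0]), and [Lbreve] over the line spanned by
   (1, 0). The projection of that line onto itself is given by [tE = 1] and [tI = 0]. *)
- pose k0 (j : 'I_0) : R := 0.
  pose k1 (j : 'I_1) : R := 1.
  pose z1 (j : 'I_1) : R := 0.
  have kl0 (i j : 'I_0) : k0 i * k0 j + k0 i * k0 j = (i == j)%:R by case: i.
  have kl1 (i j : 'I_1) : k1 i * k1 j + z1 i * z1 j = (i == j)%:R.
    by rewrite !ord1 eqxx /k1 /z1 mulr1 mulr0 addr0.
  have S0 a b : in_span k0 k0 k0 k0 a b <-> a = 0 /\ b = 0.
    by rewrite /in_span !big_ord0.
  have S1 a b : in_span k1 z1 k1 z1 a b <-> b = 0.
    rewrite /in_span !big_ord1 /k1 /z1 mul1r mul0r addr0 mulr1 mulr0.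
    by split=> [[]|].
  have fV m v : fib (Ttilde Z) m v <-> fib (RZ Z) m v /\
      in_span k0 k0 k0 k0 (- phi0 m v) (phi1 m v).
    rewrite S0; split=> [[Rv -> ->]|[Rv [/eqP + e1]]]; first by rewrite oppr0.
    by rewrite oppr_eq0 => /eqP e0.
  have fA m v : fib (Tbar Z) m v <-> fib (RZ Z) m v /\
      in_span k0 k0 k0 k0 (- phi0 m v - 1) (phi1 m v).
    rewrite S0; split=> [[Rv -> ->]|[Rv [e0 e1]]]; first by rewrite opprK subrr.
    by split=> //; move: e0; lra.
  have fH m v : fib (Lbreve Z) m v <-> fib (RZ Z) m v /\
      in_span k1 z1 k1 z1 (- phi0 m v) (phi1 m v) by rewrite S1.
  have sum0 a b : in_span k0 k0 k0 k0 a b -> a + b = 0.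
    by move=> /S0[-> ->]; rewrite addr0.
  split.
  + exact: (special_affine_span ss kl0 fV (sub _) fA (sub _)).
  + exact: (affine_maps_span fA (sub _) sum0).
  + exists (op_commutator Z); split.
    * exact: (lie_affgebroid_span ss kl0 fV (sub _) fA (sub _)).
    * exact: (bracket_is_commutator_span (sub _) fA (sub _) sum0).
    * apply: (@lie_algebroid_hull_span R n M Z sigma ss 0 k0 k0 k0 k0 kl0 1 k1 z1 k1 z1 kl1
        _ _ _ fV (sub _) fA (sub _) fH (sub _) sum0 1 0).
        by move=> a b /S1 ->; apply/S0; rewrite mulr0 addr0 mul1r subrr.
      by move=> a b t /S0[_ ->]; apply/S1.
(* The model [Ltilde] lies over the line spanned by (1, -1), with dual functional (1, 0), and the
   hull over the whole plane. From (a, b) = (a + b)(1, 0) - b (1, -1) the projection has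
   [tE = tI = 1]. *)
- pose k1 (j : 'I_1) : R := 1.
  pose z1 (j : 'I_1) : R := 0.
  pose n1 (j : 'I_1) : R := -1.
  have kl1 (i j : 'I_1) : k1 i * k1 j + z1 i * n1 j = (i == j)%:R.
    by rewrite !ord1 eqxx /k1 /z1 mulr1 mul0r addr0.
  have S1 a b : in_span k1 n1 k1 z1 a b <-> a + b = 0.
    rewrite /in_span !big_ord1 /k1 /z1 /n1 mul1r mul0r addr0 mulr1 mulrN1.
    split=> [[_ ->]|e]; first by rewrite subrr.
    by split=> //; move: e; lra.
  have fV m v : fib (Ltilde Z) m v <-> fib (RZ Z) m v /\
      in_span k1 n1 k1 z1 (- phi0 m v) (phi1 m v).
    by rewrite S1; split=> -[Rv e]; split=> //; move: e; lra.
  have fA m v : fib (Lbar Z) m v <-> fib (RZ Z) m v /\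
      in_span k1 n1 k1 z1 (- phi0 m v - 1) (phi1 m v).
    by rewrite S1; split=> -[Rv e]; split=> //; move: e; lra.
  have sum0 a b : in_span k1 n1 k1 z1 a b -> a + b = 0 by move=> /S1.
  split.
  + exact: (special_affine_span ss kl1 fV (sub _) fA (sub _)).
  + exact: (affine_maps_span fA (sub _) sum0).
  + exists (op_commutator Z); split.
    * exact: (lie_affgebroid_span ss kl1 fV (sub _) fA (sub _)).
    * exact: (bracket_is_commutator_span (sub _) fA (sub _) sum0).
    * apply: (@lie_algebroid_hull_span R n M Z sigma ss 1 k1 n1 k1 z1 kl1 2 _ _ _ _
      (@unit_dual R)
        _ _ _ fV (sub _) fA (sub _) (@fib_RZ_full _ _ _ Z) (@sec_RZ_fib _ _ _ Z) sum0 1 1).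
        by move=> a b _; apply/S1; ring.
      by move=> a b t _; exact: in_span_full.
Qed.
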